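(* Let $p\in(2,\infty)$ and let $\gamma\in\mathcal{A}_{\mathrm{pin}}$ be a flat-core pinned planar $p$-elastica. Then $\gamma$ is unstable (i.e. not a local minimizer of $\mathcal{B}_p$ in $\mathcal{A}_{\mathrm{pin}}$) either if it contains two adjacent loops in opposite directions, or if a loop touches an endpoint.
   Context: Let $L>0$, $P_0,P_1\in\mathbf{R}^2$ with $|P_0-P_1|<L$, and $$\mathcal{A}_{\mathrm{pin}}:=\{\gamma\in W^{2,p}(0,L;\mathbf{R}^2) : |\gamma'|\equiv1,\ \gamma(0)=P_0,\ \gamma(L)=P_1\},$$ with the topology induced by the $W^{2,p}$-norm. $\mathcal{B}_p[\gamma]:=\int_\gamma|k|^p\,ds$ with $k$ the signed curvature and $s$ the arclength parameter. A local minimizer minimizes $\mathcal{B}_p$ in some neighborhood of itself in $\mathcal{A}_{\mathrm{pin}}$. A pinned $p$-elastica is a critical point of $\mathcal{B}_p$ in $\mathcal{A}_{\mathrm{pin}}$: for some $\lambda\in\mathbf{R}$, $\frac{d}{d\varepsilon}(\mathcal{B}_p+\lambda\mathcal{L})[\gamma+\varepsilon\eta]|_{\varepsilon=0}=0$ for all $\eta\in W^{2,p}(0,L;\mathbf{R}^2)$ with $\eta(0)=\eta(L)=0$, where $\mathcal{L}$ denotes length. Concatenation: for $\gamma_j:[a_j,b_j]\to\mathbf{R}^2$ with $\ell_j=b_j-a_j\ge0$, $\gamma_1\oplus\gamma_2:[0,\ell_1+\ell_2]\to\mathbf{R}^2$ is $\gamma_1(s+a_1)$ for $s\in[0,\ell_1]$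 and $\gamma_2(s+a_2-\ell_1)+\gamma_1(b_1)-\gamma_2(a_2)$ for $s\in[\ell_1,\ell_1+\ell_2]$; iterate for several curves. For $p>2$, let $\mathrm{K}:=\int_0^{\pi/2}(\cos\theta)^{-2/p}d\theta$, let $\phi:[-\mathrm{K},\mathrm{K}]\to[-\frac\pi2,\frac\pi2]$ be the inverse of $x\mapsto\int_0^x|\cos\theta|^{-2/p}d\theta$, and define the unit-length arclength parametrized loop $\gamma^+_{\mathrm{loop}}:[0,1]\to\mathbf{R}^2$ by $\gamma^+_{\mathrm{loop}}(s)=\int_0^s(\cos\vartheta(t),\sin\vartheta(t))\,dt$ with $\vartheta(t)=\pi+2\phi((2t-1)\mathrm{K})$. Let $\gamma^-_{\mathrm{loop}}$ be its reflection in the $e_1$-axis, and $\gamma^{\ell}_{\mathrm{seg}}(s)=(s,0)$, $s\in[0,\ell]$. A flat-core pinned planar $p$-elastica is a pinned $p$-elastica which, up to similarity and reparametrization, is of the form $$\gamma^{L_0}_{\mathrm{seg}}\oplus\bigoplus_{j=1}^N\big(\gamma^{\sigma_j}_{\mathrm{loop}}\oplus\gamma^{L_j}_{\mathrm{seg}}\big)$$ for some integer $N\ge1$, $\sigma_j\in\{+,-\}$, and $L_0,\dots,L_N\ge0$. It contains two adjacent loops in opposite directions if $L_j=0$ and $\sigma_j\ne\sigma_{j+1}$ for some $j\in\{1,\dots,N-1\}$; a loop touches an endpoint if $L_0=0$ or $L_N=0$. *)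

(* Defs.v *)
From HB Require Import structures.
From mathcomp Require Import all_boot all_order all_algebra.
From mathcomp Require Import all_classical all_reals all_analysis.

Set Implicit Arguments.
Unset Strict Implicit.
Unset Printing Implicit Defensive.

Import Order.TTheory GRing.Theory Num.Theory.
Import numFieldNormedType.Exports.

Local Open Scope classical_set_scope.
Local Open Scope ring_scope.

(* poly uses the same notation in ring_scope for the formal derivative. *)
Local Notation "f ^` ()" := (derive1 f) : ring_scope.

Section Plane.
Context {R : realType}.
Implicit Types (u v : 'rV[R]_2).

Definition vec2 (x y : R) : 'rV[R]_2 := \row_j (if j == 0 then x else y).

(* The library norm on 'rV[R]_2 is the sup norm (same topology, hence same
   derivatives); lengths and similarities need the Euclidean one. *)
Definition enorm u : R := Num.sqrt (u 0 0 ^+ 2 + u 0 1 ^+ 2).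

Definition det2 u v : R := u 0 0 * v 0 1 - u 0 1 * v 0 0.

(* Orientation-reversing similarities (\det Q = -1) are included. *)
Definition similarity (S : 'rV[R]_2 -> 'rV[R]_2) : Prop :=
  exists (r : R) (Q : 'M[R]_2) (b : 'rV[R]_2),
    [/\ 0 < r, Q *m Q^T = 1%:M & forall x, S x = r *: (x *m Q) + b].

End Plane.

Section Sobolev.
Context {R : realType}.
Local Notation mu := (@lebesgue_measure R).

Definition Lp_on (p L : R) (f : R -> R) : Prop :=
  (f \_ `]0, L[ : measurableTypeR R -> R) \in Lfun mu p%:E.

(* C^1 functions with compact support in ]0, L[. *)
Definition test_function (L : R) (f : R -> R) : Prop :=
  [/\ forall x, derivable f x 1,
      continuous f^`() &
      exists a b, [/\ 0 < a, b < L & forall x, x \notin `[a, b] -> f x = 0]].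

Definition weak_derivative (L : R) (u v : R -> R) : Prop :=
  forall f, test_function L f ->
    \int[mu]_(x in `]0, L[) (u x * f^`() x) =
    - \int[mu]_(x in `]0, L[) (v x * f x).

(* W^{2,p}(0,L). The elements are continuous representatives, so that boundary
   values make sense. Such a representative is C^1 with absolutely continuous
   derivative; hence the classical derivatives u^`() (everywhere on ]0, L[) and
   u^`()^`() (almost everywhere) exist and agree a.e. with the weak derivatives
   v and w. They are what the functionals below are written with. *)
Definition W2p (p L : R) (u : R -> R) : Prop :=
  {within `[0, L], continuous u} /\
  exists v w, [/\ weak_derivative L u v, weak_derivative L v w,
                  Lp_on p L u, Lp_on p L v & Lp_on p L w].

Definition W2p_plane (p L : R) (u : R -> 'rV[R]_2) : Prop :=
  forall i, W2p p L (fun t => u t 0 i).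

Definition Lp_norm (p L : R) (u : R -> 'rV[R]_2) : \bar R :=
  ('N[mu]_p%:E [EFin \o ((fun t => enorm (u t)) \_ `]0%R, L[)])%E.

Definition W2p_norm (p L : R) (u : R -> 'rV[R]_2) : \bar R :=
  (Lp_norm p L u + Lp_norm p L u^`() + Lp_norm p L u^`()^`())%E.

End Sobolev.

Section Energy.
Context {R : realType}.
Local Notation mu := (@lebesgue_measure R).
Implicit Types (g : R -> 'rV[R]_2).

(* Signed curvature of an immersed curve in an arbitrary parametrization. *)
Definition curvature g (t : R) : R :=
  det2 (g^`() t) (g^`()^`() t) / enorm (g^`() t) ^+ 3.

Definition bending (p L : R) g : R :=
  \int[mu]_(t in `]0, L[) (`|curvature g t| `^ p * enorm (g^`() t)).

Definition curve_length (L : R) g : R :=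
  \int[mu]_(t in `]0, L[) enorm (g^`() t).

Definition A_pin (p L : R) (P0 P1 : 'rV[R]_2) g : Prop :=
  [/\ W2p_plane p L g,
      forall t, t \in `]0, L[ -> enorm (g^`() t) = 1,
      g 0 = P0 & g L = P1].

Definition local_minimizer (p L : R) (P0 P1 : 'rV[R]_2) g : Prop :=
  A_pin p L P0 P1 g /\
  exists2 e : R, 0 < e &
    forall h, A_pin p L P0 P1 h ->
      (W2p_norm p L (fun t => h t - g t)%R < e%:E)%E ->
      bending p L g <= bending p L h.

Definition pinned_elastica (p L : R) (P0 P1 : 'rV[R]_2) g : Prop :=
  A_pin p L P0 P1 g /\
  exists lambda : R, forall eta, W2p_plane p L eta -> eta 0 = 0 -> eta L = 0 ->
    is_derive (0 : R) (1 : R)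
      (fun e : R => bending p L (fun t => g t + e *: eta t) +
                    lambda * curve_length L (fun t => g t + e *: eta t)) (0 : R).

End Energy.

Section FlatCore.
Context {R : realType}.
Local Notation mu := (@lebesgue_measure R).

(* A curve [lo, hi] -> R^2; the values of pt outside [lo, hi] are irrelevant. *)
Record pcurve := PCurve { lo : R; hi : R; pt : R -> 'rV[R]_2 }.

Definition concat (c1 c2 : pcurve) : pcurve :=
  let l1 := hi c1 - lo c1 in
  let l2 := hi c2 - lo c2 in
  PCurve 0 (l1 + l2) (fun s =>
    if s <= l1 then pt c1 (s + lo c1)
    else pt c2 (s + lo c2 - l1) + pt c1 (hi c1) - pt c2 (lo c2)).

Definition oriented_integral (a b : R) (f : R -> R) : R :=
  if a <= b then \int[mu]_(x in `[a, b]) f x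
  else - \int[mu]_(x in `[b, a]) f x.

(* Here and below the integrand is singular at +-pi/2 (cos = 0), where powR
   takes the junk value 0 instead; this is a null set. *)
Definition Kp (p : R) : R :=
  \int[mu]_(x in `[0, pi / 2]) (cos x `^ (- (2 / p))).

Definition amp_integral (p x : R) : R :=
  oriented_integral 0 x (fun y => `|cos y| `^ (- (2 / p))).

(* Inverse of amp_integral p on [-pi/2, pi/2], only meaningful on [-Kp, Kp]. *)
Definition amp (p : R) : R -> R :=
  'pinv_(fun=> 0) `[- (pi / 2), pi / 2] (amp_integral p).

Definition loop_angle (p t : R) : R := pi + 2 * amp p ((2 * t - 1) * Kp p).

(* The sign + is encoded by true, - by false (reflection in the e_1-axis). *)
Definition loop (p : R) (sigma : bool) : pcurve :=
  PCurve 0 1 (fun s =>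
    let x := \int[mu]_(t in `[0, s]) cos (loop_angle p t) in
    let y := \int[mu]_(t in `[0, s]) sin (loop_angle p t) in
    vec2 x (if sigma then y else - y)).

Definition seg (l : R) : pcurve := PCurve 0 l (fun s => vec2 s 0).

(* sigma is used at the indices 1..N only, l at 0..N. *)
Fixpoint flat_core (p : R) (sigma : nat -> bool) (l : nat -> R) (N : nat) :
    pcurve :=
  if N is n.+1 then
    concat (flat_core p sigma l n) (concat (loop p (sigma N)) (seg (l N)))
  else seg (l 0%N).

(* Orientation-reversing changes of parameter are allowed. *)
Definition reparametrization (a b c d : R) (psi : R -> R) : Prop :=
  [/\ set_bij `[a, b] `[c, d] psi,
      {within `[a, b], continuous psi} &
      forall t, t \in `]a, b[ -> derivable psi t 1 /\ psi^`() t != 0].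

Definition same_shape (L : R) (g : R -> 'rV[R]_2) (c : pcurve) : Prop :=
  exists S psi, [/\ similarity S, reparametrization 0 L (lo c) (hi c) psi &
    forall t, t \in `[0, L] -> g t = S (pt c (psi t))].

Definition flat_core_form (p L : R) (g : R -> 'rV[R]_2)
    (N : nat) (sigma : nat -> bool) (l : nat -> R) : Prop :=
  [/\ (1 <= N)%N, forall j, (j <= N)%N -> 0 <= l j &
      same_shape L g (flat_core p sigma l N)].

Definition flat_core_pinned_elastica (p L : R) (P0 P1 : 'rV[R]_2)
    (g : R -> 'rV[R]_2) : Prop :=
  pinned_elastica p L P0 P1 g /\
  exists N sigma l, flat_core_form p L g N sigma l.

Definition has_adjacent_opposite_loops (p L : R) (g : R -> 'rV[R]_2) : Prop :=
  exists N sigma l, flat_core_form p L g N sigma l /\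
    exists j, [/\ (1 <= j < N)%N, l j = 0 & sigma j != sigma j.+1].

Definition loop_touches_endpoint (p L : R) (g : R -> 'rV[R]_2) : Prop :=
  exists N sigma l, flat_core_form p L g N sigma l /\
    (l 0%N = 0 \/ l N = 0).

End FlatCore.

(* Main.v *)
(* Let m be the arclength at which a loop touches an endpoint, or at which two
   opposite loops meet. Cut a piece of length u off each loop at m (for two
   loops the tangent angles still match by symmetry), dilate what is left of them
   by a factor t in ]1, 1 + u], and spend the remaining length on a straight
   segment at their other ends. For t = 1 the displacement of the whole curve
   increases by o(u), since the removed piece was almost straight; for t = 1 + u
   it decreases by an amount of order u, since the displacement of a loop is
   smaller than its length. By the intermediate value theorem some t keeps the
   distance of the endpoints, and a small rotation restores the endpoints. The
   dilation makes the energy of the loops strictly smaller (it multiplies it by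
   t^(1 - p)), and the new curve is W^{2,p}-close to the old one because the
   curvature of a loop is continuous and vanishes at its ends. *)
Require Import Defs.
From mathcomp Require Import all_boot all_order all_algebra.
From mathcomp Require Import all_classical all_reals all_analysis.
From mathcomp Require Import ring lra measurable_realfun.

Set Implicit Arguments.
Unset Strict Implicit.
Unset Printing Implicit Defensive.

Import Order.TTheory GRing.Theory Num.Theory.
Import numFieldNormedType.Exports.

Local Open Scope classical_set_scope.
Local Open Scope ring_scope.
Local Notation "f ^` ()" := (derive1 f) : ring_scope.

(** * Primitives of continuous functions *)
Section Calculus.
Context {R : realType}.
Local Notation mu := (@lebesgue_measure R).
Implicit Types (f g F : R -> R) (x : R).

(** All curves are handled through their tangent angle: the endpoints are integrals of its cosine
    and sine, and uniform closeness of angle and curvature gives [W2p_norm]-closeness. One formula,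
    [sg * Th (1 - u - la * |s - m|)] plus the angle of the other loops, covers every position of
    [m]: a first loop read backwards, a last loop, or two opposite loops, whose angle climbs to 2 pi
    and returns. With two loops the cut makes the curvature jump at [m], by an amount that tends to
    0 with [u]; hence second derivatives are only piecewise continuous. Since [1 - u <= la], a
    dilated remainder has length (1 - u) / la at most 1 and does not reach the neighbouring loops.
    The final rotation needs a chord of positive length, which comes from the positive displacement
    of each loop. The assumption on p gives q = 2 / p < 1, so that the singular integral behind the
    amplitude converges. *)

Lemma is_derive_continuous f x (d : R) : is_derive (x : R) (1 : R) f d -> {for x, continuous f}.
Proof. by move=> [df _]; apply/differentiable_continuous/derivable1_diffP. Qed.

Lemma is_derive_continuousT f (f' : R -> R) :
  (forall x, is_derive x 1 f (f' x)) -> continuous f.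
Proof. by move=> df x; exact: is_derive_continuous (df x). Qed.

Lemma deriveD_fun f g x (a b : R) : is_derive x (1 : R) f a -> is_derive x (1 : R) g b ->
  is_derive x (1 : R) (fun y => f y + g y) (a + b).
Proof. by move=> df dg; exact: is_deriveD. Qed.

Lemma deriveN_fun f x (a : R) : is_derive x (1 : R) f a ->
  is_derive x (1 : R) (fun y => - f y) (- a).
Proof. by move=> df; exact: is_deriveN. Qed.

Lemma deriveB_fun f g x (a b : R) : is_derive x (1 : R) f a -> is_derive x (1 : R) g b ->
  is_derive x (1 : R) (fun y => f y - g y) (a - b).
Proof. by move=> df dg; exact: is_deriveB. Qed.

Lemma deriveM_fun f g x (a b : R) : is_derive x (1 : R) f a -> is_derive x (1 : R) g b ->
  is_derive x (1 : R) (fun y => f y * g y) (a * g x + f x * b).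
Proof.
move=> df dg; apply: (is_derive_eq (is_deriveM df dg)).
by rewrite addrC /GRing.scale/= (mulrC (g x)).
Qed.

Lemma derive_comp_fun f g x (a b : R) : is_derive (g x) (1 : R) f a ->
  is_derive x (1 : R) g b -> is_derive x (1 : R) (fun y => f (g y)) (a * b).
Proof. by move=> df dg; exact: is_derive1_comp. Qed.

Lemma derive_cst_fun (c x : R) : is_derive x (1 : R) (fun=> c) (0 : R).
Proof. exact: is_derive_cst. Qed.

Lemma derive_affine_fun (a b x : R) : is_derive x (1 : R) (fun y => a * y + b) a.
Proof.
apply: (is_derive_eq (deriveD_fun (deriveM_fun (derive_cst_fun a x)
  (is_derive_id x (1 : R))) (derive_cst_fun b x))).
by rewrite mul0r mulr1 add0r addr0.
Qed.

Lemma near_itvoo (a b x : R) : a < x < b -> \forall y \near x, a < y < b.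
Proof.
move=> axb; have : x \in `]a, b[ by rewrite in_itv.
by move/near_in_itvoo; apply: filterS => y; rewrite in_itv.
Qed.

Lemma derive0_within_cst f (a b : R) : {within `[a, b], continuous f} ->
  (forall x, a < x < b -> is_derive x 1 f 0) ->
  {in `[a, b] &, forall x y, f x = f y}.
Proof.
move=> cf df.
suff H x y : a <= x -> x <= y -> y <= b -> f x = f y.
  move=> x y; rewrite !in_itv/= => /andP[ax xb] /andP[ay yb].
  have [xy|/ltW yx] := leP x y; first exact: H.
  by rewrite (H _ _ ay yx).
move=> ax xy yb.
have [||c _] := @MVT_segment R f (fun=> 0) x y xy.
- move=> z; rewrite in_itv/= => /andP[xz zy]; apply: df.
  by rewrite (le_lt_trans ax xz) (lt_le_trans zy yb).
- apply: continuous_subspaceW cf; apply: subset_itvScc; rewrite bnd_simp//.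
- by rewrite mul0r => /eqP; rewrite subr_eq0 => /eqP.
Qed.

Lemma integrable_sub_itvcc f (a b c d : R) : mu.-integrable `[a, b] (EFin \o f) ->
  a <= c -> d <= b -> mu.-integrable `[c, d] (EFin \o f).
Proof.
move=> intf ac db; apply: (@integrableS _ _ _ mu `[a, b]) => //.
by apply: subset_itvScc; rewrite bnd_simp.
Qed.

Lemma continuous_integrable_itvcc f (a b : R) : {within `[a, b], continuous f} ->
  mu.-integrable `[a, b] (EFin \o f).
Proof. by move=> cf; apply: continuous_compact_integrable => //; exact: segment_compact. Qed.

Lemma Rintegral_splitcc f (a b c : R) : a <= c <= b ->
  mu.-integrable `[a, b] (EFin \o f) ->
  \int[mu]_(x in `[a, b]) f x =
  \int[mu]_(x in `[a, c]) f x + \int[mu]_(x in `[c, b]) f x.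
Proof.
move=> /andP[ac cb] intf.
have := @Rintegral_itvB _ f (BLeft a) (BRight b) c intf.
rewrite !bnd_simp => /(_ ac cb) /eqP; rewrite subr_eq => /eqP ->.
rewrite addrC; congr (_ + _); apply: Rintegral_itv_obnd_cbnd.
by apply: integrableS intf => //; apply: subset_itv; rewrite bnd_simp.
Qed.

(** Moving the base point from 0 to the left end [a] removes the sign distinction, so that
    continuity and differentiability can be obtained on both sides of 0 at once. *)
Lemma oriented_integralE f (a b x : R) : a <= 0 <= b -> a <= x <= b ->
  mu.-integrable `[a, b] (EFin \o f) ->
  oriented_integral 0 x f =
  \int[mu]_(t in `[a, x]) f t - \int[mu]_(t in `[a, 0]) f t.
Proof.
move=> /andP[a0 b0] /andP[ax xb] intf; rewrite /oriented_integral; case: ifPn => [x0|].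
  rewrite (@Rintegral_splitcc f a x 0) ?a0//; first by rewrite addrAC subrr add0r.
  exact: integrable_sub_itvcc intf _ _.
rewrite -ltNge => /ltW x0; rewrite (@Rintegral_splitcc f a 0 x) ?ax//.
  by rewrite opprD addrA subrr add0r.
exact: integrable_sub_itvcc intf _ _.
Qed.

Lemma oriented_integral_is_derive f (a b x : R) : a <= 0 <= b -> a < x < b ->
  mu.-integrable `[a, b] (EFin \o f) -> {for x, continuous f} ->
  is_derive x 1 (fun x => oriented_integral 0 x f) (f x).
Proof.
move=> a0b /andP[ax xb] intf cf.
apply: (@near_eq_is_derive _ _ _ (fun x => \int[mu]_(t in `[a, x]) f t - \int[mu]_(t in `[a, 0]) f t)).
  have := @near_itvoo a b x; rewrite ax xb => /(_ isT); apply: filterS => y /andP[ay yb].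
  by apply/esym/(@oriented_integralE f a b y) => //; rewrite !ltW.
have [dF F'] := @continuous_FTC1_closed R f a x b xb intf ax cf.
have dF1 : is_derive x (1 : R) (fun x => \int[mu]_(t in `[a, x]) f t) (f x).
  by split; [exact: dF | rewrite -derive1E F'].
by apply: (is_derive_eq (deriveB_fun dF1 (derive_cst_fun _ x))); rewrite subr0.
Qed.

Lemma oriented_integral_within_continuous f (a b : R) : a <= 0 <= b ->
  mu.-integrable `[a, b] (EFin \o f) ->
  {within `[a, b], continuous (fun x => oriented_integral 0 x f)}.
Proof.
move=> a0b intf; have ab : a <= b by case/andP: a0b; exact: le_trans.
have := parameterized_integral_continuous ab intf.
move=> /(_ _) H; apply: (@subspace_eq_continuous _ _ _
  (fun x => \int[mu]_(t in `[a, x]) f t - \int[mu]_(t in `[a, 0]) f t)).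
  move=> x; rewrite inE/= in_itv/= => axb.
  exact/esym/(@oriented_integralE f a b x).
by move=> x; apply: cvgB; [exact: H|exact: cvg_cst].
Qed.

(** Oriented, so that a continuous function has a primitive that is differentiable on the whole
    line, 0 included. [amp_integral p] is an instance. *)
Definition prim f x := oriented_integral 0 x f.

Lemma prim0 f : prim f 0 = 0.
Proof. by rewrite /prim /oriented_integral lexx set_itv1 Rintegral_set1. Qed.

Lemma prim_ge0E f x : 0 <= x -> prim f x = \int[mu]_(t in `[0, x]) f t.
Proof. by rewrite /prim /oriented_integral => ->. Qed.

Lemma prim_derive f x : continuous f -> is_derive x 1 (prim f) (f x).
Proof.
move=> cf; have [h1 h2] : x <= `|x| /\ - x <= `|x| by split; rewrite ?ler_norm// -normrN ler_norm.
apply: (@oriented_integral_is_derive f (- `|x| - 1) (`|x| + 1)).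
- by apply/andP; split; have := normr_ge0 x; lra.
- by apply/andP; split; lra.
- by apply: continuous_integrable_itvcc; exact: continuous_subspaceT.
- exact: cf.
Qed.

Lemma prim_unique f F : continuous f -> (forall x, is_derive x 1 F (f x)) ->
  forall x, prim f x = F x - F 0.
Proof.
move=> cf dF x.
have d0 y : is_derive y (1 : R) (fun x => prim f x - F x) 0.
  by apply: (is_derive_eq (deriveB_fun (prim_derive y cf) (dF y))); rewrite subrr.
have /eqP := is_derive_0_is_cst x 0 d0.
by rewrite prim0 sub0r subr_eq addrC => /eqP.
Qed.

Lemma FTC2_prim f (a b : R) : continuous f -> a <= b ->
  \int[mu]_(t in `[a, b]) f t = prim f b - prim f a.
Proof.
move=> cf; rewrite le_eqVlt => /predU1P[->|ab].
  by rewrite set_itv1 Rintegral_set1 subrr.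
have dp x := prim_derive x cf; rewrite /Rintegral (@continuous_FTC2 R f (prim f))//.
- exact: continuous_subspaceT.
- split; first by move=> x _; case: (dp x).
    by apply: cvg_at_right_filter; exact: is_derive_continuous (dp a).
  by apply: cvg_at_left_filter; exact: is_derive_continuous (dp b).
- by move=> x _; rewrite derive1E; case: (dp x).
Qed.

End Calculus.

(** * The angle of a loop *)
Section Amplitude.
Context {R : realType}.
Local Notation mu := (@lebesgue_measure R).

(** For small [r] there is no derivative at 0, so continuity there is checked directly, with radius
    e^(1/r); elsewhere it follows from the derivative. *)
Lemma continuous_normpowR (r : R) : 0 < r -> continuous (fun x : R => `|x| `^ r).
Proof.
move=> r0 x; have [->|x0] := eqVneq x 0.
  apply/cvgrPdist_lt => e e0; rewrite normr0 powR0 ?gt_eqF//.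
  near=> y; rewrite sub0r normrN ger0_norm ?powR_ge0//.
  rewrite -[e]powRr1 ?ltW// -(mulVf (lt0r_neq0 r0)) powRrM gt0_ltr_powR ?nnegrE ?powR_ge0//.
  near: y; have e'0 : 0 < e `^ r^-1 by rewrite powR_gt0.
  by have := @nbhs0_lt R R^o _ e'0.
apply: (@continuous_comp _ _ _ (fun x : R => `|x|) (fun y : R => y `^ r)).
  exact: norm_continuous.
by have := is_derive1_powR r (_ : 0 < `|x|); rewrite normr_gt0 => /(_ x0)/is_derive_continuous.
Unshelve. all: end_near. Qed.

Lemma is_derive_normcos_powR (a y : R) : - (pi / 2) < y < pi / 2 ->
  is_derive y (1 : R) (fun y => `|cos y| `^ a) (- a * sin y * `|cos y| `^ (a - 1)).
Proof.
move=> hy; have cy := cos_gt0_pihalf hy.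
apply: (@near_eq_is_derive _ _ _ (fun y => cos y `^ a)).
  have := near_itvoo hy; apply: filterS => z hz.
  by rewrite ger0_norm// ltW// cos_gt0_pihalf.
apply: (is_derive_eq (derive_comp_fun (is_derive1_powR a cy) (is_derive_cos y))).
by rewrite ger0_norm ?(ltW cy)//; ring.
Qed.

Variable q : R.
Hypothesis q01 : 0 < q < 1.
Local Notation f := (fun y : R => `|cos y| `^ (- q)).

Lemma amp_integrand_continuous (y : R) : - (pi / 2) < y < pi / 2 -> {for y, continuous f}.
Proof. by move=> hy; exact: is_derive_continuous (is_derive_normcos_powR (- q) hy). Qed.

(** The point is that the bound does not depend on [x]: it survives the passage to the singular
    ends, and it is finite because q < 1. *)
Lemma amp_integrand_bound (x : R) : 0 <= x < pi / 2 ->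
  (\int[mu]_(y in `[(- x)%R, x]) (`|cos y| `^ (- q))%:E <= ((1 + (1 - q)^-1) * pi)%:E)%E.
Proof.
move=> /andP[x0 xpi]; have [q0 q1] := andP q01.
(* Integrating by parts leaves a multiple of cos^(2 - q); adding this constant turns it into the
   nonnegative c (1 - cos^(2 - q)), so that [g] dominates the integrand. *)
pose c := 1 + (1 - q)^-1; have c0 : 0 < c by rewrite /c addr_gt0// invr_gt0 subr_gt0.
have q1N : 1 - q != 0 by rewrite subr_eq0 gt_eqF.
(* Integration by parts: G is a primitive of g, and g = f + c (1 - cos^(2 - q)). *)
pose g y := - (1 - q)^-1 * (cos y * `|cos y| `^ (1 - q) +
  sin y * (- (1 - q) * sin y * `|cos y| `^ (1 - q - 1))) + c.
pose G y := - (1 - q)^-1 * (sin y * `|cos y| `^ (1 - q)) + c * y.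
have sub y : - x <= y <= x -> - (pi / 2) < y < pi / 2.
  by move=> /andP[? ?]; apply/andP; split; lra.
have dG y : - x <= y <= x -> is_derive y (1 : R) G (g y).
  move=> /sub hy.
  have d1 := deriveM_fun (derive_cst_fun (- (1 - q)^-1) y)
    (deriveM_fun (is_derive_sin y) (is_derive_normcos_powR (1 - q) hy)).
  apply: (is_derive_eq (deriveD_fun d1 (deriveM_fun (derive_cst_fun c y) (is_derive_id y (1 : R))))).
  by rewrite /g; ring.
have gE y : - x <= y <= x -> g y = `|cos y| `^ (- q) + c * (1 - `|cos y| `^ (2 - q)).
  move=> /sub hy; have cy := cos_gt0_pihalf hy.
  rewrite /g ger0_norm ?(ltW cy)//.
  have -> : cos y `^ (1 - q) = cos y * cos y `^ (- q).
    by rewrite powRD ?(gt_eqF cy) ?implybT// powRr1// ltW.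
  have -> : cos y `^ (2 - q) = cos y ^+ 2 * cos y `^ (- q).
    by rewrite powRD ?(gt_eqF cy) ?implybT// (powR_mulrn 2) ?(ltW cy).
  have -> : 1 - q - 1 = - q by ring.
  transitivity (cos y `^ (- q) * (- (1 - q)^-1 * cos y ^+ 2 + sin y ^+ 2) + c); first by field.
  by rewrite sin2cos2 /c; field.
have cf : {within `[- x, x], continuous f}.
  by apply: continuous_in_subspaceT => y; rewrite inE/= in_itv/= => /sub /amp_integrand_continuous.
have cg : {within `[- x, x], continuous g}.
  apply: (@subspace_eq_continuous _ _ _ (fun y => `|cos y| `^ (- q) + c * (1 - `|cos y| `^ (2 - q)))).
    by move=> y; rewrite inE/= in_itv/= => /gE.
  have cc : continuous (fun y : R => c * (1 - `|cos y| `^ (2 - q))).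
    move=> y; apply: cvgM; first exact: cvg_cst.
    apply: cvgB; first exact: cvg_cst.
    apply: (@continuous_comp _ _ _ cos (fun z : R => `|z| `^ (2 - q))).
      exact: continuous_cos.
    by apply: continuous_normpowR; lra.
  move=> y; apply: cvgD; first exact: cf.
  exact: (continuous_subspaceT cc).
rewrite -(fineK (integrable_fin_num _ (continuous_integrable_itvcc cf)))// lee_fin.
have fg : \int[mu]_(y in `[- x, x]) `|cos y| `^ (- q) <= \int[mu]_(y in `[- x, x]) g y.
  apply: le_Rintegral => //; try exact: continuous_integrable_itvcc.
  move=> y /=; rewrite in_itv/= => hy; rewrite gE// lerDl mulr_ge0// ?(ltW c0)//.
  have cy := cos_gt0_pihalf (sub _ hy).
  have q2 : 0 <= 2 - q by lra.
  by have := ge0_ler_powR q2 (_ : `|cos y| \in Num.nneg) (_ : 1 \in Num.nneg) (cos_max y);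
    rewrite powR1 !nnegrE subr_ge0; apply.
apply: (le_trans fg); case: (eqVneq x 0) => [->|xN0].
  by rewrite oppr0 set_itv1 Rintegral_set1 mulr_ge0 ?pi_ge0// ltW.
have {}x0 : 0 < x by rewrite lt_def xN0.
rewrite /Rintegral (@continuous_FTC2 R g G) //.
- rewrite /= -/c /G cosN sinN.
  have S : 0 <= (1 - q)^-1 * (sin x * `|cos x| `^ (1 - q)).
    rewrite mulr_ge0 ?invr_ge0 ?subr_ge0 ?(ltW q1)// mulr_ge0 ?powR_ge0//.
    by apply/ltW/sin_gt0_pihalf; rewrite x0.
  have : c * x <= c * (pi / 2) by rewrite ler_pM2l// ltW.
  by lra.
- by lra.
- split.
  + move=> y; rewrite in_itv/= => /andP[? ?].
    by have yx : - x <= y <= x; [rewrite !ltW|case: (dG _ yx)].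
  + apply: cvg_at_right_filter; apply: is_derive_continuous (dG (- x) _).
    by apply/andP; split; lra.
  + apply: cvg_at_left_filter; apply: is_derive_continuous (dG x _).
    by apply/andP; split; lra.
- move=> y; rewrite in_itv/= derive1E => /andP[? ?].
  by have yx : - x <= y <= x; [rewrite !ltW|case: (dG _ yx)].
Qed.

(** Monotone convergence along the segments [[- h n, h n]], on which the uniform bound applies; the
    two singular ends are a null set and are removed first. *)
Lemma amp_integrable : mu.-integrable `[- (pi / 2), pi / 2] (EFin \o f).
Proof.
have pi0 := @pi_gt0 R; have [q0 q1] := andP q01.
have mf D : measurable_fun D f.
  apply: (@measurable_funS _ _ _ _ setT) => //.
  apply: (@measurableT_comp _ _ _ _ _ _ (fun y : R => y `^ (- q))) => //.
  apply: (@measurableT_comp _ _ _ _ _ _ (fun x : R => `|x|)) => //; apply: continuous_measurable_fun; exact: continuous_cos.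
apply/integrableP; split; first by apply/measurable_EFinP; exact: mf.
have f0 (x : R) : `|(f x)%:E|%E = (f x)%:E by rewrite gee0_abs// lee_fin powR_ge0.
under eq_integral do rewrite f0.
rewrite -integral_itv_obnd_cbnd; last by apply/measurable_EFinP; exact: mf.
rewrite -integral_itv_bndo_bndc; last by apply/measurable_EFinP; exact: mf.
pose h n : R := pi / 2 - pi / 2 / n.+1%:R.
have hn n : 0 <= h n < pi / 2.
  rewrite /h; have n0 : 0 < n.+1%:R :> R by [].
  rewrite subr_ge0 ler_pdivrMr// ler_peMr ?ler1n//=; last by lra.
  by rewrite gtrBl divr_gt0//; lra.
have hS n : h n <= h n.+1.
  by rewrite lerD2l lerN2 ler_pM2l ?divr_gt0// lef_pV2 ?posrE// ler_nat.
have -> : `]- (pi / 2), pi / 2[%classic = \bigcup_n `[- h n, h n]%classic.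
  apply/seteqP; split => x /=; last first.
    move=> [n _]; rewrite /= !in_itv/= => /andP[? ?]; have /andP[? ?] := hn n.
    by apply/andP; split; lra.
  rewrite in_itv/= => /andP[x1 x2].
  have d0 : 0 < pi / 2 - `|x|.
    by rewrite subr_gt0 ltr_norml x1.
  pose n := Num.trunc (pi / 2 / (pi / 2 - `|x|)).
  exists n => //=; rewrite in_itv/= -ler_norml /h.
  have n0 : 0 < n.+1%:R :> R by [].
  have : pi / 2 / n.+1%:R < pi / 2 - `|x|.
    by rewrite ltr_pdivrMr// [ltRHS]mulrC -ltr_pdivrMr//; exact: truncnS_gt.
  by move=> /ltW; rewrite lerBrDr -lerBrDl.
have hcvg : (\int[mu]_(x in `[(- h i)%R, h i]) (EFin \o f) x @[i --> \oo] -->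
    \int[mu]_(x in \bigcup_n `[(- h n)%R, h n]%classic) (EFin \o f) x)%E.
  apply: ge0_nondecreasing_set_cvg_integral => //.
  - apply/nondecreasing_seqP => n; rewrite subsetEset; apply: subset_itvScc; rewrite bnd_simp.
      by rewrite lerN2.
    exact: hS.
  - by move=> i; apply/measurable_EFinP; exact: mf.
  - by move=> i x _; rewrite lee_fin powR_ge0.
apply: (@le_lt_trans _ _ ((1 + (1 - q)^-1) * pi)%:E); last by rewrite ltry.
rewrite -(cvg_lim _ hcvg)//; apply: lime_le; first exact: cvgP hcvg.
by apply: nearW => n; exact: amp_integrand_bound.
Qed.

Local Notation h := (pi / 2 : R).
Local Notation I := (prim f).

Let h0 : 0 < h. Proof. by rewrite divr_gt0// pi_gt0. Qed.
Let h00 : - h <= 0 <= h. Proof. by rewrite oppr_le0 ltW. Qed.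

Lemma amp_prim_is_derive (y : R) : - h < y < h -> is_derive y (1 : R) I (f y).
Proof.
move=> hy; apply: (oriented_integral_is_derive h00 hy amp_integrable).
exact: amp_integrand_continuous.
Qed.

Lemma amp_prim_continuous : {within `[- h, h], continuous I}.
Proof. exact: oriented_integral_within_continuous amp_integrable. Qed.

Lemma continuousN_within (g : R -> R) (a : R) : {within `[- a, a], continuous g} ->
  {within `[- a, a], continuous (fun y => g (- y))}.
Proof.
move=> cg; apply/subspace_continuousP => x; rewrite /= in_itv/= => /andP[x1 x2].
have /subspace_continuousP/(_ (- x)) := cg; rewrite /= in_itv/= lerN2 lerNl x1 x2 => /(_ isT) H.
apply: (@cvg_comp _ _ _ -%R g _ (within `[- a, a]%classic (nbhs (- x))) _ _ H).
have cN : {for x, continuous (fun y : R => - y)}.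
  exact: is_derive_continuous (deriveN_fun (is_derive_id x (1 : R))).
move=> P /cN HP; change (nbhs x (fun y => `[- a, a]%classic y -> P (- y))).
have {}HP : nbhs x (fun y => `[- a, a]%classic (- y) -> P (- y)) := HP.
apply: filterS HP => y /= HP; rewrite in_itv/= => hy.
by apply: HP; rewrite /= in_itv/= lerN2 lerNl andbC.
Qed.

Lemma amp_prim_odd (y : R) : - h <= y <= h -> I (- y) = - I y.
Proof.
move=> hy; apply/eqP; rewrite -subr_eq0 opprK addrC; apply/eqP.
have E := @derive0_within_cst _ (fun y => I y + I (- y)) (- h) h.
rewrite (E _ _ y 0) ?in_itv//=; first by rewrite oppr0 !prim0 addr0.
  move=> z; apply: cvgD; first exact: amp_prim_continuous.
  exact: (continuousN_within amp_prim_continuous).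
move=> x hx; have hNx : - h < - x < h by rewrite ltrN2 ltrNl andbC.
have d1 := derive_comp_fun (amp_prim_is_derive hNx) (deriveN_fun (is_derive_id x (1 : R))).
by apply: (is_derive_eq (deriveD_fun (amp_prim_is_derive hx) d1)); rewrite cosN mulrN1 subrr.
Qed.

Lemma amp_prim_lt : {in `[- h, h] &, {homo I : x y / x < y}}.
Proof.
move=> x y; rewrite !in_itv/= => /andP[x1 x2] /andP[y1 y2] xy.
have sub z : x < z < y -> - h < z < h by move=> /andP[? ?]; apply/andP; split; lra.
have [||c] := @MVT R I f x y xy.
- by move=> z; rewrite in_itv/= => /sub/amp_prim_is_derive.
- by apply: continuous_subspaceW amp_prim_continuous; apply: subset_itvScc; rewrite bnd_simp.
- rewrite in_itv/= => /sub cxy E; rewrite -subr_gt0 E mulr_gt0 ?subr_gt0//.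
  by rewrite powR_gt0// normr_gt0 gt_eqF// cos_gt0_pihalf.
Qed.

Local Notation K := (I h).

Lemma amp_K_gt0 : 0 < K.
Proof. by rewrite -(prim0 f) amp_prim_lt// in_itv/= ?h00// lexx andbT; case/andP: h00; lra. Qed.

Lemma amp_primNh : I (- h) = - K.
Proof. by apply: amp_prim_odd; rewrite lexx andbT; case/andP: h00; lra. Qed.

Local Notation A := ('pinv_(fun=> 0) `[- h, h] I).

Lemma amp_primK : {in `[- h, h], cancel I A}.
Proof.
move=> x; rewrite in_itv/= => hx; apply: pinvKV; last by rewrite inE/= in_itv.
move=> y z; rewrite !inE/= => hy hz E; apply/eqP; apply: contraT.
by rewrite neq_lt => /orP[] /amp_prim_lt; rewrite E ltxx => /(_ _ _)->.
Qed.

(** The intermediate value theorem makes the primitive surjective onto [-K, K], which turns the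
    one-sided inverse into a two-sided one. *)
Lemma ampK : {in `[- K, K], cancel A I}.
Proof.
rewrite -amp_primNh; apply: segment_continuous_le_can_sym; last exact: amp_primK.
  by case/andP: h00; lra.
exact: amp_prim_continuous.
Qed.

Lemma amp_continuous : {within `[- K, K], continuous A}.
Proof.
rewrite -amp_primNh; apply: segment_can_le_continuous; last exact: amp_primK.
  by case/andP: h00; lra.
exact: amp_prim_continuous.
Qed.

Lemma amp_le : {in `[- K, K] &, {mono A : x y / x <= y}}.
Proof.
rewrite -amp_primNh; apply: segment_can_le; last exact: amp_primK.
  by case/andP: h00; lra.
exact: amp_prim_continuous.
Qed.

Lemma amp_lt : {in `[- K, K] &, {mono A : x y / x < y}}.
Proof. exact: leW_mono_in amp_le. Qed.

Lemma amp_Kh : A K = h.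
Proof. by apply: amp_primK; rewrite in_itv/= lexx andbT; case/andP: h00; lra. Qed.

Lemma amp_0 : A 0 = 0.
Proof. by have := @amp_primK 0; rewrite prim0; apply; rewrite in_itv. Qed.

Lemma amp_NKh : A (- K) = - h.
Proof. by rewrite -amp_primNh; apply: amp_primK; rewrite in_itv/= lexx; case/andP: h00; lra. Qed.

Lemma amp_itv (x : R) : - K <= x <= K -> - h <= A x <= h.
Proof.
have K0 := amp_K_gt0; move=> hx; have /andP[x1 x2] := hx.
have Ki : K \in `[- K, K] by rewrite in_itv/= lexx andbT; lra.
have NKi : - K \in `[- K, K] by rewrite in_itv/= lexx; lra.
have xi : x \in `[- K, K] by rewrite in_itv/= x1.
have := amp_le NKi xi; have := amp_le xi Ki.
by rewrite amp_Kh amp_NKh x1 x2 => -> ->.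
Qed.

Lemma amp_itvoo (x : R) : - K < x < K -> - h < A x < h.
Proof.
have K0 := amp_K_gt0; move=> /andP[x1 x2].
have Ki : K \in `[- K, K] by rewrite in_itv/= lexx andbT; lra.
have NKi : - K \in `[- K, K] by rewrite in_itv/= lexx; lra.
have xi : x \in `[- K, K] by rewrite in_itv/= !ltW.
have := amp_lt NKi xi; have := amp_lt xi Ki.
by rewrite amp_Kh amp_NKh x1 x2 => -> ->.
Qed.

Lemma amp_odd (x : R) : - K <= x <= K -> A (- x) = - A x.
Proof.
move=> hx; have hA := amp_itv hx.
rewrite -[in LHS](@ampK x) ?in_itv//= -amp_prim_odd// amp_primK// in_itv/= lerN2 lerNl.
by case/andP: hA => -> ->.
Qed.

(** The inverse function theorem inverts the integrand, so its singularity at the ends becomes a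
    zero. This is why the curvature of a loop vanishes where the loop starts and stops. *)
Lemma amp_is_derive (x : R) : - K < x < K -> is_derive x (1 : R) A (`|cos (A x)| `^ q).
Proof.
move=> hx; have hA := amp_itvoo hx; have /andP[x1 x2] := hx.
have xE : I (A x) = x by apply: ampK; rewrite in_itv/= !ltW.
have f0 : f (A x) != 0 by rewrite gt_eqF// powR_gt0// normr_gt0 gt_eqF// cos_gt0_pihalf.
rewrite -{1}xE -[_ `^ q]invrK -powRN; apply: (@is_derive_inverse R I A).
- have := near_itvoo hA; apply: filterS => y /andP[y1 y2].
  by apply: amp_primK; rewrite in_itv/= !ltW.
- have := near_itvoo hA; apply: filterS => y /amp_prim_is_derive.
  exact: is_derive_continuous.
- exact: amp_prim_is_derive.
- exact: f0.
Qed.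

End Amplitude.

(** * The tangent angle of a loop as a function on the whole line *)

Section LoopProfile.
Context {R : realType}.
Local Notation mu := (@lebesgue_measure R).

(* Th is the tangent angle of a loop, extended by 0 and 2 pi outside [0, 1];
   ka is its curvature, which is continuous because it vanishes at the ends. *)
Record loop_profile (Th ka : R -> R) : Prop := {
  profile_curv_continuous : continuous ka;
  profile_is_derive : forall t : R, is_derive t (1 : R) Th (ka t);
  profile_le0 : forall t, t <= 0 -> Th t = 0;
  profile_ge1 : forall t, 1 <= t -> Th t = 2 * pi;
  profile_curv_le0 : forall t, t <= 0 -> ka t = 0;
  profile_curv_ge1 : forall t, 1 <= t -> ka t = 0;
  profile_curv_gt0 : forall t, 0 < t < 1 -> 0 < ka t;
  profile_sym : forall t, Th (1 - t) = 2 * pi - Th t;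
  profile_dx_gt0 : 0 < prim (fun t => cos (Th t)) 1
}.

(** The amplitude is continuous only relative to its segment; composed with a map into that segment
    it becomes continuous on the line. *)
Lemma continuous_comp_within (f g : R -> R) (D : set R) : continuous g ->
  (forall x, D (g x)) -> {within D, continuous f} -> continuous (fun x => f (g x)).
Proof.
move=> cg Dg /subspace_continuousP cf x.
apply: (@cvg_comp _ _ _ g f _ (within D (nbhs (g x)))); last exact: cf.
move=> P; change (nbhs (g x) (fun y => D y -> P y) -> nbhs x (fun y => P (g y))).
move=> /cg HP; have {}HP : nbhs x (fun y => D (g y) -> P (g y)) := HP.
by apply: filterS HP => y; apply.
Qed.

(* Projection onto [0, 1]. *)
Definition clamp (t : R) : R := (`|t| - `|t - 1| + 1) / 2.

Lemma clamp_continuous : continuous clamp.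
Proof.
move=> t; apply: cvgM; last exact: cvg_cst.
apply: cvgD; last exact: cvg_cst.
apply: cvgB; first exact: norm_continuous.
by apply: cvg_norm; apply: cvgB; [exact: cvg_id|exact: cvg_cst].
Qed.

Lemma clamp_le0 (t : R) : t <= 0 -> clamp t = 0.
Proof. by move=> t0; rewrite /clamp !ler0_norm//; [field|lra]. Qed.

Lemma clamp_ge1 (t : R) : 1 <= t -> clamp t = 1.
Proof. by move=> t0; rewrite /clamp !ger0_norm//; [field|lra|lra]. Qed.

Lemma clamp_id (t : R) : 0 <= t <= 1 -> clamp t = t.
Proof.
by move=> /andP[t0 t1]; rewrite /clamp ger0_norm// ler0_norm; [field|lra].
Qed.

Lemma clamp_itv (t : R) : 0 <= clamp t <= 1.
Proof.
have [t0|/ltW t0] := leP t 0; first by rewrite clamp_le0//; lra.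
have [t1|/ltW t1] := leP t 1; first by rewrite clamp_id ?t0.
by rewrite clamp_ge1//; lra.
Qed.

Lemma clamp_onem (t : R) : clamp (1 - t) = 1 - clamp t.
Proof.
rewrite /clamp (_ : 1 - t - 1 = - t); last by ring.
by rewrite normrN -[`|1 - t|]distrC; field.
Qed.

Section Construction.
Variable q : R.
Hypothesis q01 : 0 < q < 1.
Local Notation h := (pi / 2 : R).
Local Notation I := (prim (fun y : R => `|cos y| `^ (- q))).
Local Notation K := (I h).
Local Notation A := ('pinv_(fun=> 0) `[- h, h] I).

Let u (t : R) := (2 * clamp t - 1) * K.
Let phi (t : R) := A (u t).
Let ka (t : R) := 4 * K * `|cos (phi t)| `^ q.
(** A primitive of [ka] rather than pi + 2 phi, because [phi] gets a derivative only inside ]0, 1[,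
    whereas a primitive has one everywhere. The factor 4 K in [ka] is the product of the slope 2 K
    of [u] and the 2 in front of [phi]. *)
Let Th := prim ka.
Let q0 : 0 < q. Proof. by case/andP: q01. Qed.
Let q1 : q < 1. Proof. by case/andP: q01. Qed.
Let K0 : 0 < K. Proof. exact: amp_K_gt0. Qed.

Let u_itv (t : R) : - K <= u t <= K.
Proof.
have /andP[c0 c1] := clamp_itv t.
by rewrite /u; move: (clamp t) c0 c1 K0 => c c0 c1; move: K => k k0; apply/andP; split; nra.
Qed.

Let u_itvoo (t : R) : 0 < t < 1 -> - K < u t < K.
Proof.
move=> /andP[c0 c1]; rewrite /u clamp_id; last by rewrite !ltW.
by move: K0; move: K => k k0; apply/andP; split; nra.
Qed.

Let u_continuous : continuous u.
Proof.
move=> t; apply: cvgM; last exact: cvg_cst.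
apply: cvgB; last exact: cvg_cst.
by apply: cvgM; [exact: cvg_cst|exact: clamp_continuous].
Qed.

Let u_is_derive (t : R) : 0 < t < 1 -> is_derive t (1 : R) u (2 * K).
Proof.
move=> ht; apply: (@near_eq_is_derive _ _ _ (fun t => 2 * K * t + - K)).
  have := near_itvoo ht; apply: filterS => s /andP[s0 s1].
  by rewrite /u clamp_id ?(ltW s0) ?(ltW s1)//; ring.
exact: derive_affine_fun.
Qed.

Let phi_continuous : continuous phi.
Proof.
apply: (@continuous_comp_within A u `[- K, K]%classic) => //.
exact: amp_continuous.
Qed.

Let phi_is_derive (t : R) : 0 < t < 1 -> is_derive t (1 : R) phi (`|cos (phi t)| `^ q * (2 * K)).
Proof.
move=> ht; apply: (derive_comp_fun _ (u_is_derive ht)).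
exact: (amp_is_derive q01 (u_itvoo ht)).
Qed.

Let phi_le0 (t : R) : t <= 0 -> phi t = - h.
Proof. by move=> t0; rewrite /phi /u clamp_le0// mulr0 sub0r mulN1r amp_NKh. Qed.

Let phi_ge1 (t : R) : 1 <= t -> phi t = h.
Proof.
by move=> t0; rewrite /phi /u clamp_ge1// (_ : (2 * 1 - 1) * K = K) ?amp_Kh//; ring.
Qed.

Let phi_itv (t : R) : 0 < t < 1 -> - h < phi t < h.
Proof. by move=> /u_itvoo /amp_itvoo; apply. Qed.

Let phi_gt0 (t : R) : 1 / 2 < t < 1 -> 0 < phi t.
Proof.
move=> ht; have h1 : 0 < t < 1 by lra.
have /andP[u1 u2] := u_itvoo h1.
have ui : u t \in `[- K, K] by rewrite in_itv/= !ltW.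
have zi : 0 \in `[- K, K] by rewrite in_itv/= oppr_le0 ltW.
have ut : 0 < u t.
  by rewrite /u clamp_id; last lra; apply: mulr_gt0; [lra|exact: K0].
by have := amp_lt q01 zi ui; rewrite amp_0// ut.
Qed.

Let phi_onem (t : R) : phi (1 - t) = - phi t.
Proof.
rewrite /phi -(amp_odd q01 (u_itv t)); congr (A _).
by rewrite /u clamp_onem; ring.
Qed.

Let normcos_phi_continuous (r : R) : 0 < r -> continuous (fun t => `|cos (phi t)| `^ r).
Proof.
move=> r0 t; apply: (@continuous_comp _ _ _ (cos \o phi) (fun x : R => `|x| `^ r)).
  by apply: continuous_comp; [exact: phi_continuous|exact: continuous_cos].
exact: continuous_normpowR.
Qed.

Let ka_continuous : continuous ka.
Proof. by move=> t; apply: cvgM; [exact: cvg_cst|exact: normcos_phi_continuous]. Qed.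

Let ka_le0 (t : R) : t <= 0 -> ka t = 0.
Proof.
by move=> t0; rewrite /ka phi_le0// cosN cos_pihalf normr0 powR0 ?mulr0// gt_eqF.
Qed.

Let ka_ge1 (t : R) : 1 <= t -> ka t = 0.
Proof. by move=> t0; rewrite /ka phi_ge1// cos_pihalf normr0 powR0 ?mulr0// gt_eqF. Qed.

Let ka_gt0 (t : R) : 0 < t < 1 -> 0 < ka t.
Proof.
move=> /phi_itv ht; rewrite /ka !mulr_gt0// powR_gt0// normr_gt0 gt_eqF//.
exact: cos_gt0_pihalf.
Qed.

Let Th_is_derive (t : R) : is_derive t (1 : R) Th (ka t).
Proof. exact: prim_derive. Qed.

(** Equal derivatives inside and equal values at 0; the ends are reached by continuity. *)
Let Th_phi (t : R) : 0 <= t <= 1 -> Th t = pi + 2 * phi t.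
Proof.
move=> ht; apply/eqP; rewrite -subr_eq0; apply/eqP.
have E := @derive0_within_cst _ (fun t => Th t - (pi + 2 * phi t)) 0 1.
rewrite (E _ _ t 0) ?in_itv//= ?lexx ?ler01//.
- by rewrite /Th prim0 phi_le0//; field.
- apply: continuous_subspaceT => s; apply: cvgB.
    exact: is_derive_continuous (Th_is_derive s).
  apply: cvgD; first exact: cvg_cst.
  by apply: cvgM; [exact: cvg_cst|exact: phi_continuous].
- move=> s hs; have d1 := deriveM_fun (derive_cst_fun 2 s) (phi_is_derive hs).
  apply: (is_derive_eq (deriveB_fun (Th_is_derive s) (deriveD_fun (derive_cst_fun pi s) d1))).
  by rewrite /ka; ring.
Qed.

Let Th_le0 (t : R) : t <= 0 -> Th t = 0.
Proof.
move=> t0; have E := @derive0_within_cst _ Th t 0.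
rewrite (E _ _ t 0) ?in_itv//= ?lexx ?t0//; first by rewrite /Th prim0.
- by apply: continuous_subspaceT => s; exact: is_derive_continuous (Th_is_derive s).
- by move=> s /andP[_ /ltW s0]; rewrite -(ka_le0 s0).
Qed.

Let Th_ge1 (t : R) : 1 <= t -> Th t = 2 * pi.
Proof.
move=> t0; have E := @derive0_within_cst _ Th 1 t.
rewrite (E _ _ t 1) ?in_itv//= ?lexx ?t0//.
- by rewrite Th_phi ?ler01 ?lexx// phi_ge1//; field.
- by apply: continuous_subspaceT => s; exact: is_derive_continuous (Th_is_derive s).
- by move=> s /andP[/ltW s0 _]; rewrite -(ka_ge1 s0).
Qed.

Let Th_sym (t : R) : Th (1 - t) = 2 * pi - Th t.
Proof.
have [t0|/ltW t0] := leP t 0; first by rewrite (Th_le0 t0) Th_ge1 ?subr0//; lra.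
have [t1|/ltW t1] := leP t 1; last by rewrite (Th_ge1 t1) Th_le0 ?subrr//; lra.
by rewrite !Th_phi ?phi_onem; [ring|lra|lra].
Qed.

Let cosTh (t : R) : 0 <= t <= 1 -> cos (Th t) = sin (phi t) ^+ 2 - cos (phi t) ^+ 2.
Proof.
move=> /Th_phi ->; rewrite cosD cospi sinpi mul0r subr0 mulN1r mulr_natl cos_mulr2n.
by rewrite sin2cos2; ring.
Qed.

(* H' = q sin(phi)^2, and the second summand vanishes at 0 and 1: this is what
   makes the displacement of a loop positive. *)
Let H (t : R) := prim (fun t => cos (Th t)) t +
  (2 * K)^-1 * (sin (phi t) * `|cos (phi t)| `^ (1 - q)).

Let cosTh_continuous : continuous (fun t => cos (Th t)).
Proof.
move=> t; apply: continuous_comp; last exact: continuous_cos.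
exact: is_derive_continuous (Th_is_derive t).
Qed.

Let H_continuous : continuous H.
Proof.
move=> t; apply: cvgD; first exact: is_derive_continuous (prim_derive t cosTh_continuous).
apply: cvgM; first exact: cvg_cst.
apply: cvgM; last by apply: normcos_phi_continuous; rewrite subr_gt0.
by apply: continuous_comp; [exact: phi_continuous|exact: continuous_sin].
Qed.

Let H_is_derive (t : R) : 0 < t < 1 -> is_derive t (1 : R) H (q * sin (phi t) ^+ 2).
Proof.
move=> ht; have hp := phi_itv ht; have cp := cos_gt0_pihalf hp.
have d1 := deriveM_fun (is_derive_sin (phi t)) (is_derive_normcos_powR (1 - q) hp).
have d2 := deriveM_fun (derive_cst_fun (2 * K)^-1 t) (derive_comp_fun d1 (phi_is_derive ht)).
apply: (is_derive_eq (deriveD_fun (prim_derive t cosTh_continuous) d2)).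
rewrite cosTh; last by case/andP: ht => /ltW-> /ltW->.
rewrite ger0_norm ?(ltW cp)//.
have c0 : cos (phi t) `^ q != 0 by rewrite gt_eqF// powR_gt0.
have -> : 1 - q - 1 = - q by ring.
have -> : cos (phi t) `^ (1 - q) = cos (phi t) / cos (phi t) `^ q.
  by rewrite powRD ?(gt_eqF cp) ?implybT// powRr1 ?(ltW cp)// powRN.
have K0' : K != 0 by rewrite gt_eqF.
by rewrite powRN; field; rewrite c0 K0'.
Qed.

Let dx_gt0 : 0 < prim (fun t => cos (Th t)) 1.
Proof.
have H0 : H 0 = 0.
  by rewrite /H prim0 phi_le0// cosN cos_pihalf normr0 powR0 ?mulr0 ?addr0// subr_eq0 gt_eqF.
have H1 : H 1 = prim (fun t => cos (Th t)) 1.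
  by rewrite /H phi_ge1// cos_pihalf normr0 powR0 ?mulr0 ?addr0// subr_eq0 gt_eqF.
rewrite -H1 -H0.
have cH := continuous_subspaceT H_continuous.
(* The derivative q sin(phi)^2 vanishes at 1/2, so a single mean value point would give only a weak
   inequality. The interval is halved: the left half contributes at least 0, the right half, where
   phi > 0, strictly more. *)
have [|||c] := @MVT R H (fun t => q * sin (phi t) ^+ 2) 0 (1 / 2); first by lra.
- by move=> t; rewrite in_itv/= => ht; apply: H_is_derive; lra.
- exact: cH.
rewrite in_itv/= => _ E1.
have [|||d] := @MVT R H (fun t => q * sin (phi t) ^+ 2) (1 / 2) 1; first by lra.
- by move=> t; rewrite in_itv/= => ht; apply: H_is_derive; lra.
- exact: cH.
rewrite in_itv/= => hd E2.
have : 0 < sin (phi d).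
  apply: sin_gt0_pihalf; rewrite phi_gt0//=.
  by have /phi_itv/andP[] : 0 < d < 1 by lra.
move=> sd; have : 0 < q * sin (phi d) ^+ 2 by rewrite mulr_gt0// exprn_gt0.
have : 0 <= q * sin (phi c) ^+ 2 by rewrite mulr_ge0 ?sqr_ge0// ltW.
by nra.
Qed.

Lemma loop_profile_exists_amp : exists Th ka, loop_profile Th ka /\
  forall t, 0 <= t <= 1 -> Th t = pi + 2 * A ((2 * t - 1) * K).
Proof.
exists Th, ka; split; first by split.
by move=> t ht; rewrite Th_phi// /phi /u clamp_id.
Qed.

End Construction.

Lemma loop_profile_exists (p : R) : 2 < p -> exists Th ka, loop_profile Th ka /\
  {in `[0, 1], loop_angle p =1 Th}.
Proof.
move=> p2; have p0 : 0 < p by lra.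
have q01 : 0 < 2 / p < 1 by rewrite divr_gt0//= ltr_pdivrMr// mul1r.
have [Th [ka [prof E]]] := loop_profile_exists_amp q01.
have KE : Kp p = prim (fun y => `|cos y| `^ (- (2 / p))) (pi / 2).
  have h0 : 0 <= pi / 2 :> R by rewrite divr_ge0// pi_ge0.
  rewrite /Kp (prim_ge0E _ h0); apply: eq_Rintegral => y.
  rewrite inE/= in_itv/= => /andP[y1 y2].
  have pi0 := @pi_gt0 R; rewrite ger0_norm// cos_ge0_pihalf//.
  by apply/andP; split; lra.
exists Th, ka; split=> // t; rewrite in_itv/= => /E ->.
by rewrite /loop_angle KE.
Qed.

End LoopProfile.

(** * Integrals of tent-shaped profiles *)

Section Perturbation.
Context {R : realType}.
Local Notation mu := (@lebesgue_measure R).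
Implicit Types (f g G : R -> R).

Lemma prim_ext f g (x : R) : 0 <= x -> (forall t, 0 <= t <= x -> f t = g t) ->
  prim f x = prim g x.
Proof.
move=> x0 fg; rewrite !prim_ge0E//; apply: eq_Rintegral => t.
by rewrite inE/= in_itv/=; exact: fg.
Qed.

Lemma prim_continuous f : continuous f -> continuous (prim f).
Proof. by move=> cf; apply: is_derive_continuousT => x; exact: prim_derive. Qed.

Lemma prim_diff f G (a b : R) : continuous f -> continuous G -> a <= b ->
  (forall t : R, a < t < b -> is_derive t (1 : R) G (f t)) ->
  prim f b - prim f a = G b - G a.
Proof.
move=> cf cG ab dG.
have E := @derive0_within_cst _ (fun t => prim f t - G t) a b.
suff : prim f b - G b = prim f a - G a by lra.
apply: E; rewrite ?in_itv/= ?lexx ?ab//.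
  by apply: continuous_subspaceT => t; apply: cvgB; [exact: prim_continuous|exact: cG].
by move=> t /dG d; apply: (is_derive_eq (deriveB_fun (prim_derive t cf) d)); rewrite subrr.
Qed.

Lemma primD f g (x : R) : continuous f -> continuous g ->
  prim (fun t => f t + g t) x = prim f x + prim g x.
Proof.
move=> cf cg; have cfg : continuous (fun t => f t + g t).
  by move=> t; apply: cvgD; [exact: cf|exact: cg].
have -> := @prim_unique _ _ (fun t => prim f t + prim g t) cfg
  (fun t => deriveD_fun (prim_derive t cf) (prim_derive t cg)).
by rewrite !prim0 addr0 subr0.
Qed.

Lemma primZ f (a x : R) : continuous f -> prim (fun t => a * f t) x = a * prim f x.
Proof.
move=> cf; have caf : continuous (fun t => a * f t).
  by move=> t; apply: cvgM; [exact: cvg_cst|exact: cf].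
have d t : is_derive t (1 : R) (fun t => a * prim f t) (a * f t).
  apply: (is_derive_eq (deriveM_fun (derive_cst_fun a t) (prim_derive t cf))).
  by rewrite mul0r add0r.
by have -> := prim_unique caf d; rewrite !prim0 mulr0 subr0.
Qed.

Lemma prim_cst (a x : R) : prim (fun=> a) x = a * x.
Proof.
have ca : continuous (fun _ : R => a) by exact: cst_continuous.
have -> := prim_unique ca (derive_affine_fun a 0).
by rewrite !addr0 mulr0 subr0.
Qed.

Lemma prim_le0 f (x : R) : continuous f -> (forall t, t <= 0 -> f t = 0) -> x <= 0 ->
  prim f x = 0.
Proof.
move=> cf f0 x0; have := @prim_diff f (fun _ : R => 0) x 0 cf _ x0.
rewrite prim0 subrr sub0r => E; apply/eqP; rewrite -oppr_eq0; apply/eqP/E.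
  exact: cst_continuous.
by move=> t /andP[_ /ltW t0]; rewrite f0//; exact: derive_cst_fun.
Qed.

Lemma continuous_affine_norm (c la m : R) : continuous (fun s : R => c - la * `|s - m|).
Proof.
move=> s; apply: cvgB; first exact: cvg_cst.
apply: cvgM; first exact: cvg_cst.
by apply: cvg_norm; apply: cvgB; [exact: cvg_id|exact: cvg_cst].
Qed.

(** The integral is split at the top of the tent; on each side an affine substitution gives 1 / la
    times an increment of [prim f]. *)
Lemma prim_tent f (c la m l : R) : continuous f -> 0 < la -> 0 <= m <= l ->
  prim (fun s => f (c - la * `|s - m|)) l =
  la^-1 * (2 * prim f c - prim f (c - la * m) - prim f (c - la * (l - m))).
Proof.
move=> cf la0 /andP[m0 ml].
have cg : continuous (fun s => f (c - la * `|s - m|)).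
  by move=> s; apply: continuous_comp; [exact: continuous_affine_norm|exact: cf].
have dG (a b s : R) : is_derive s (1 : R) (fun s => prim f (a * s + b)) (a * f (a * s + b)).
  have H := @derive_comp_fun _ (prim f) (fun s => a * s + b) s _ _
    (prim_derive (a * s + b) cf) (derive_affine_fun a b s).
  apply: (is_derive_eq H).
  by rewrite mulrC.
have dG1 (e a b s : R) : is_derive s (1 : R) (fun s => e * prim f (a * s + b)) (e * (a * f (a * s + b))).
  by apply: (is_derive_eq (deriveM_fun (derive_cst_fun e s) (dG a b s))); rewrite mul0r add0r.
have la1 : la != 0 by rewrite gt_eqF.
have d1 s : 0 < s < m -> is_derive s (1 : R)
    (fun s => la^-1 * prim f (la * s + (c - la * m))) (f (c - la * `|s - m|)).
  move=> /andP[_ /ltW sm]; apply: (is_derive_eq (dG1 _ _ _ s)).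
  by rewrite mulrA mulVf// mul1r ler0_norm ?subr_le0//; congr f; ring.
have d2 s : m < s < l -> is_derive s (1 : R)
    (fun s => - la^-1 * prim f (- la * s + (c + la * m))) (f (c - la * `|s - m|)).
  move=> /andP[/ltW ms _]; apply: (is_derive_eq (dG1 _ _ _ s)).
  by rewrite !mulNr mulrN opprK mulrA mulVf// mul1r ger0_norm ?subr_ge0//; congr f; ring.
have E1 := prim_diff cg (is_derive_continuousT (dG1 _ _ _)) m0 d1.
have E2 := prim_diff cg (is_derive_continuousT (dG1 _ _ _)) ml d2.
rewrite prim0 subr0 in E1; have -> := canRL (subrK _) E2; rewrite E1.
rewrite (_ : - la * l + (c + la * m) = c - la * (l - m)); last by ring.
rewrite (_ : - la * m + (c + la * m) = c); last by ring.
rewrite (_ : la * m + (c - la * m) = c); last by ring.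
by rewrite mulr0 add0r; ring.
Qed.

End Perturbation.

(** * Estimates for the loop profile *)

Section ProfileFacts.
Context {R : realType}.
Implicit Types (f g : R -> R).

(** Slightly more than uniform continuity on the segment: only [x] is confined to it, while [y] may
    lie outside. *)
Lemma continuous_uniform_segment f (a b e : R) : continuous f -> 0 < e ->
  exists2 d, 0 < d & forall x y, a <= x <= b -> `|x - y| < d -> `|f x - f y| < e.
Proof.
move=> cf e0; have /compact_near_coveringP cK := @segment_compact R a b.
have : \forall d \near (0 : R)^'+, `[a, b]%classic `<=`
    (fun x => forall y, `|x - y| < d -> `|f x - f y| < e).
  apply: (cK R (0 : R)^'+ (fun d x => forall y, `|x - y| < d -> `|f x - f y| < e)) => x _.
  have e2 : 0 < e / 2 by rewrite divr_gt0.
  have /cvgrPdist_lt/(_ _ e2)/nbhs_ballP[r /= r0 Hr] := cf x.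
  have r2 : 0 < r / 2 by rewrite divr_gt0.
  near=> z d => /= y zyd.
  have zx : `|x - z| < r / 2 by near: z; exact: (@nbhsx_ballx _ R^o x (r / 2) r2).
  have dr : d < r / 2 by near: d; exact: nbhs_right_lt.
  have h1 : `|f x - f z| < e / 2 by apply: Hr; rewrite /ball/=; apply: lt_trans zx _; lra.
  have h2 : `|f x - f y| < e / 2.
    apply: Hr; rewrite /ball/= -(subrKA z) (le_lt_trans (ler_normD _ _))//.
    by lra.
  rewrite -(subrKA (f x)) (le_lt_trans (ler_normD _ _))// distrC; lra.
move=> H; near (0 : R)^'+ => d; exists d => //.
have : `[a, b]%classic `<=` (fun x => forall y, `|x - y| < d -> `|f x - f y| < e).
  by near: d.
by move=> Hd x y xab; apply: Hd; rewrite /= in_itv.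
Unshelve. all: end_near. Qed.

Variables (Th ka : R -> R).
Hypothesis prof : loop_profile Th ka.

Lemma profile_continuous : continuous Th.
Proof. exact: is_derive_continuousT (profile_is_derive prof). Qed.

Lemma profile_curv_ge0 t : 0 <= ka t.
Proof.
have [t0|t0] := leP t 0; first by rewrite (profile_curv_le0 prof).
have [t1|t1] := leP 1 t; first by rewrite (profile_curv_ge1 prof).
by rewrite ltW// (profile_curv_gt0 prof)// t0.
Qed.

Lemma profile_itv t : 0 < t < 1 -> 0 < Th t < 2 * pi.
Proof.
move=> /andP[t0 t1]; apply/andP; split.
- have [||c] := @MVT R Th ka 0 t t0.
  + by move=> x _; exact: profile_is_derive.
  + exact: continuous_subspaceT profile_continuous.
  + rewrite in_itv/= (profile_le0 prof (lexx 0)) !subr0 => /andP[c0 c1] ->.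
    by rewrite mulr_gt0// (profile_curv_gt0 prof)// c0 (lt_trans c1).
- have [||c] := @MVT R Th ka t 1 t1.
  + by move=> x _; exact: profile_is_derive.
  + exact: continuous_subspaceT profile_continuous.
  + rewrite in_itv/= (profile_ge1 prof (lexx 1)) => /andP[c0 c1] E.
    rewrite -subr_gt0 E mulr_gt0 ?subr_gt0//.
    by rewrite (profile_curv_gt0 prof)// c1 (lt_trans t0).
Qed.

Lemma cos_lt1 (x : R) : 0 < x < 2 * pi -> cos x < 1.
Proof.
move=> /andP[x0 x1]; have : 0 < sin (x / 2).
  by apply: sin_gt0_pi; apply/andP; split; lra.
rewrite [in cos x](_ : x = (x / 2) *+ 2); last by rewrite -mulr_natr; field.
by rewrite cos_mulr2n => s0; have := cos2Dsin2 (x / 2); nra.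
Qed.

Lemma profile_cos_lt1 t : 0 < t < 1 -> cos (Th t) < 1.
Proof. by move=> /profile_itv/cos_lt1. Qed.

(** Displacement minus arclength, not the displacement itself: the integrand vanishes where the
    angle is 0 or 2 pi, so a loop contributes the same amount whatever straight pieces surround
    it. *)
Definition loop_dx (t : R) := prim (fun t => cos (Th t) - 1) t.
Definition loop_dy (t : R) := prim (fun t => sin (Th t)) t.

Lemma profile_cos_continuous : continuous (fun t => cos (Th t)).
Proof. by move=> t; apply: continuous_comp; [exact: profile_continuous|exact: continuous_cos]. Qed.

Lemma profile_sin_continuous : continuous (fun t => sin (Th t)).
Proof. by move=> t; apply: continuous_comp; [exact: profile_continuous|exact: continuous_sin]. Qed.

Lemma profile_cosB1_continuous : continuous (fun t => cos (Th t) - 1).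
Proof. by move=> t; apply: cvgB; [exact: profile_cos_continuous|exact: cvg_cst]. Qed.

Lemma loop_dx1 : -1 < loop_dx 1 < 0.
Proof.
have E : loop_dx 1 = prim (fun t => cos (Th t)) 1 - 1.
  have cN : continuous (fun _ : R => -1 : R) by exact: cst_continuous.
  by rewrite /loop_dx (primD 1 profile_cos_continuous cN) prim_cst mulr1.
apply/andP; split; first by rewrite E; have := profile_dx_gt0 prof; lra.
have [||c] := @MVT R loop_dx (fun t => cos (Th t) - 1) 0 1 ltr01.
- by move=> x _; exact: (prim_derive x profile_cosB1_continuous).
- exact: continuous_subspaceT (prim_continuous profile_cosB1_continuous).
- rewrite in_itv/= /loop_dx prim0 !subr0 mulr1 => /profile_cos_lt1 + ->.
  by lra.
Qed.

(** Mirror symmetry of the loop: [loop_dy t - loop_dy (1 - t)] has derivative 0 and vanishes at t =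
    1/2; its value at t = 1 is the claim. *)
Lemma loop_dy1 : loop_dy 1 = 0.
Proof.
have dY t : is_derive t (1 : R) loop_dy (sin (Th t)) by exact: (prim_derive t profile_sin_continuous).
have d0 t : is_derive t (1 : R) (fun t => loop_dy t - loop_dy (1 - t)) 0.
  have d1 : is_derive t (1 : R) (fun t : R => 1 - t) (-1).
    apply: (is_derive_eq (deriveB_fun (derive_cst_fun 1 t) (is_derive_id t (1 : R)))).
    by rewrite sub0r.
  have d2 := @derive_comp_fun _ loop_dy (fun t => 1 - t) t _ _ (dY (1 - t)) d1.
  apply: (is_derive_eq (deriveB_fun (dY t) d2)).
  rewrite (profile_sym prof) sinB [in sin (2 * pi)]mulr_natl sin2pi.
  by rewrite mulr_natl cos2pi; ring.
have := is_derive_0_is_cst 1 (1 / 2) d0.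
rewrite (_ : 1 - 1 / 2 = 1 / 2); last by field.
by rewrite subrr /loop_dy prim0 subr0 => ->; rewrite subrr.
Qed.

(** First-order estimate at the end of the loop, where the cosine is 1 and the sine is 0. The strict
    lower bound is what later excludes the dilation factor 1. *)
Lemma loop_near_end (e : R) : 0 < e -> exists2 u0, 0 < u0 & forall u, 0 < u < u0 -> u < 1 ->
  0 < loop_dx (1 - u) - loop_dx 1 <= e * u /\ `|loop_dy (1 - u)| <= e * u.
Proof.
move=> e0.
have c1 : cos (Th 1) = 1 by rewrite (profile_ge1 prof)// mulr_natl cos2pi.
have s1 : sin (Th 1) = 0 by rewrite (profile_ge1 prof)// mulr_natl sin2pi.
have cc : continuous (fun t => cos (Th t)) := profile_cos_continuous.
have cs : continuous (fun t => sin (Th t)) := profile_sin_continuous.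
have /cvgrPdist_lt/(_ _ e0)/nbhs_ballP[r /= r0 Hr] := cc 1.
have /cvgrPdist_lt/(_ _ e0)/nbhs_ballP[q /= q0 Hq] := cs 1.
exists (Num.min r q); first by rewrite lt_min r0 q0.
move=> u; rewrite lt_min => /andP[u0 /andP[ur uq]] u1; have u1' : 1 - u < 1 by lra.
have near_c c : c \in `]1 - u, 1[ -> `|1 - cos (Th c)| < e /\ `|sin (Th c)| < e.
  rewrite in_itv/= => /andP[c0 c1'].
  have h1 : `|1 - c| < u by rewrite ger0_norm; lra.
  have := Hr c; have := Hq c; rewrite /ball/= c1 s1 sub0r normrN.
  by move=> H1 H2; split; [apply: H2|apply: H1]; exact: lt_trans h1 _.
split.
- have [||c hc] := @MVT R loop_dx (fun t => cos (Th t) - 1) (1 - u) 1 u1'.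
  + by move=> x _; exact: (prim_derive x profile_cosB1_continuous).
  + exact: continuous_subspaceT (prim_continuous profile_cosB1_continuous).
  + have [+ _] := near_c _ hc; move: hc; rewrite in_itv/= => hc.
    have /profile_cos_lt1 cl1 : 0 < c < 1 by case/andP: hc => ? ->; rewrite andbT; lra.
    rewrite ger0_norm; last lra.
    by move=> ce E; rewrite -opprB E; apply/andP; split; nra.
- have [||c hc] := @MVT R loop_dy (fun t => sin (Th t)) (1 - u) 1 u1'.
  + by move=> x _; exact: (prim_derive x profile_sin_continuous).
  + exact: continuous_subspaceT (prim_continuous profile_sin_continuous).
  + have [_ sc] := near_c _ hc; rewrite loop_dy1 sub0r => E.
    rewrite -normrN E normrM (_ : 1 - (1 - u) = u); last by ring.
    by rewrite (ger0_norm (ltW u0)) ler_pM2r// ltW.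
Qed.

Lemma profile_curv_bound : exists2 M, 0 < M & forall t, `|ka t| <= M.
Proof.
have [c _ Hc] := EVT_max ler01 (continuous_subspaceT (profile_curv_continuous prof)).
exists (ka c + 1); first by have := profile_curv_ge0 c; lra.
move=> t; rewrite ger0_norm ?profile_curv_ge0//.
have c0 := profile_curv_ge0 c.
have [t0|/ltW t0] := leP t 0; first by rewrite (profile_curv_le0 prof) //; lra.
have [t1|/ltW t1] := leP 1 t; first by rewrite (profile_curv_ge1 prof) //; lra.
by have := Hc t; rewrite in_itv/= t0 t1 => /(_ isT); lra.
Qed.

Lemma profile_lipschitz : exists2 M, 0 < M & forall x y, `|Th x - Th y| <= M * `|x - y|.
Proof.
have [M M0 HM] := profile_curv_bound; exists M => // x y.
wlog xy : x y / y <= x.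
  by move=> W; have [/W//|/ltW/W] := leP y x; rewrite distrC [`|y - x|]distrC.
have [||c _ ->] := @MVT_segment R Th ka y x xy.
- by move=> z _; exact: profile_is_derive.
- exact: continuous_subspaceT profile_continuous.
- by rewrite normrM ler_wpM2r.
Qed.

Lemma profile_curv_uniform (e : R) : 0 < e ->
  exists2 d, 0 < d & forall x y, `|x - y| < d -> `|ka x - ka y| < e.
Proof.
(* The segment [-1, 2] leaves a margin of 1 around [0, 1]: if [x] is outside it and |x - y| < 1,
   then both curvatures are 0. *)
move=> e0; have [d d0 Hd] := @continuous_uniform_segment ka (-1) 2 e (profile_curv_continuous prof) e0.
exists (Num.min d 1); first by rewrite lt_min d0 ltr01.
move=> x y; rewrite lt_min => /andP[xyd]; rewrite ltr_norml => /andP[xy1 xy2].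
have [x1|x1] := ltP x (-1).
  by rewrite !(profile_curv_le0 prof) ?subrr ?normr0//; lra.
have [x2|x2] := leP x 2; first by apply: Hd => //; rewrite x1.
by rewrite !(profile_curv_ge1 prof) ?subrr ?normr0//; lra.
Qed.

End ProfileFacts.

(** * Shortening and dilating loops *)
Section Bending.
Context {R : realType}.

(* t is the dilation factor of the loop after a piece of length u has been cut
   off; A and S are the resulting changes of its displacement before dilation. *)
Lemma scale_solution (X0 nu c A S u e : R) :
  0 < X0 -> 1 <= nu <= 2 -> 0 < c -> c <= 1 -> 0 < A -> A <= c / 4 * u ->
  `|S| <= c / 4 * u -> 0 < u -> u < 1 -> u < X0 / 4 -> u < e / 4 ->
  exists2 t, 1 < t <= 1 + u &
    let X := X0 + nu * (t * A - (t - 1) * c) in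
    let Y := nu * (t * S) in
    [/\ X ^+ 2 + Y ^+ 2 = X0 ^+ 2, 0 <= X & `|Y| <= e].
Proof.
move=> X00 /andP[nu1 nu2] c0 c1 A0 A1 S1 u0 u1 uX ue.
have cu : c * u <= u by nra.
have cu0 : 0 < c * u by rewrite mulr_gt0.
(* The loss is at most nu c u <= 2 u, which is less than half of [X0] because u < X0 / 4. *)
have boundX t : 1 <= t <= 1 + u -> X0 / 2 <= X0 + nu * (t * A - (t - 1) * c).
  move=> /andP[t1 t2].
  have h1 : (t - 1) * c <= c * u by rewrite mulrC ler_pM2l//; lra.
  have h2 : 0 <= t * A by rewrite mulr_ge0 ?(ltW A0)//; lra.
  by nra.
have boundY t : 1 <= t <= 1 + u -> `|nu * (t * S)| <= nu * c * u / 2.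
  move=> /andP[t1 t2]; rewrite !normrM (@ger0_norm _ nu); last lra.
  rewrite (@ger0_norm _ t); last lra.
  have h1 : t * `|S| <= 2 * (c / 4 * u) by apply: ler_pM => //; lra.
  by rewrite -!mulrA ler_pM2l; lra.
pose F t := (X0 + nu * (t * A - (t - 1) * c)) ^+ 2 + (nu * (t * S)) ^+ 2.
have cF : continuous F.
  move=> t.
  have cX : {for t, continuous (fun t : R => X0 + nu * (t * A - (t - 1) * c))}.
    apply: cvgD; first exact: cvg_cst.
    apply: cvgM; first exact: cvg_cst.
    apply: cvgB; first by apply: cvgM; [exact: cvg_id|exact: cvg_cst].
    apply: cvgM; last exact: cvg_cst.
    by apply: cvgB; [exact: cvg_id|exact: cvg_cst].
  have cY : {for t, continuous (fun t : R => nu * (t * S))}.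
    apply: cvgM; first exact: cvg_cst.
    by apply: cvgM; [exact: cvg_id|exact: cvg_cst].
  by apply: cvgD; apply: cvgM.
have F1 : X0 ^+ 2 < F 1.
  have X1 : X0 < X0 + nu * A by rewrite ltrDl mulr_gt0//; lra.
  have := sqr_ge0 (nu * (1 * S)); rewrite /F subrr mul0r subr0 mul1r.
  by move: X1; clear -X00; nra.
(* Let w = nu c u. The factors c / 4 are chosen so that X <= X0 - w / 2 and |Y| <= w / 2 here; then
   F is at most X0^2 - X0 w + w^2 / 2, and w < X0. *)
have Fu : F (1 + u) < X0 ^+ 2.
  have h12 : 1 <= 1 + u <= 1 + u by apply/andP; split; lra.
  have XX := boundX _ h12; have YY := boundY _ h12; rewrite /F.
  have XU : X0 + nu * ((1 + u) * A - (1 + u - 1) * c) <= X0 - nu * (c * u) / 2.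
    rewrite (_ : 1 + u - 1 = u); last by ring.
    have : (1 + u) * A <= 2 * (c / 4 * u) by apply: ler_pM; lra.
    by clear -nu1; nra.
  have Y2 : (nu * ((1 + u) * S)) ^+ 2 <= (nu * c * u / 2) ^+ 2.
    by rewrite -[(nu * _) ^+ 2]real_normK ?num_real// ler_sqr ?nnegrE ?(le_trans _ YY).
  have w0 : 0 < nu * (c * u) by rewrite mulr_gt0//; lra.
  have w1 : nu * (c * u) < X0 by clear -cu cu0 nu1 nu2 uX; nra.
  move: (X0 + _) (_ ^+ 2) XX XU Y2 => x y2 XX XU.
  rewrite -(mulrA nu); move: (nu * (c * u)) w0 w1 XU => w w0 w1 XU.
  have : x ^+ 2 <= (X0 - w / 2) ^+ 2 by rewrite ler_sqr ?nnegrE; lra.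
  by clear -w0 w1; nra.
have u11 : 1 <= 1 + u by lra.
have [|t] := @IVT R F 1 (1 + u) (X0 ^+ 2) u11 (continuous_subspaceT cF).
  by rewrite ge_min (ltW Fu) orbT le_max (ltW F1).
rewrite in_itv/= => ht Ft; exists t.
  have /andP[t1 ->] := ht; rewrite andbT lt_neqAle t1 andbT.
  by apply: contraTneq F1 => ->; rewrite Ft ltxx.
split; first by rewrite -Ft.
- by have := boundX _ ht; lra.
- apply: (le_trans (boundY _ ht)); rewrite -(mulrA nu).
  by clear -nu1 nu2 cu cu0 ue; nra.
Qed.

Variables (Th ka : R -> R).
Hypothesis prof : loop_profile Th ka.

(** The constant c of [scale_solution] is [- loop_dx Th 1], what a loop loses against a straight
    line of the same length. The bound on [Y] will keep the rotation angle small. *)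
Lemma scale_exists (X0 nu e : R) : 0 < X0 -> 1 <= nu <= 2 -> 0 < e ->
  \forall u \near (0 : R)^'+, exists2 t, 1 < t <= 1 + u &
    let X := X0 + nu * (t * loop_dx Th (1 - u) - loop_dx Th 1) in
    let Y := nu * (t * loop_dy Th (1 - u)) in
    [/\ X ^+ 2 + Y ^+ 2 = X0 ^+ 2, 0 <= X & `|Y| <= e].
Proof.
move=> X00 nu12 e0; have /andP[dx1 dx0] := loop_dx1 prof.
have c0 : 0 < - loop_dx Th 1 by lra.
have c4 : 0 < - loop_dx Th 1 / 4 by rewrite divr_gt0.
have [u0 u00 Hu] := loop_near_end prof c4.
near=> u; have u_gt0 : 0 < u by [].
have u1 : u < 1 by near: u; exact: nbhs_right_lt.
have uu0 : u < u0 by near: u; exact: nbhs_right_lt.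
have uX : u < X0 / 4 by near: u; apply: nbhs_right_lt; rewrite divr_gt0.
have ue : u < e / 4 by near: u; apply: nbhs_right_lt; rewrite divr_gt0.
have [||/andP[A0 A1] S1] := Hu u; rewrite ?u_gt0//.
have [|t ht /= H] := scale_solution X00 nu12 c0 _ A0 A1 S1 u_gt0 u1 uX ue; first by lra.
exists t => //=.
rewrite (_ : t * loop_dx Th (1 - u) - loop_dx Th 1 =
  t * (loop_dx Th (1 - u) - loop_dx Th 1) - (t - 1) * - loop_dx Th 1)//.
by ring.
Unshelve. all: end_near. Qed.

End Bending.

(** * Bent curves: endpoints, energy and choice of the perturbation *)

Section BentCurve.
Context {R : realType}.
Implicit Types (f g : R -> R).

(** The angle is minus the argument of (X, Y); as X >= 0, it is - asin (Y / X0), which is small by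
    continuity of asin at 0. *)
Lemma rotation_exists (X0 e : R) : 0 < X0 -> 0 < e -> exists2 d, 0 < d &
  forall X Y, X ^+ 2 + Y ^+ 2 = X0 ^+ 2 -> 0 <= X -> `|Y| <= d ->
  exists b, [/\ `|b| <= e, cos b * X - sin b * Y = X0 & sin b * X + cos b * Y = 0].
Proof.
move=> X00 e0.
have asin0 : asin 0 = 0 :> R.
  have pi0 := @pi_gt0 R; have := @sinK R 0; rewrite sin0; apply.
  by rewrite in_itv/=; apply/andP; split; lra.
have ca : {for 0, continuous (@asin R)} by apply: continuous_asin; apply/andP; split; lra.
have /cvgrPdist_lt/(_ _ e0)/nbhs_ballP[r /= r0 Hr] := ca.
exists (X0 * (r / 2)); first by rewrite mulr_gt0// divr_gt0.
move=> X Y XY X0' Yd.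
have XN0 : X0 != 0 by rewrite gt_eqF.
pose y := Y / X0; have Yy : Y = X0 * y by rewrite /y mulrCA divff ?mulr1.
have yr : `|y| < r.
  rewrite /y normrM normfV (ger0_norm (ltW X00)) ltr_pdivrMr// (le_lt_trans Yd)//.
  by rewrite mulrC ltr_pM2r//; lra.
have yX : X = X0 * Num.sqrt (1 - y ^+ 2).
  have -> : X = Num.sqrt (X0 ^+ 2 * (1 - y ^+ 2)).
    rewrite -[LHS](ger0_norm X0') -sqrtr_sqr; congr Num.sqrt.
    by rewrite mulrBr mulr1 -exprMn -Yy -XY addrK.
  by rewrite sqrtrM ?sqr_ge0// sqrtr_sqr ger0_norm// ltW.
have y2 : y ^+ 2 <= 1.
  rewrite /y expr_div_n ler_pdivrMr ?exprn_gt0// mul1r -XY.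
  by rewrite lerDr sqr_ge0.
have hy : -1 <= y <= 1 by rewrite -ler_norml -(@ler_sqr _ _ 1) ?nnegrE// real_normK ?num_real// expr1n.
have sy : sin (asin y) = y by apply: asinK; rewrite in_itv.
have cy := cos_asin hy.
exists (- asin y); rewrite normrN cosN sinN sy cy; split.
- have := Hr y; rewrite /ball/= asin0 !sub0r !normrN => /(_ yr)/ltW.
  by [].
- have q2 := sqr_sqrtr (_ : 0 <= 1 - y ^+ 2); rewrite subr_ge0 in q2.
  rewrite yX Yy.
  transitivity (X0 * (Num.sqrt (1 - y ^+ 2) ^+ 2 + y ^+ 2)); first by ring.
  by rewrite q2// subrK mulr1.
- by rewrite yX Yy; ring.
Qed.

Lemma bump_arg_dist (la u l a : R) : 0 <= a <= l -> 0 <= u -> la <= 1 -> 1 - la <= u ->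
  `|(1 - u - la * a) - (1 - 0 - 1 * a)| <= u * (1 + l).
Proof.
move=> /andP[a0 al] u0 la1 la_u.
rewrite (_ : _ - _ = (1 - la) * a - u); last by ring.
have h1 : (1 - la) * a <= u * l by apply: ler_pM => //; rewrite subr_ge0.
have h2 : 0 <= (1 - la) * a by rewrite mulr_ge0// subr_ge0.
have h3 : 0 <= u * l by rewrite mulr_ge0// (le_trans a0).
by rewrite ler_norml mulrDr mulr1; apply/andP; split; lra.
Qed.

Lemma dist_itv_le (s m l : R) : 0 <= s <= l -> 0 <= m <= l -> `|s - m| <= l.
Proof. by move=> /andP[? ?] /andP[? ?]; rewrite ler_norml; apply/andP; split; lra. Qed.

Variables (Th ka : R -> R).
Hypothesis prof : loop_profile Th ka.
Variables (p sg m l : R) (rest rest' : R -> R).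

(* The loops meeting at m are shortened by u at m, dilated by 1 / la and rotated
   by b; (u, la, b) = (0, 1, 0) is the original curve. If m is 0 or l there is
   one such loop, otherwise there are two. *)
Definition bent_angle (u la b s : R) := b + sg * Th (1 - u - la * `|s - m|) + rest s.
Definition bent_curv (u la s : R) :=
  sg * (- la * Num.sg (s - m)) * ka (1 - u - la * `|s - m|) + rest' s.
(** A sum of powers instead of the power of the sum: the two curvatures are never nonzero together.
    Dropping the sign of s - m makes the function continuous across [m]. *)
Definition bent_energy (u la s : R) :=
  `|la * ka (1 - u - la * `|s - m|)| `^ p + `|rest' s| `^ p.

Hypothesis p1 : 1 < p.
Hypothesis sgE : sg = 1 \/ sg = -1.
Hypothesis l0 : 0 < l.
Hypothesis m0l : 0 <= m <= l.
(** On each side of [m] there is either nothing or room for a whole loop, which has length 1. *)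
Hypothesis mleft : m = 0 \/ 1 <= m.
Hypothesis mright : m = l \/ m <= l - 1.
Hypothesis rest_der : forall s : R, is_derive s (1 : R) rest (rest' s).
Hypothesis rest'_cont : continuous rest'.
Hypothesis rest_flat : forall s, 0 <= s <= l -> `|s - m| < 1 ->
  [/\ cos (rest s) = 1, sin (rest s) = 0 & rest' s = 0].

Let p0 : 0 < p. Proof. exact: lt_trans ltr01 p1. Qed.
Let pN0 : p != 0. Proof. by rewrite gt_eqF. Qed.
(* The number of loops meeting at m. *)
Let nu : R := (m != 0)%:R + (m != l)%:R.

Let nu12 : 1 <= nu <= 2.
Proof.
rewrite /nu; have [->|m0] := eqVneq m 0; have [|ml] := eqVneq _ l => /=; try lra.
by move=> l0'; move: l0; rewrite -l0' ltxx.
Qed.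

Let arg (u la s : R) := 1 - u - la * `|s - m|.

Let arg_continuous u la : continuous (arg u la).
Proof. exact: continuous_affine_norm. Qed.

(** By [1 - u <= la] the argument of [f] is nonpositive at distance 1 from [m], so [f] has died out
    at any end of the interval other than [m]; the ends that coincide with [m] are what [nu]
    discounts. *)
Lemma prim_bump f (u la : R) : continuous f -> (forall t, t <= 0 -> f t = 0) ->
  0 < la -> 1 - u <= la ->
  prim (fun s => f (1 - u - la * `|s - m|)) l = la^-1 * (nu * prim f (1 - u)).
Proof.
move=> cf f0 la0 ula; rewrite prim_tent//; congr (_ * _).
have E1 : prim f (1 - u - la * m) = (m == 0)%:R * prim f (1 - u).
  have [->|m1] := eqVneq m 0; first by rewrite mulr0 subr0 mul1r.
  have m1' : 1 <= m by case: mleft => // mE; rewrite mE eqxx in m1.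
  by rewrite mul0r prim_le0//; have := ler_peMr (ltW la0) m1'; lra.
have E2 : prim f (1 - u - la * (l - m)) = (m == l)%:R * prim f (1 - u).
  have [->|m1] := eqVneq m l; first by rewrite subrr mulr0 subr0 mul1r.
  have m1' : 1 <= l - m by case: mright => [mE|]; [rewrite mE eqxx in m1|lra].
  by rewrite mul0r prim_le0//; have := ler_peMr (ltW la0) m1'; lra.
by rewrite E1 E2 /nu; case: eqP => _; case: eqP => _ /=; ring.
Qed.

(** The dichotomy behind the additive formulas below: at each point one of the two angles is trivial
    modulo 2 pi. *)
Let rest_or_bump (u la s : R) : 0 < la -> 1 - u <= la -> 0 <= s <= l ->
  [/\ cos (rest s) = 1, sin (rest s) = 0 & rest' s = 0] \/ 1 - u - la * `|s - m| <= 0.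
Proof.
move=> la0 ula hs; have [sm|sm] := ltP `|s - m| 1; first by left; exact: rest_flat.
by right; have := ler_peMr (ltW la0) sm; lra.
Qed.

Lemma rest_continuous : continuous rest.
Proof. exact: is_derive_continuousT rest_der. Qed.

Lemma bent_angle_continuous (u la b : R) : continuous (bent_angle u la b).
Proof.
move=> s; apply: cvgD; last exact: rest_continuous.
apply: cvgD; first exact: cvg_cst.
apply: cvgM; first exact: cvg_cst.
apply: (@continuous_comp _ _ _ (arg u la) Th); first exact: arg_continuous.
exact: (profile_continuous prof).
Qed.

Let cos_sg (x : R) : cos (sg * x) = cos x.
Proof. by case: sgE => ->; rewrite ?mul1r// mulN1r cosN. Qed.

Let sin_sg (x : R) : sin (sg * x) = sg * sin x.
Proof. by case: sgE => ->; rewrite ?mul1r// !mulN1r sinN. Qed.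

(** If one of the angles x, y is trivial, then cos (x + y) = (cos x - 1) + cos y, so the
    displacement splits into a bump part and a rest part. *)
Lemma bent_dx (u la : R) : 0 < la -> 1 - u <= la ->
  prim (fun s => cos (bent_angle u la 0 s)) l =
  la^-1 * (nu * loop_dx Th (1 - u)) + prim (fun s => cos (rest s)) l.
Proof.
move=> la0 ula; have cT := profile_cosB1_continuous prof.
have cr : continuous (fun s => cos (rest s)).
  by move=> s; apply: continuous_comp; [exact: rest_continuous|exact: continuous_cos].
rewrite /loop_dx -(prim_bump cT)//; last first.
  by move=> t t0; rewrite (profile_le0 prof)// cos0 subrr.
rewrite -primD//; last first.
  by move=> s; apply: (@continuous_comp _ _ _ (arg u la) (fun t => cos (Th t) - 1));
    [exact: arg_continuous|exact: cT].
apply: prim_ext; first exact: ltW.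
move=> s /(rest_or_bump la0 ula)[[c1 s0 _]|a0]; rewrite /bent_angle add0r cosD cos_sg sin_sg.
  by rewrite c1 s0; ring.
by rewrite (profile_le0 prof a0) cos0 sin0; ring.
Qed.

Lemma bent_dy (u la : R) : 0 < la -> 1 - u <= la ->
  prim (fun s => sin (bent_angle u la 0 s)) l =
  sg * (la^-1 * (nu * loop_dy Th (1 - u))) + prim (fun s => sin (rest s)) l.
Proof.
move=> la0 ula; have cT := profile_sin_continuous prof.
have cr : continuous (fun s => sin (rest s)).
  by move=> s; apply: continuous_comp; [exact: rest_continuous|exact: continuous_sin].
have cb : continuous (fun s => sin (Th (1 - u - la * `|s - m|))).
  by move=> s; apply: (@continuous_comp _ _ _ (arg u la) (fun t => sin (Th t)));
    [exact: arg_continuous|exact: cT].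
rewrite /loop_dy -(prim_bump cT)//; last first.
  by move=> t t0; rewrite (profile_le0 prof)// sin0.
rewrite -(primZ sg l cb) -primD//; last first.
  by move=> s; apply: cvgM; [exact: cvg_cst|exact: cb].
apply: prim_ext; first exact: ltW.
move=> s /(rest_or_bump la0 ula)[[c1 s0 _]|a0]; rewrite /bent_angle add0r sinD cos_sg sin_sg.
  by rewrite c1 s0; ring.
by rewrite (profile_le0 prof a0) cos0 sin0; ring.
Qed.

Lemma bent_rotate (u la b : R) :
  prim (fun s => cos (bent_angle u la b s)) l =
    cos b * prim (fun s => cos (bent_angle u la 0 s)) l -
    sin b * prim (fun s => sin (bent_angle u la 0 s)) l /\
  prim (fun s => sin (bent_angle u la b s)) l =
    sin b * prim (fun s => cos (bent_angle u la 0 s)) l +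
    cos b * prim (fun s => sin (bent_angle u la 0 s)) l.
Proof.
have cc : continuous (fun s => cos (bent_angle u la 0 s)).
  by move=> s; apply: continuous_comp; [exact: bent_angle_continuous|exact: continuous_cos].
have cs : continuous (fun s => sin (bent_angle u la 0 s)).
  by move=> s; apply: continuous_comp; [exact: bent_angle_continuous|exact: continuous_sin].
have cZ a f : continuous f -> continuous (fun s => a * f s).
  by move=> cf s; apply: cvgM; [exact: cvg_cst|exact: cf].
have bE s : bent_angle u la b s = b + bent_angle u la 0 s by rewrite /bent_angle; ring.
have Z a c : a * prim (fun s => cos (bent_angle u la 0 s)) l +
    c * prim (fun s => sin (bent_angle u la 0 s)) l =
    prim (fun s => a * cos (bent_angle u la 0 s) + c * sin (bent_angle u la 0 s)) l.
  by rewrite -(primZ a l cc) -(primZ c l cs) -(primD l (cZ a _ cc) (cZ c _ cs)).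
rewrite -mulNr !Z; split; apply: prim_ext; try exact: ltW.
- by move=> s _; rewrite bE cosD mulNr.
- by move=> s _; rewrite bE sinD.
Qed.

Lemma continuous_normpowR_comp f : continuous f -> continuous (fun s => `|f s| `^ p).
Proof.
move=> cf s; apply: (@continuous_comp _ _ _ f (fun x : R => `|x| `^ p)); first exact: cf.
exact: continuous_normpowR p0 _.
Qed.

Lemma bent_energy_continuous (u la : R) : continuous (bent_energy u la).
Proof.
move=> s; apply: cvgD; last exact: continuous_normpowR_comp.
apply: (@continuous_normpowR_comp (fun s => la * ka (arg u la s))) => t.
apply: cvgM; first exact: cvg_cst.
apply: (@continuous_comp _ _ _ (arg u la) ka); first exact: arg_continuous.
exact: (profile_curv_continuous prof).
Qed.

Lemma bent_curv_energy (u la s : R) : 0 < la -> 1 - u <= la -> 0 <= s <= l -> s != m ->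
  `|bent_curv u la s| `^ p = bent_energy u la s.
Proof.
move=> la0 ula hs sm; have sg1 : `|sg| = 1 by case: sgE => ->; rewrite ?normrN normr1.
rewrite /bent_curv /bent_energy; case: (rest_or_bump la0 ula hs) => [[_ _ ->]|a0].
  rewrite addr0 normr0 powR0// addr0; congr (_ `^ _).
  by rewrite !normrM sg1 mul1r normrN normr_sg subr_eq0 sm mulr1.
by rewrite (profile_curv_le0 prof a0) !mulr0 add0r normr0 powR0// add0r.
Qed.

Lemma bent_energy_prim (u la : R) : 0 < la -> 1 - u <= la ->
  prim (bent_energy u la) l =
  la `^ p * (la^-1 * (nu * prim (fun t => `|ka t| `^ p) (1 - u))) +
  prim (fun s => `|rest' s| `^ p) l.
Proof.
move=> la0 ula; have ck : continuous (fun t => `|ka t| `^ p).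
  exact/continuous_normpowR_comp/(profile_curv_continuous prof).
have cb : continuous (fun s => `|ka (1 - u - la * `|s - m|)| `^ p).
  by move=> s; apply: (@continuous_comp _ _ _ (arg u la) (fun t => `|ka t| `^ p));
    [exact: arg_continuous|exact: ck].
rewrite -(prim_bump ck)//; last first.
  by move=> t t0; rewrite (profile_curv_le0 prof)// normr0 powR0.
rewrite -primZ// -primD//; last 2 first.
- by move=> s; apply: cvgM; [exact: cvg_cst|exact: cb].
- exact: continuous_normpowR_comp.
apply: prim_ext; first exact: ltW.
move=> s _; rewrite /bent_energy normrM powRM// ger0_norm//; exact: ltW.
Qed.

Lemma bent_energy_lt (u la : R) : 0 < u -> 0 < la -> la < 1 -> 1 - u <= la ->
  prim (bent_energy u la) l < prim (bent_energy 0 1) l.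
Proof.
move=> u0 la0 la1 ula; have ck : continuous (fun t => `|ka t| `^ p).
  exact/continuous_normpowR_comp/(profile_curv_continuous prof).
rewrite !bent_energy_prim ?subr0// ltrD2r powR1 invr1 !mul1r.
set E := prim _; rewrite mulrCA !(mulrA la^-1) (mulrC la^-1).
(* This is la^(p - 1) < 1, where p > 1 is decisive. *)
have la_lt1 : la `^ p / la < 1.
  rewrite ltr_pdivrMr// mul1r -[ltRHS]powRr1 ?ltW//.
  by rewrite /powR gt_eqF// ltr_expR ltr_nM2r// ln_lt0// la0.
have dE x : is_derive x (1 : R) E (`|ka x| `^ p) by exact: prim_derive.
(* Cutting a piece off changes the energy only by a weak inequality; strictness comes from the
   scaling factor, which needs a loop of positive energy. *)
have E1 : 0 < E 1.
  have [|c] := @MVT R E _ 0 1 ltr01 (fun x _ => dE x).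
  - exact: continuous_subspaceT (prim_continuous ck).
  - rewrite in_itv/= /E prim0 !subr0 mulr1 => hc ->.
    by rewrite powR_gt0// normr_gt0 gt_eqF// (profile_curv_gt0 prof).
have Eu : E (1 - u) <= E 1.
  have u1 : 1 - u <= 1 by lra.
  have [|c _] := @MVT_segment R E _ (1 - u) 1 u1 (fun x _ => dE x).
  - exact: continuous_subspaceT (prim_continuous ck).
  - move=> EE; rewrite -subr_ge0 EE mulr_ge0 ?powR_ge0//; lra.
have nu0 : 0 < nu by case/andP: nu12; lra.
rewrite mulrCA ltr_pM2l// mulrC (mulrC la^-1).
have r0 : 0 <= la `^ p / la by rewrite divr_ge0 ?powR_ge0// ltW.
by rewrite (le_lt_trans (ler_wpM2l r0 Eu))// gtr_pMl.
Qed.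

Lemma bent_perturbation (X0 eta : R) : 0 < X0 -> 0 < eta ->
  prim (fun s => cos (bent_angle 0 1 0 s)) l = X0 ->
  prim (fun s => sin (bent_angle 0 1 0 s)) l = 0 ->
  exists u la b, [/\ 0 < la, 1 - u <= la &
    [/\ prim (fun s => cos (bent_angle u la b s)) l = X0,
        prim (fun s => sin (bent_angle u la b s)) l = 0,
        forall s, 0 <= s <= l -> `|bent_angle u la b s - bent_angle 0 1 0 s| <= eta,
        forall s, 0 <= s <= l -> `|bent_curv u la s - bent_curv 0 1 s| <= eta &
        prim (bent_energy u la) l < prim (bent_energy 0 1) l]].
Proof.
move=> X00 eta0 hX hY; have eta2 : 0 < eta / 2 by rewrite divr_gt0.
have [M M0 HM] := profile_curv_bound prof.
have [M' M'0 HM'] := profile_lipschitz prof.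
have [d d0 Hrot] := rotation_exists X00 eta2.
have [dk dk0 Hdk] := profile_curv_uniform prof eta2.
have l1 : 0 < 1 + l by rewrite addr_gt0.
near (0 : R)^'+ => u; have u0 : 0 < u by [].
have [t /andP[t1 tu] /= [XY X0' Yd]] : exists2 t, 1 < t <= 1 + u &
    let X := X0 + nu * (t * loop_dx Th (1 - u) - loop_dx Th 1) in
    let Y := nu * (t * loop_dy Th (1 - u)) in
    [/\ X ^+ 2 + Y ^+ 2 = X0 ^+ 2, 0 <= X & `|Y| <= d].
  by near: u; exact: (scale_exists prof X00 nu12 d0).
have udk : u * (1 + l) < dk.
  by rewrite -ltr_pdivlMr//; near: u; apply: nbhs_right_lt; rewrite divr_gt0.
have uM : u * M <= eta / 2.
  by rewrite -ler_pdivlMr//; near: u; apply: nbhs_right_le; rewrite divr_gt0.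
have uM' : M' * (u * (1 + l)) <= eta / 2.
  rewrite mulrC -ler_pdivlMr// -ler_pdivlMr//.
  by near: u; apply: nbhs_right_le; rewrite !divr_gt0.
have t0 : 0 < t by exact: lt_trans t1.
pose la := t^-1; have laE : la^-1 = t by rewrite invrK.
have la0 : 0 < la by rewrite invr_gt0.
have la1 : la < 1 by rewrite invf_lt1.
have latE : la * t = 1 by rewrite mulVf// gt_eqF.
(* 1 - la = la (t - 1) <= t - 1 <= u. *)
have la_u : 1 - la <= u.
  have : la * (t - 1) <= 1 * (t - 1) by rewrite ler_wpM2r ?(ltW la1) ?subr_ge0 ?(ltW t1).
  by rewrite mulrBr latE mul1r mulr1 => /le_trans; apply; rewrite lerBlDl.
have ula : 1 - u <= la by rewrite lerBlDr -lerBlDl.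
clearbody la.
(* The displacement formulas at u = 0, la = 1 express the contribution of [rest] through the chord
   (X0, 0) of the original curve, so that [rest] can be eliminated below. *)
have E0 : 0 < 1 :> R by []; have E00 : 1 - 0 <= 1 :> R by rewrite subr0.
have := bent_dx E0 E00; rewrite hX invr1 mul1r subr0 => RX.
have := bent_dy E0 E00; rewrite hY subr0 (loop_dy1 prof) !mulr0 add0r => RY.
set X := X0 + _ in XY X0'; set Y := nu * _ in XY Yd.
have XE : prim (fun s => cos (bent_angle u la 0 s)) l = X.
  by rewrite bent_dx// laE /X RX; ring.
have YE : prim (fun s => sin (bent_angle u la 0 s)) l = sg * Y.
  by rewrite bent_dy// laE /Y -RY addr0; ring.
have XY' : X ^+ 2 + (sg * Y) ^+ 2 = X0 ^+ 2.
  by rewrite -XY; case: sgE => ->; ring.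
have Yd' : `|sg * Y| <= d by case: sgE => ->; rewrite ?mul1r// mulN1r normrN.
have [b [hb bX bY]] := Hrot _ _ XY' X0' Yd'.
have hd s : 0 <= s <= l -> `|(1 - u - la * `|s - m|) - (1 - 0 - 1 * `|s - m|)| <= u * (1 + l).
  move=> hs; apply: bump_arg_dist (ltW u0) (ltW la1) la_u.
  by rewrite normr_ge0 (dist_itv_le hs).
have sg1 : `|sg| = 1 by case: sgE => ->; rewrite ?normrN normr1.
exists u, la, b; split=> //; split.
- by have [-> _] := bent_rotate u la b; rewrite XE YE.
- by have [_ ->] := bent_rotate u la b; rewrite XE YE.
- move=> s hs; rewrite /bent_angle.
  rewrite (_ : _ - _ = b + sg * (Th (1 - u - la * `|s - m|) - Th (1 - 0 - 1 * `|s - m|)));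
    last by ring.
  rewrite (le_trans (ler_normD _ _))// [leRHS](splitr eta) lerD//.
  rewrite normrM sg1 [leLHS]mul1r (le_trans (HM' _ _))// (le_trans _ uM')//.
  by rewrite ler_wpM2l ?hd// ltW.
- move=> s hs; rewrite /bent_curv.
  set x := 1 - u - _; set y := 1 - 0 - _.
  (* Both curvatures carry the same sign factor, so its jump at [m] does not enter the estimate; a
     translation error of [ka] and the dilation error 1 - la remain. *)
  rewrite (_ : _ - _ = sg * Num.sg (s - m) * ((ka y - ka x) + (1 - la) * ka x)); last by ring.
  rewrite normrM; apply: (@le_trans _ _ (1 * `|ka y - ka x + (1 - la) * ka x|)).
    rewrite ler_wpM2r// normrM sg1 [leLHS]mul1r normr_sg.
    by case: (s - m != 0) => /=.
  rewrite [leLHS]mul1r (le_trans (ler_normD _ _))// [leRHS](splitr eta) lerD//.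
    by apply/ltW/Hdk; rewrite distrC (le_lt_trans (hd _ hs)).
  rewrite normrM (le_trans _ uM)// ler_pM//.
  by rewrite ger0_norm ?subr_ge0 ?(ltW la1).
- exact: bent_energy_lt.
Unshelve. all: end_near. Qed.

End BentCurve.

(** * Sobolev curves with one kink in the curvature *)
Section Piecewise.
Context {R : realType}.
Local Notation mu := (@lebesgue_measure R).
Implicit Types (f g : R -> R).

(* The value at the kink c itself, and the values off ]0, L[, are arbitrary. *)
Definition piecewise (c L : R) f f1 f2 := [/\ continuous f1, continuous f2 &
  forall t, 0 < t < L -> (t < c -> f t = f1 t) /\ (c < t -> f t = f2 t)].

Lemma continuous_piecewise c L f : continuous f -> piecewise c L f f f.
Proof. by move=> cf; split. Qed.

Lemma piecewise2 c L f f1 f2 g g1 g2 (op : R -> R -> R) :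
  piecewise c L f f1 f2 -> piecewise c L g g1 g2 ->
  continuous (fun t => op (f1 t) (g1 t)) -> continuous (fun t => op (f2 t) (g2 t)) ->
  piecewise c L (fun t => op (f t) (g t)) (fun t => op (f1 t) (g1 t)) (fun t => op (f2 t) (g2 t)).
Proof.
move=> [_ _ Hf] [_ _ Hg] c1 c2; split=> // t ht.
have [f_1 f_2] := Hf t ht; have [g_1 g_2] := Hg t ht.
by split=> tc; [rewrite f_1 ?g_1|rewrite f_2 ?g_2].
Qed.

Lemma piecewise_measurable c L f f1 f2 : piecewise c L f f1 f2 ->
  measurable_fun `]0, L[ (f : measurableTypeR R -> measurableTypeR R).
Proof.
move=> [cf1 cf2 Hf].
pose g t := if t == c then f c else if t < c then f1 t else f2 t.
apply: (@eq_measurable_fun _ _ _ _ _ g).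
  move=> t; rewrite inE/= in_itv/= => /Hf[H1 H2]; rewrite /g.
  by case: ltgtP => [/H1|/H2|->].
apply: (@measurable_funS _ _ _ _ setT) => //.
apply: measurable_fun_ifT => //; first exact: measurable_fun_eqr.
apply: measurable_fun_ifT; first exact: measurable_fun_ltr.
  exact: continuous_measurable_fun.
exact: continuous_measurable_fun.
Qed.

Lemma continuous_itv_bounded f (L : R) : 0 <= L -> continuous f ->
  exists M, forall t, 0 <= t <= L -> `|f t| <= M.
Proof.
move=> L0 cf; have cn : continuous (fun t => `|f t|) by move=> t; apply: cvg_norm; exact: cf.
have [c _ Hc] := EVT_max L0 (continuous_subspaceT cn).
by exists `|f c| => t ht; apply: Hc; rewrite in_itv.
Qed.

Lemma piecewise_bounded c L f f1 f2 : 0 <= L -> piecewise c L f f1 f2 ->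
  exists2 M, 0 <= M & forall t, 0 < t < L -> `|f t| <= M.
Proof.
move=> L0 [cf1 cf2 Hf].
have [M1 H1] := continuous_itv_bounded L0 cf1.
have [M2 H2] := continuous_itv_bounded L0 cf2.
exists (Num.max `|f c| (Num.max M1 M2)); first by rewrite le_max normr_ge0.
move=> t ht; have [h1 h2] := Hf t ht; have ht' : 0 <= t <= L by case/andP: ht => /ltW-> /ltW->.
rewrite !le_max; case: (ltgtP t c) => [/h1 ->|/h2 ->|->]; last by rewrite lexx.
  by rewrite H1// orbT.
by rewrite H2// !orbT.
Qed.

Lemma lebesgue_measure_itvoo (L : R) : 0 <= L -> mu `]0, L[%classic = L%:E.
Proof.
move=> L0; rewrite lebesgue_measure_itv/= lte_fin; case: ltP => [_|L0'].
  by rewrite oppr0 adde0.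
by congr (_%:E); apply/eqP; rewrite eq_le L0 L0'.
Qed.

Lemma piecewise_integrable c L f f1 f2 : 0 <= L -> piecewise c L f f1 f2 ->
  mu.-integrable `]0, L[ (EFin \o f).
Proof.
move=> L0 pf; have [M M0 HM] := piecewise_bounded L0 pf.
apply: measurable_bounded_integrable => //.
- have H : (mu `]0%R, L[%classic < +oo)%E by rewrite lebesgue_measure_itvoo// ltry.
  exact: H.
- exact: piecewise_measurable pf.
- exists M; split; first by rewrite num_real.
  move=> x Mx t /=; rewrite in_itv/= => ht; exact: le_trans (HM t ht) (ltW Mx).
Qed.

Lemma itvoo_setD1 (c L : R) : 0 <= c <= L ->
  `]0, L[%classic `\ c = `]0, c[%classic `|` `]c, L[%classic.
Proof.
move=> /andP[c0 cL]; apply/seteqP; split => t /=; rewrite !in_itv/=.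
  by move=> [/andP[t0 tL] /eqP]; rewrite neq_lt t0 tL /= andbT => /orP[]->; [left|right].
move=> [/andP[t0 tc]|/andP[ct tL]]; split.
- by rewrite t0 (lt_le_trans tc cL).
- by move=> tE; rewrite tE ltxx in tc.
- by rewrite tL (le_lt_trans c0 ct).
- by move=> tE; rewrite tE ltxx in ct.
Qed.

Lemma Rintegral_itvoo_prim f g (a b : R) : a <= b -> continuous g ->
  (forall t, a < t < b -> f t = g t) -> \int[mu]_(t in `]a, b[) f t = prim g b - prim g a.
Proof.
move=> ab cg fg; rewrite -(FTC2_prim cg ab).
have -> : \int[mu]_(t in `]a, b[) f t = \int[mu]_(t in `]a, b[) g t.
  by apply: eq_Rintegral => t; rewrite inE/= in_itv/=; exact: fg.
have mg : measurable_fun `]a, b[ (EFin \o g).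
  apply/measurable_EFinP; apply: (@measurable_funS _ _ _ _ setT) => //.
  exact: continuous_measurable_fun.
by rewrite /Rintegral (@integral_itv_bndoo R a b (fun x => (g x)%:E) true false mg).
Qed.

Lemma Rintegral_piecewise c L f f1 f2 : 0 <= c <= L -> piecewise c L f f1 f2 ->
  \int[mu]_(t in `]0, L[) f t = prim f1 c + (prim f2 L - prim f2 c).
Proof.
move=> hc pf; have [cf1 cf2 Hf] := pf; have /andP[c0 cL] := hc.
have L0 : 0 <= L := le_trans c0 cL.
have intf := piecewise_integrable L0 pf.
have mD : measurable (`]0, L[%classic `\ c : set R) by apply: measurableD.
have intD : mu.-integrable (`]0, L[%classic `\ c) (EFin \o f).
  by apply: integrableS intf => //; exact: subDsetl.
have -> : \int[mu]_(t in `]0, L[) f t = \int[mu]_(t in `]0, L[%classic `\ c) f t.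
  have mf := measurable_int mu intD.
  by rewrite /Rintegral (@integral_setD1 R (fun x => (f x)%:E) c).
rewrite (itvoo_setD1 hc) Rintegral_setU//.
- rewrite (@Rintegral_itvoo_prim f f1 0 c)//; last first.
    move=> t /andP[t0 tc]; have /Hf[h1 _] : 0 < t < L by rewrite t0 (lt_le_trans tc cL).
    exact: h1.
  rewrite (@Rintegral_itvoo_prim f f2 c L)//; last first.
    move=> t /andP[ct tL]; have /Hf[_ h2] : 0 < t < L by rewrite tL (le_lt_trans c0 ct).
    exact: h2.
  by rewrite prim0 subr0.
- by rewrite -(itvoo_setD1 hc).
- apply/disj_setPS => t [] /=; rewrite !in_itv/= => /andP[_ tc] /andP[ct _].
  by have := lt_trans tc ct; rewrite ltxx.
Qed.

(** The exceptional point [c] is a null set; it has to be allowed because second derivatives are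
    controlled only off the kink. *)
Lemma Lnorm_bound (p L M c : R) f : 0 < p -> 0 <= L -> 0 <= M ->
  measurable_fun `]0, L[ (f : measurableTypeR R -> measurableTypeR R) ->
  (forall t, 0 < t < L -> t != c -> `|f t| <= M) ->
  ('N[mu]_p%:E [EFin \o (f \_ `]0%R, L[)] <= (M * L `^ p^-1)%:E)%E.
Proof.
move=> p0 L0 M0 mf fM; have pN0 : p != 0 by rewrite gt_eqF.
have mpf : measurable_fun `]0, L[ (fun x => (`|f x| `^ p)%:E).
  apply/measurable_EFinP; apply: (@measurableT_comp _ _ _ _ _ _ (fun y : R => y `^ p)) => //.
  exact: measurableT_comp.
rewrite unlock /=.
have -> : (\int[mu]_x `|((f \_ `]0%R, L[) x)%:E| `^ p = \int[mu]_(x in `]0%R, L[) (`|f x| `^ p)%:E)%E.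
  rewrite [RHS]integral_mkcond; apply: eq_integral => x _.
  by rewrite /= !patchE; case: ifP => _ //; rewrite normr0 powR0.
have muL := lebesgue_measure_itvoo L0.
have mD : measurable (`]0, L[%classic `\ c : set R) by apply: measurableD.
have mpfD : measurable_fun (`]0, L[%classic `\ c) (fun x => (`|f x| `^ p)%:E).
  by apply: measurable_funS mpf => //; exact: subDsetl.
have B : (\int[mu]_(x in `]0%R, L[) (`|f x| `^ p)%:E <= (M `^ p * L)%:E)%E.
  rewrite -(@integral_setD1 _ _ c)//.
  apply: (@le_trans _ _ (\int[mu]_(x in `]0%R, L[%classic `\ c) (M `^ p)%:E)%E).
    apply: ge0_le_integral => //.
    - move=> x /= [+ /eqP xc]; rewrite in_itv/= => hx.
      by rewrite lee_fin; apply: ge0_ler_powR; rewrite ?nnegrE ?(ltW p0)// fM.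
  rewrite (@integral_setD1 _ (fun=> (M `^ p)%:E))// integral_cst//.
  by rewrite [X in (_ * X)%E](_ : _ = L%:E)// -EFinM.
have I0 : (0 <= \int[mu]_(x in `]0%R, L[) (`|f x| `^ p)%:E)%E.
  by apply: integral_ge0 => x _; rewrite lee_fin powR_ge0.
apply: (@le_trans _ _ ((M `^ p * L)%:E `^ p^-1)%E).
  apply: gt0_ler_poweR => //; rewrite ?invr_ge0 ?(ltW p0)// in_itv/= leey andbT//.
  by rewrite lee_fin mulr_ge0 ?powR_ge0.
rewrite poweR_EFin lee_fin powRM ?powR_ge0// -powRrM divff// powRr1//.
Qed.

Lemma piecewise_Lp_on p c L f f1 f2 : 0 < p -> 0 <= L -> piecewise c L f f1 f2 -> Lp_on p L f.
Proof.
move=> p0 L0 pf; have [M M0 HM] := piecewise_bounded L0 pf.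
have mf := piecewise_measurable pf.
rewrite /Lp_on; apply/andP; split; rewrite inE/=.
  exact/(measurable_restrictT _ _).1.
rewrite /finite_norm.
have := @Lnorm_bound p L M 0 f p0 L0 M0 mf (fun t ht _ => HM t ht).
by move=> /le_lt_trans; apply; rewrite ltry.
Qed.

End Piecewise.

(** * Weak derivatives across a kink *)

Section SobolevPiecewise.
Context {R : realType}.
Local Notation mu := (@lebesgue_measure R).
Implicit Types (f g u v w : R -> R).

(** Integration by parts on each side of [c]: the boundary terms at [c] cancel because [v] is
    continuous there, and those at 0 and L vanish with the test function. *)
Lemma weak_derivative_piecewise (L c : R) v w w1 w2 : 0 <= c <= L -> continuous v ->
  piecewise c L w w1 w2 ->
  (forall t : R, 0 < t < L -> t != c -> is_derive t (1 : R) v (w t)) -> weak_derivative L v w.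
Proof.
move=> hc cv pw dv f [df cf' [a [b [a0 bL f0]]]]; have /andP[c0 cL] := hc.
have [cw1 cw2 Hw] := pw; have L0 : 0 <= L := le_trans c0 cL.
have df' t : is_derive t (1 : R) f (f^`() t) by split; [exact: df|rewrite derive1E].
have cf : continuous f := is_derive_continuousT df'.
have cM g1 g2 : continuous g1 -> continuous g2 -> continuous (fun t : R => g1 t * g2 t : R).
  by move=> c1 c2 t; apply: cvgM; [exact: c1|exact: c2].
have cD g1 g2 : continuous g1 -> continuous g2 -> continuous (fun t : R => g1 t + g2 t : R).
  by move=> c1 c2 t; apply: cvgD; [exact: c1|exact: c2].
have pvf := continuous_piecewise c L (cM _ _ cv cf').
have pwf := piecewise2 pw (continuous_piecewise c L cf) (cM _ _ cw1 cf) (cM _ _ cw2 cf).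
have psum := piecewise2 pvf pwf (cD _ _ (cM _ _ cv cf') (cM _ _ cw1 cf))
  (cD _ _ (cM _ _ cv cf') (cM _ _ cw2 cf)).
apply/eqP; rewrite -addr_eq0 -RintegralD//; last 2 first.
- exact: piecewise_integrable L0 pvf.
- exact: piecewise_integrable L0 pwf.
rewrite (Rintegral_piecewise hc psum).
have dvf t : 0 < t < L -> t != c -> is_derive t (1 : R) (fun t => v t * f t) (v t * f^`() t + w t * f t).
  move=> ht tc; apply: (is_derive_eq (deriveM_fun (dv t ht tc) (df' t))).
  by rewrite addrC.
have E1 := @prim_diff _ _ (fun t => v t * f t) 0 c
  (cD _ _ (cM _ _ cv cf') (cM _ _ cw1 cf)) (cM _ _ cv cf) c0.
have E2 := @prim_diff _ _ (fun t => v t * f t) c L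
  (cD _ _ (cM _ _ cv cf') (cM _ _ cw2 cf)) (cM _ _ cv cf) cL.
have d1 t : 0 < t < c -> is_derive t (1 : R) (fun t => v t * f t) (v t * f^`() t + w1 t * f t).
  move=> /andP[t0 tc]; have ht : 0 < t < L by rewrite t0 (lt_le_trans tc cL).
  by have [w1E _] := Hw t ht; rewrite -w1E//; apply: dvf => //; rewrite lt_eqF.
have d2 t : c < t < L -> is_derive t (1 : R) (fun t => v t * f t) (v t * f^`() t + w2 t * f t).
  move=> /andP[ct tL]; have ht : 0 < t < L by rewrite tL (le_lt_trans c0 ct).
  by have [_ w2E] := Hw t ht; rewrite -w2E//; apply: dvf => //; rewrite gt_eqF.
rewrite prim0 subr0 in E1; rewrite (E1 d1) (E2 d2).
rewrite (f0 0) ?(f0 L) ?in_itv/= ?(leNgt a) ?a0//; last by rewrite (leNgt L) bL andbF.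
by rewrite !mulr0 subr0 sub0r subrr.
Qed.

Lemma W2p_piecewise (p L c : R) u v w w1 w2 : 0 < p -> 0 <= c <= L ->
  (forall t : R, is_derive t (1 : R) u (v t)) -> continuous v ->
  piecewise c L w w1 w2 ->
  (forall t : R, 0 < t < L -> t != c -> is_derive t (1 : R) v (w t)) -> W2p p L u.
Proof.
move=> p0 hc du cv pw dv; have cu := is_derive_continuousT du.
have L0 : 0 <= L by case/andP: hc; exact: le_trans.
have pu := continuous_piecewise c L cu; have pv := continuous_piecewise c L cv.
split; first exact: continuous_subspaceT.
exists v, w; split.
- by apply: (weak_derivative_piecewise hc cu pv) => t _ _; exact: du.
- exact: (weak_derivative_piecewise hc cv pw).
- exact: piecewise_Lp_on p0 L0 pu.
- exact: piecewise_Lp_on p0 L0 pv.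
- exact: piecewise_Lp_on p0 L0 pw.
Qed.

End SobolevPiecewise.

(** * Euclidean geometry and derivatives in the plane *)

Section Plane.
Context {R : realType}.
Implicit Types (u v : 'rV[R]_2) (Q : 'M[R]_2).

Lemma vec2_0 (x y : R) : vec2 x y 0 0 = x.
Proof. by rewrite mxE. Qed.

Lemma vec2_1 (x y : R) : vec2 x y 0 1 = y.
Proof. by rewrite mxE. Qed.

Lemma rV2P u v : u 0 0 = v 0 0 -> u 0 1 = v 0 1 -> u = v.
Proof.
move=> h0 h1; apply/rowP => j; case: (eqVneq j 0) => [->//|j0].
have -> : j = 1 by apply/val_inj; move: j0; case: j => -[|[|]].
by [].
Qed.

Lemma rV2_mul u Q j : (u *m Q) 0 j = u 0 0 * Q 0 j + u 0 1 * Q 1 j.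
Proof.
rewrite mxE big_ord_recl big_ord1; congr (_ + u 0 _ * Q _ j); exact/val_inj.
Qed.

Lemma orthogonal2 Q : Q *m Q^T = 1%:M ->
  [/\ Q 0 0 ^+ 2 + Q 0 1 ^+ 2 = 1, Q 1 0 ^+ 2 + Q 1 1 ^+ 2 = 1 &
      Q 0 0 * Q 1 0 + Q 0 1 * Q 1 1 = 0].
Proof.
move=> QQ; have E i j : Q i 0 * Q j 0 + Q i 1 * Q j 1 = (i == j)%:R.
  have := congr1 (fun A : 'M[R]_2 => A i j) QQ; rewrite !mxE big_ord_recl big_ord1 !mxE.
  by move=> <-; congr (_ + Q _ _ * Q _ _); exact/val_inj.
by rewrite !expr2 !E.
Qed.

Lemma enormZ (a : R) u : enorm (a *: u) = `|a| * enorm u.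
Proof.
rewrite /enorm !mxE !exprMn -mulrDr sqrtrM ?sqr_ge0// sqrtr_sqr//.
Qed.

Lemma enorm_mul Q u : Q *m Q^T = 1%:M -> enorm (u *m Q) = enorm u.
Proof.
move=> /orthogonal2[q1 q2 q3]; rewrite /enorm !rV2_mul; congr Num.sqrt.
transitivity (u 0 0 ^+ 2 * (Q 0 0 ^+ 2 + Q 0 1 ^+ 2) + u 0 1 ^+ 2 * (Q 1 0 ^+ 2 + Q 1 1 ^+ 2)
  + 2 * (u 0 0 * u 0 1) * (Q 0 0 * Q 1 0 + Q 0 1 * Q 1 1)); first by ring.
by rewrite q1 q2 q3 !mulr1 mulr0 addr0.
Qed.

Lemma norm_det2_mul Q u v : Q *m Q^T = 1%:M -> `|det2 (u *m Q) (v *m Q)| = `|det2 u v|.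
Proof.
move=> /orthogonal2[q1 q2 q3].
have -> : det2 (u *m Q) (v *m Q) = (Q 0 0 * Q 1 1 - Q 0 1 * Q 1 0) * det2 u v.
  by rewrite /det2 !rV2_mul; ring.
suff dQ : `|Q 0 0 * Q 1 1 - Q 0 1 * Q 1 0| = 1 by rewrite normrM dQ mul1r.
apply/eqP; rewrite -(@eqrXn2 _ 2)// real_normK ?num_real// expr1n; apply/eqP.
(* Lagrange's identity: the squared determinant is the product of the squared row lengths minus the
   square of the inner product of the rows. *)
transitivity ((Q 0 0 ^+ 2 + Q 0 1 ^+ 2) * (Q 1 0 ^+ 2 + Q 1 1 ^+ 2)
  - (Q 0 0 * Q 1 0 + Q 0 1 * Q 1 1) ^+ 2); first by ring.
by rewrite q1 q2 q3 mul1r expr0n subr0.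
Qed.

Lemma det2Z (a b : R) u v : det2 (a *: u) (b *: v) = a * b * det2 u v.
Proof. by rewrite /det2 !mxE; ring. Qed.

Lemma enorm_le u (D : R) : `|u 0 0| <= D -> `|u 0 1| <= D -> enorm u <= 2 * D.
Proof.
move=> h0 h1; have D0 : 0 <= D := le_trans (normr_ge0 _) h0.
rewrite /enorm -[leRHS](@ger0_norm _ (2 * D)) ?mulr_ge0// -sqrtr_sqr ler_wsqrtr//.
have : u 0 0 ^+ 2 <= D ^+ 2 by rewrite -[_ ^+ 2]real_normK ?num_real// ler_sqr ?nnegrE.
have : u 0 1 ^+ 2 <= D ^+ 2 by rewrite -[_ ^+ 2]real_normK ?num_real// ler_sqr ?nnegrE.
by have := sqr_ge0 D; nra.
Qed.

Lemma is_derive_scalel (k : R -> R) (v : 'rV[R]_2) (t a : R) :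
  is_derive t (1 : R) k a -> is_derive t (1 : R) (fun s => k s *: v) (a *: v).
Proof.
move=> [dk dkE]; have dk' : differentiable k t by apply/derivable1_diffP.
have dkv : differentiable (fun s => k s *: v) t by apply: differentiableZl.
split; first exact/derivable1_diffP.
by rewrite deriveE// diffZl// -dkE deriveE.
Qed.

Lemma is_derive_vec2 (x y : R -> R) (t a b : R) :
  is_derive t (1 : R) x a -> is_derive t (1 : R) y b ->
  is_derive t (1 : R) (fun s => vec2 (x s) (y s)) (vec2 a b).
Proof.
have E (z z' : R) : vec2 z z' = z *: vec2 1 0 + z' *: vec2 0 1.
  by apply: rV2P; rewrite !mxE/= ?mulr1 ?mulr0 ?addr0 ?add0r.
move=> dx dy; rewrite E.
have -> : (fun s => vec2 (x s) (y s)) = (fun s => x s *: vec2 1 0) + (fun s => y s *: vec2 0 1).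
  by apply/funext => s; rewrite E.
by apply: is_deriveD; exact: is_derive_scalel.
Qed.

(** Curves are prescribed only on the parameter interval; inside it this determines all derivatives,
    and energies and norms integrate over the open interval. *)
Lemma derive1_eq_oo (V : normedModType R) (f g : R -> V) (a b : R) :
  (forall t, a < t < b -> f t = g t) -> forall t, a < t < b -> f^`() t = g^`() t.
Proof.
move=> fg t ht; rewrite !derive1E; apply: near_eq_derive.
by have := near_itvoo ht; apply: filterS => s /fg.
Qed.

Lemma derive1_is_derive (V : normedModType R) (f : R -> V) (t : R) (d : V) :
  is_derive t (1 : R) f d -> f^`() t = d.
Proof. by move=> [_ <-]; rewrite derive1E. Qed.

End Plane.

(** * Similar copies of curves given by their tangent angle *)

Section Curves.
Context {R : realType}.
Local Notation mu := (@lebesgue_measure R).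
Implicit Types (th k e : R -> R).

Definition plane_curve th (s : R) : 'rV[R]_2 :=
  vec2 (prim (fun s => cos (th s)) s) (prim (fun s => sin (th s)) s).

(* k is the derivative of th except at m, where it may jump; k m is arbitrary. *)
Definition kinked (m : R) th k := [/\ continuous th,
  exists k1 k2, [/\ continuous k1, continuous k2,
    forall s, s < m -> k s = k1 s & forall s, m < s -> k s = k2 s] &
  forall s : R, s != m -> is_derive s (1 : R) th (k s)].

Lemma cos_lipschitz (x y : R) : `|cos x - cos y| <= `|x - y|.
Proof.
wlog xy : x y / y <= x.
  by move=> W; have [/W//|/ltW/W] := leP y x; rewrite distrC [`|y - x|]distrC.
have [|c _ ->] := @MVT_segment R cos (fun x => - sin x) y x xy (fun z _ => is_derive_cos z).
  exact: continuous_subspaceT (@continuous_cos R).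
by rewrite normrM normrN ler_piMl// sin_max.
Qed.

Lemma sin_lipschitz (x y : R) : `|sin x - sin y| <= `|x - y|.
Proof.
wlog xy : x y / y <= x.
  by move=> W; have [/W//|/ltW/W] := leP y x; rewrite distrC [`|y - x|]distrC.
have [|c _ ->] := @MVT_segment R sin cos y x xy (fun z _ => is_derive_sin z).
  exact: continuous_subspaceT (@continuous_sin R).
by rewrite normrM ler_piMl// cos_max.
Qed.

Lemma prim_dist (f g : R -> R) (l d s : R) : continuous f -> continuous g -> 0 <= s <= l ->
  (forall t, 0 <= t <= l -> `|f t - g t| <= d) -> `|prim f s - prim g s| <= d * l.
Proof.
move=> cf cg /andP[s0 sl] fg.
have d0 : 0 <= d by apply: le_trans (fg 0 _) => //; rewrite lexx (le_trans s0 sl).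
have [||c] := @MVT_segment R (fun t => prim f t - prim g t) (fun t => f t - g t) 0 s s0.
- by move=> z _; exact: (deriveB_fun (prim_derive z cf) (prim_derive z cg)).
- apply: continuous_subspaceT => t; apply: cvgB; exact: prim_continuous.
rewrite !prim0 !subr0 in_itv/= => /andP[c0 cs] ->.
rewrite normrM (ger0_norm s0) ler_pM// fg// c0/=; exact: le_trans sl.
Qed.

Lemma continuous_cos_comp th : continuous th -> continuous (fun s => cos (th s)).
Proof. by move=> ct s; apply: continuous_comp; [exact: ct|exact: continuous_cos]. Qed.

Lemma continuous_sin_comp th : continuous th -> continuous (fun s => sin (th s)).
Proof. by move=> ct s; apply: continuous_comp; [exact: ct|exact: continuous_sin]. Qed.

Lemma similar_curve_coord (r : R) (Q : 'M[R]_2) (b : 'rV[R]_2) (j : 'I_2) th (psi : R -> R) (t a : R) :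
  continuous th -> is_derive t (1 : R) psi a ->
  is_derive t (1 : R) (fun t => (r *: (plane_curve th (psi t) *m Q) + b) 0 j)
    (((r * a) *: (vec2 (cos (th (psi t))) (sin (th (psi t))) *m Q)) 0 j).
Proof.
move=> ct dpsi.
have dx := @derive_comp_fun _ (prim (fun s => cos (th s))) psi t _ _
  (prim_derive _ (continuous_cos_comp ct)) dpsi.
have dy := @derive_comp_fun _ (prim (fun s => sin (th s))) psi t _ _
  (prim_derive _ (continuous_sin_comp ct)) dpsi.
have -> : (fun t => (r *: (plane_curve th (psi t) *m Q) + b) 0 j) = (fun t => r *
   (prim (fun s => cos (th s)) (psi t) * Q 0 j +
    prim (fun s => sin (th s)) (psi t) * Q 1 j) + b 0 j).
  by apply/funext => s; rewrite /plane_curve [LHS]mxE [X in X + _]mxE rV2_mul vec2_0 vec2_1.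
have d1 := deriveD_fun (deriveM_fun dx (derive_cst_fun (Q 0 j) t)) (deriveM_fun dy (derive_cst_fun (Q 1 j) t)).
apply: (is_derive_eq (deriveD_fun (deriveM_fun (derive_cst_fun r t) d1) (derive_cst_fun (b 0 j) t))).
by rewrite [RHS]mxE rV2_mul vec2_0 vec2_1; ring.
Qed.

Lemma is_derive_rV2 (f : R -> 'rV[R]_2) (d : 'rV[R]_2) (t : R) :
  is_derive t (1 : R) (fun t => f t 0 0) (d 0 0) ->
  is_derive t (1 : R) (fun t => f t 0 1) (d 0 1) -> is_derive t (1 : R) f d.
Proof.
move=> d0 d1; have E (v : 'rV[R]_2) : v = vec2 (v 0 0) (v 0 1) by apply: rV2P; rewrite ?vec2_0 ?vec2_1.
have -> : f = fun t => vec2 (f t 0 0) (f t 0 1) by apply/funext => s; exact: E.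
by rewrite (E d); exact: is_derive_vec2.
Qed.

Variables (p r l L al a0 m : R) (Q : 'M[R]_2) (b : 'rV[R]_2).
Hypothesis p1 : 1 < p.
Hypothesis r0 : 0 < r.
Hypothesis l0 : 0 < l.
Hypothesis QQ : Q *m Q^T = 1%:M.
(** The two affine bijections from [0, L] to [0, l], one preserving and one reversing the
    orientation; speed 1 / r compensates the similarity ratio r. *)
Hypothesis orient : (al = r^-1 /\ a0 = 0) \/ (al = - r^-1 /\ a0 = l).
Hypothesis LE : L = r * l.
Hypothesis m0l : 0 <= m <= l.

Let rN0 : r != 0. Proof. by rewrite gt_eqF. Qed.

Lemma reparam_itv (t : R) : 0 <= t <= L -> 0 <= al * t + a0 <= l.
Proof.
rewrite LE => /andP[t0 tL].
have h0 : 0 <= r^-1 * t by rewrite mulr_ge0// invr_ge0 ltW.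
have h1 : r^-1 * t <= l by rewrite mulrC ler_pdivrMr// mulrC.
by case: orient => -[-> ->]; apply/andP; split; lra.
Qed.

Let al2 : al ^+ 2 = r ^- 2.
Proof. by case: orient => -[-> _]; rewrite ?sqrrN exprVn. Qed.

Let alN0 : al != 0.
Proof. by case: orient => -[-> _]; rewrite ?oppr_eq0 invr_eq0. Qed.

Let norm_ral : `|r * al| = 1.
Proof. by case: orient => -[-> _]; rewrite ?mulrN ?normrN divff// normr1. Qed.

Let c := (m - a0) / al.

Let reparam_c : al * c + a0 = m.
Proof. by rewrite /c mulrC divfK// subrK. Qed.

Let c_itv : 0 <= c <= L.
Proof.
have /andP[m0 ml] := m0l; rewrite LE /c; case: orient => -[-> ->].
  by rewrite subr0 invrK mulrC; apply/andP; split; [exact: mulr_ge0 (ltW _) _|rewrite ler_pM2l].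
rewrite invrN invrK mulrN -mulNr opprB mulrC; apply/andP; split.
  by rewrite mulr_ge0 ?(ltW r0)// subr_ge0.
by rewrite ler_pM2l// lerBlDr lerDl.
Qed.

Let reparam_neq (t : R) : t != c -> al * t + a0 != m.
Proof.
by move=> tc; rewrite -reparam_c (inj_eq (addIr _)) (inj_eq (mulfI alN0)).
Qed.

Definition moved th (t : R) : 'rV[R]_2 := r *: (plane_curve th (al * t + a0) *m Q) + b.

Definition moved1 th (t : R) : 'rV[R]_2 :=
  (r * al) *: (vec2 (cos (th (al * t + a0))) (sin (th (al * t + a0))) *m Q).

(** The second derivative off the kink. The factor is r al^2, which is 1 / r for both
    orientations. *)
Definition moved2 th k (t : R) : 'rV[R]_2 :=
  r^-1 *: (vec2 (- (k (al * t + a0) * sin (th (al * t + a0))))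
                (k (al * t + a0) * cos (th (al * t + a0))) *m Q).

Lemma is_derive_coord th (j : 'I_2) (t : R) : continuous th ->
  is_derive t (1 : R) (fun t => moved th t 0 j) (moved1 th t 0 j).
Proof. by move=> ct; exact: (similar_curve_coord r Q b j ct (derive_affine_fun al a0 t)). Qed.

Lemma is_derive_coord1 th k (j : 'I_2) (t : R) : kinked m th k -> t != c ->
  is_derive t (1 : R) (fun t => moved1 th t 0 j) (moved2 th k t 0 j).
Proof.
move=> [ct _ dth] /reparam_neq tm; have aff := derive_affine_fun al a0 t.
have dt := @derive_comp_fun _ th (fun t => al * t + a0) t _ _ (dth _ tm) aff.
have dx := @derive_comp_fun _ cos _ t _ _ (is_derive_cos _) dt.
have dy := @derive_comp_fun _ sin _ t _ _ (is_derive_sin _) dt.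
have -> : (fun t => moved1 th t 0 j) = (fun t => (r * al) *
   (cos (th (al * t + a0)) * Q 0 j + sin (th (al * t + a0)) * Q 1 j)).
  by apply/funext => s; rewrite /moved1 [LHS]mxE rV2_mul vec2_0 vec2_1.
have d1 := deriveD_fun (deriveM_fun dx (derive_cst_fun (Q 0 j) t)) (deriveM_fun dy (derive_cst_fun (Q 1 j) t)).
apply: (is_derive_eq (deriveM_fun (derive_cst_fun (r * al) t) d1)).
rewrite /moved2 [RHS]mxE rV2_mul vec2_0 vec2_1.
have -> : r^-1 = r * al ^+ 2 by rewrite al2; field.
by ring.
Qed.

Lemma moved_is_derive th t : continuous th -> is_derive t (1 : R) (moved th) (moved1 th t).
Proof. by move=> ct; apply: is_derive_rV2; exact: is_derive_coord. Qed.

Lemma moved1_is_derive th k t : kinked m th k -> t != c ->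
  is_derive t (1 : R) (moved1 th) (moved2 th k t).
Proof. by move=> kt tc; apply: is_derive_rV2; exact: is_derive_coord1. Qed.

Lemma moved_derive1 th : continuous th -> (moved th)^`() = moved1 th.
Proof. by move=> ct; apply/funext => t; apply: derive1_is_derive; exact: moved_is_derive. Qed.

Lemma enorm_moved1 th t : enorm (moved1 th t) = 1.
Proof.
rewrite /moved1 enormZ enorm_mul// norm_ral mul1r /enorm vec2_0 vec2_1.
by rewrite cos2Dsin2 sqrtr1.
Qed.

(** Reflections and reversals flip the sign of the curvature, so only its absolute value is
    transported. *)
Lemma curvature_moved th k t : kinked m th k -> t != c ->
  `|curvature (moved th) t| = r^-1 * `|k (al * t + a0)|.
Proof.
move=> kt tc; have [ct _ _] := kt.
rewrite /curvature moved_derive1// (derive1_is_derive (moved1_is_derive kt tc)).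
rewrite enorm_moved1 expr1n divr1 /moved1 /moved2 det2Z normrM norm_det2_mul//.
rewrite normrM norm_ral mul1r (ger0_norm (_ : 0 <= r^-1)) ?invr_ge0 ?(ltW r0)//.
rewrite /det2 !vec2_0 !vec2_1; congr (_ * `|_|).
set x := th _; set y := k _.
transitivity (y * (cos x ^+ 2 + sin x ^+ 2)); first by ring.
by rewrite cos2Dsin2 mulr1.
Qed.

Let affine_continuous : continuous (fun t : R => al * t + a0).
Proof. exact: is_derive_continuousT (derive_affine_fun al a0). Qed.

Let comp_affine (f : R -> R) : continuous f -> continuous (fun t => f (al * t + a0)).
Proof.
move=> cf t; apply: (@continuous_comp _ _ _ (fun t => al * t + a0) f); last exact: cf.
exact: affine_continuous.
Qed.

(* Reversing the orientation swaps the two sides of the kink. *)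
Lemma kinked_piecewise th k : kinked m th k -> exists f1 f2,
  piecewise c L (fun t => k (al * t + a0)) f1 f2.
Proof.
move=> [_ [k1 [k2 [c1 c2 H1 H2]]] _]; have r1 : 0 < r^-1 by rewrite invr_gt0.
case: (orient) => -[alE _].
- exists (fun t => k1 (al * t + a0)), (fun t => k2 (al * t + a0)); split; try exact: comp_affine.
  have al0 : 0 < al by rewrite alE.
  by move=> t _; split=> tc; [apply: H1|apply: H2]; rewrite -reparam_c ltrD2r ltr_pM2l.
- exists (fun t => k2 (al * t + a0)), (fun t => k1 (al * t + a0)); split; try exact: comp_affine.
  have al0 : al < 0 by rewrite alE oppr_lt0.
  by move=> t _; split=> tc; [apply: H2|apply: H1]; rewrite -reparam_c ltrD2r ltr_nM2l.
Qed.

(** [e] is a continuous substitute for |k|^p, whose value at [m] is arbitrary; it makes the energy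
    computable from an explicit primitive. *)
Lemma moved_bending th k e : kinked m th k -> continuous e ->
  (forall s, 0 <= s <= l -> s != m -> `|k s| `^ p = e s) ->
  bending p L (moved th) = r^-1 `^ p * (r * prim e l).
Proof.
move=> kt ce ke; have [ct _ _] := kt.
have cf : continuous (fun t => r^-1 `^ p * e (al * t + a0)).
  by move=> t; apply: cvgM; [exact: cvg_cst|exact: comp_affine].
have pf : piecewise c L (fun t => `|curvature (moved th) t| `^ p * enorm ((moved th)^`() t))
    (fun t => r^-1 `^ p * e (al * t + a0)) (fun t => r^-1 `^ p * e (al * t + a0)).
  have E t : 0 < t < L -> t != c ->
      `|curvature (moved th) t| `^ p * enorm ((moved th)^`() t) = r^-1 `^ p * e (al * t + a0).
    move=> /andP[t0 tL] tc; rewrite (curvature_moved kt tc) moved_derive1// enorm_moved1 mulr1.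
    rewrite powRM ?invr_ge0 ?(ltW r0)// ke//; last exact: reparam_neq.
    by apply: reparam_itv; rewrite !ltW.
  by split=> // t ht; split=> tc; apply: E => //; [rewrite lt_eqF|rewrite gt_eqF].
(* Both branches are the same continuous function, so the split at [c] cancels. *)
rewrite /bending (Rintegral_piecewise c_itv pf) addrC subrK.
have dG t : is_derive t (1 : R) (fun t => r^-1 `^ p * (al^-1 * prim e (al * t + a0)))
    (r^-1 `^ p * e (al * t + a0)).
  have d1 := @derive_comp_fun _ (prim e) (fun t => al * t + a0) t _ _
    (prim_derive _ ce) (derive_affine_fun al a0 t).
  have d2 := deriveM_fun (derive_cst_fun al^-1 t) d1.
  apply: (is_derive_eq (deriveM_fun (derive_cst_fun (r^-1 `^ p) t) d2)).
  by rewrite mul0r add0r; field.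
rewrite (prim_unique cf dG) -!mulrBr; congr (_ * _).
rewrite LE; case: orient => -[-> ->].
  rewrite mulr0 !addr0 prim0 subr0 invrK mulrA mulVf// mul1r.
  by [].
rewrite (_ : - r^-1 * (r * l) + l = 0); last by field.
by rewrite mulr0 add0r invrN invrK prim0 sub0r mulrN mulNr opprK.
Qed.

Lemma moved2_piecewise th k (j : 'I_2) : kinked m th k ->
  exists g1 g2, piecewise c L (fun t => moved2 th k t 0 j) g1 g2.
Proof.
move=> kt; have [ct _ _] := kt; have [f1 [f2 pk]] := kinked_piecewise kt.
have cth := comp_affine ct.
have cc := continuous_cos_comp cth; have cs := continuous_sin_comp cth.
pose N (x s : R) (c : R) := r^-1 * (- (x * s) * Q 0 j + x * c * Q 1 j).
have cN (f : R -> R) : continuous f ->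
    continuous (fun t => N (f t) (sin (th (al * t + a0))) (cos (th (al * t + a0)))).
  move=> cf t; apply: cvgM; first exact: cvg_cst.
  apply: cvgD; (apply: cvgM; last exact: cvg_cst); first apply: cvgN;
    by apply: cvgM; [exact: cf|first [exact: cs|exact: cc]].
have [cf1 cf2 Hk] := pk.
exists (fun t => N (f1 t) (sin (th (al * t + a0))) (cos (th (al * t + a0)))),
   (fun t => N (f2 t) (sin (th (al * t + a0))) (cos (th (al * t + a0)))).
split; [exact: cN|exact: cN|move=> t /Hk[h1 h2]].
have E : moved2 th k t 0 j = N (k (al * t + a0)) (sin (th (al * t + a0))) (cos (th (al * t + a0))).
  by rewrite /moved2 [LHS]mxE rV2_mul vec2_0 vec2_1.
by split=> tc; rewrite E; [rewrite h1|rewrite h2].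
Qed.

Lemma moved1_continuous th (j : 'I_2) : continuous th -> continuous (fun t => moved1 th t 0 j).
Proof.
move=> ct; have cth := comp_affine ct.
have cc := continuous_cos_comp cth; have cs := continuous_sin_comp cth.
have -> : (fun t => moved1 th t 0 j) = (fun t => (r * al) *
   (cos (th (al * t + a0)) * Q 0 j + sin (th (al * t + a0)) * Q 1 j)).
  by apply/funext => s; rewrite /moved1 [LHS]mxE rV2_mul vec2_0 vec2_1.
move=> t; apply: cvgM; first exact: cvg_cst.
by apply: cvgD; (apply: cvgM; last exact: cvg_cst); [exact: cc|exact: cs].
Qed.

Lemma moved_W2p th k : kinked m th k -> W2p_plane p L (moved th).
Proof.
move=> kt j; have [ct _ _] := kt; have [f1 [f2 pk]] := moved2_piecewise j kt.
have p0 : 0 < p := lt_trans ltr01 p1.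
apply: (@W2p_piecewise _ p L c _ (fun t => moved1 th t 0 j) (fun t => moved2 th k t 0 j) f1 f2) => //.
- by move=> t; exact: is_derive_coord.
- exact: moved1_continuous.
- by move=> t _ tc; exact: is_derive_coord1.
Qed.

Lemma enorm_piecewise (f : R -> 'rV[R]_2) f1 f2 g1 g2 :
  piecewise c L (fun t => f t 0 0) f1 f2 -> piecewise c L (fun t => f t 0 1) g1 g2 ->
  exists h1 h2, piecewise c L (fun t => enorm (f t)) h1 h2.
Proof.
move=> pf pg; have [cf1 cf2 _] := pf; have [cg1 cg2 _] := pg.
have cE (x y : R -> R) : continuous x -> continuous y ->
    continuous (fun t => Num.sqrt (x t ^+ 2 + y t ^+ 2)).
  move=> cx cy t; apply: (@continuous_comp _ _ _ (fun t => x t ^+ 2 + y t ^+ 2) Num.sqrt);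
    last exact: sqrt_continuous.
  by apply: cvgD; apply: cvgM; first [exact: cx|exact: cy].
eexists; eexists.
exact: (@piecewise2 _ c L _ _ _ _ _ _ (fun x y => Num.sqrt (x ^+ 2 + y ^+ 2)) pf pg (cE _ _ cf1 cg1) (cE _ _ cf2 cg2)).
Qed.

Lemma coordB (u v : 'rV[R]_2) j : (u - v) 0 j = u 0 j - v 0 j.
Proof. by rewrite !mxE. Qed.

Lemma piecewiseB (f g : R -> R) f1 f2 g1 g2 : piecewise c L f f1 f2 -> piecewise c L g g1 g2 ->
  exists h1 h2, piecewise c L (fun t => f t - g t) h1 h2.
Proof.
move=> pf pg; have [cf1 cf2 _] := pf; have [cg1 cg2 _] := pg.
exists (fun t => f1 t - g1 t), (fun t => f2 t - g2 t).
apply: (@piecewise2 _ c L _ _ _ _ _ _ (fun x y => x - y) pf pg) => t; apply: cvgB;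
  by [exact: cf1|exact: cg1|exact: cf2|exact: cg2].
Qed.

(** The three summands bound position, tangent and second derivative. Each 2 comes from [enorm_le],
    and d + K d is the error of the products of curvature with cosine or sine. Both curves undergo
    the same motion, so only the differences of angles and curvatures matter. *)
Lemma moved_dist th1 k1 th2 k2 (d K : R) : kinked m th1 k1 -> kinked m th2 k2 -> 0 <= d -> 0 <= K ->
  (forall s, 0 <= s <= l -> `|th1 s - th2 s| <= d) ->
  (forall s, 0 <= s <= l -> `|k1 s - k2 s| <= d) ->
  (forall s, 0 <= s <= l -> `|k2 s| <= K) ->
  (W2p_norm p L (fun t => moved th1 t - moved th2 t)%R <=
   ((2 * (r * (d * l)) + 2 * d + 2 * (r^-1 * (d + K * d))) * L `^ p^-1)%:E)%E.
Proof.
move=> kt1 kt2 d0 K0 hth hk hK; have [ct1 _ _] := kt1; have [ct2 _ _] := kt2.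
have p0 : 0 < p := lt_trans ltr01 p1.
have L0 : 0 <= L by rewrite LE mulr_ge0// ltW.
have ri0 : 0 < r^-1 by rewrite invr_gt0.
pose D t := moved th1 t - moved th2 t.
have dD t : is_derive t (1 : R) D (moved1 th1 t - moved1 th2 t).
  by apply: is_deriveB; exact: moved_is_derive.
have D1E : D^`() = fun t => moved1 th1 t - moved1 th2 t.
  by apply/funext => t; apply: derive1_is_derive; exact: dD.
have D2E t : t != c -> D^`()^`() t = moved2 th1 k1 t - moved2 th2 k2 t.
  move=> tc; rewrite D1E; apply: derive1_is_derive.
  by apply: is_deriveB; exact: moved1_is_derive.
have cosd s : 0 <= s <= l -> `|cos (th1 s) - cos (th2 s)| <= d.
  by move=> hs; apply: le_trans (cos_lipschitz _ _) (hth s hs).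
have sind s : 0 <= s <= l -> `|sin (th1 s) - sin (th2 s)| <= d.
  by move=> hs; apply: le_trans (sin_lipschitz _ _) (hth s hs).
have re t : 0 < t < L -> 0 <= al * t + a0 <= l.
  by move=> /andP[? ?]; apply: reparam_itv; rewrite !ltW.
have meas (f : R -> 'rV[R]_2) : (forall j, exists g1 g2, piecewise c L (fun t => f t 0 j) g1 g2) ->
    measurable_fun `]0, L[ ((fun t => enorm (f t)) : measurableTypeR R -> measurableTypeR R).
  move=> pf; have [f1 [f2 pf0]] := pf 0; have [g1 [g2 pf1]] := pf 1.
  by have [h1 [h2 ph]] := enorm_piecewise pf0 pf1; exact: piecewise_measurable ph.
have norm_enorm (u : 'rV[R]_2) : `|enorm u| = enorm u by rewrite ger0_norm// sqrtr_ge0.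
have L2 (j : 'I_2) : exists g1 g2, piecewise c L (fun t => D t 0 j) g1 g2.
  have cD : continuous (fun t => D t 0 j).
    have -> : (fun t => D t 0 j) = (fun t => moved th1 t 0 j - moved th2 t 0 j).
      by apply/funext => t; rewrite /D coordB.
    move=> t; apply: cvgB.
      exact: is_derive_continuous (is_derive_coord j t ct1).
    exact: is_derive_continuous (is_derive_coord j t ct2).
  by exists (fun t => D t 0 j), (fun t => D t 0 j); exact: continuous_piecewise.
have L3 (j : 'I_2) : exists g1 g2, piecewise c L (fun t => D^`() t 0 j) g1 g2.
  have -> : (fun t => D^`() t 0 j) = (fun t => moved1 th1 t 0 j - moved1 th2 t 0 j).
    by apply/funext => t; rewrite D1E coordB.
  have c1 : continuous (fun t => moved1 th1 t 0 j) by exact: moved1_continuous.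
  have c2 : continuous (fun t => moved1 th2 t 0 j) by exact: moved1_continuous.
  exists (fun t => moved1 th1 t 0 j - moved1 th2 t 0 j), (fun t => moved1 th1 t 0 j - moved1 th2 t 0 j).
  by apply: continuous_piecewise => t; apply: cvgB; [exact: c1|exact: c2].
have L4 (j : 'I_2) : exists g1 g2, piecewise c L (fun t => D^`()^`() t 0 j) g1 g2.
  have [f1 [f2 pf]] := moved2_piecewise j kt1; have [g1 [g2 pg]] := moved2_piecewise j kt2.
  have [h1 [h2 [ch1 ch2 ph]]] := piecewiseB pf pg; exists h1, h2; split=> // t ht.
  have [H1 H2] := ph t ht; split=> tc.
    by rewrite D2E ?coordB ?H1// lt_eqF.
  by rewrite D2E ?coordB ?H2// gt_eqF.
have B2 t : 0 < t < L -> t != c -> `|enorm (D t)| <= 2 * (r * (d * l)).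
  move=> /re ht _; rewrite norm_enorm.
  have -> : D t = r *: ((plane_curve th1 (al * t + a0) - plane_curve th2 (al * t + a0)) *m Q).
    by rewrite /D /moved mulmxBl scalerBr opprD addrACA subrr addr0.
  rewrite enormZ enorm_mul// (ger0_norm (ltW r0)) mulrCA ler_pM2l//.
  apply: enorm_le; rewrite coordB ?vec2_0 ?vec2_1.
    by apply: prim_dist => //; exact: continuous_cos_comp.
  by apply: prim_dist => //; exact: continuous_sin_comp.
have B3 t : 0 < t < L -> t != c -> `|enorm (D^`() t)| <= 2 * d.
  move=> /re ht _; rewrite norm_enorm D1E /moved1 -scalerBr -mulmxBl enormZ norm_ral mul1r enorm_mul//.
  by apply: enorm_le; rewrite coordB ?vec2_0 ?vec2_1; [exact: cosd|exact: sind].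
have prodd (x1 x2 y1 y2 : R) : `|x1 - x2| <= d -> `|x2| <= K -> `|y1| <= 1 -> `|y1 - y2| <= d ->
    `|x1 * y1 - x2 * y2| <= d + K * d.
  move=> hx hx2 hy hyy.
  rewrite (_ : x1 * y1 - x2 * y2 = (x1 - x2) * y1 + x2 * (y1 - y2)); last by ring.
  rewrite (le_trans (ler_normD _ _))// !normrM lerD//.
    by rewrite -[leRHS]mulr1 ler_pM.
  by rewrite ler_pM.
have B4 t : 0 < t < L -> t != c -> `|enorm (D^`()^`() t)| <= 2 * (r^-1 * (d + K * d)).
  move=> /re ht tc; rewrite norm_enorm D2E// /moved2 -scalerBr -mulmxBl enormZ enorm_mul//.
  rewrite (ger0_norm (ltW ri0)) mulrCA ler_pM2l//.
  apply: enorm_le; rewrite coordB ?vec2_0 ?vec2_1.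
    rewrite -opprD normrN; apply: prodd; [exact: hk|exact: hK|exact: sin_max|exact: sind].
  by apply: prodd; [exact: hk|exact: hK|exact: cos_max|exact: cosd].
rewrite /W2p_norm /Lp_norm -/D (mulrDl (_ + 2 * d)) (mulrDl (2 * (r * (d * l)))) !EFinD.
have rdl : 0 <= r * (d * l) by rewrite !mulr_ge0// ltW.
have rdK : 0 <= r^-1 * (d + K * d) by rewrite mulr_ge0 ?(ltW ri0)// addr_ge0// mulr_ge0.
have M2 : 0 <= 2 * (r * (d * l)) by rewrite mulr_ge0.
have M3 : 0 <= 2 * d by rewrite mulr_ge0.
have M4 : 0 <= 2 * (r^-1 * (d + K * d)) by rewrite mulr_ge0.
apply: leeD; first apply: leeD.
- exact: Lnorm_bound p0 L0 M2 (meas _ L2) B2.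
- exact: Lnorm_bound p0 L0 M3 (meas _ L3) B3.
- exact: Lnorm_bound p0 L0 M4 (meas _ L4) B4.
Qed.

Lemma Lp_norm_eq (u v : R -> 'rV[R]_2) : (forall t, 0 < t < L -> u t = v t) ->
  Lp_norm p L u = Lp_norm p L v.
Proof.
move=> uv; rewrite /Lp_norm; apply: eq_Lnorm => t /=; rewrite !patchE; case: ifPn => //.
by rewrite inE/= in_itv/= => /uv ->.
Qed.

Lemma W2p_norm_eq (u v : R -> 'rV[R]_2) : (forall t, 0 < t < L -> u t = v t) ->
  W2p_norm p L u = W2p_norm p L v.
Proof.
move=> uv; have uv1 := derive1_eq_oo uv; have uv2 := derive1_eq_oo uv1.
have E0 := Lp_norm_eq uv; have E1 := Lp_norm_eq uv1; have E2 := Lp_norm_eq uv2.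
exact: (f_equal2 adde (f_equal2 adde E0 E1) E2).
Qed.

Lemma bending_eq (u v : R -> 'rV[R]_2) : (forall t, 0 < t < L -> u t = v t) ->
  bending p L u = bending p L v.
Proof.
move=> uv; have uv1 := derive1_eq_oo uv; have uv2 := derive1_eq_oo uv1.
rewrite /bending; apply: eq_Rintegral => t; rewrite inE/= in_itv/= => ht.
pose F (x y : 'rV[R]_2) := `|det2 x y / enorm x ^+ 3| `^ p * enorm x.
exact: (f_equal2 F (uv1 t ht) (uv2 t ht)).
Qed.

Lemma kinked_bounded th k : kinked m th k -> exists2 K, 0 <= K & forall s, 0 <= s <= l -> `|k s| <= K.
Proof.
move=> [_ [k1 [k2 [c1 c2 H1 H2]]] _].
have [K1 B1] := continuous_itv_bounded (ltW l0) c1.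
have [K2 B2] := continuous_itv_bounded (ltW l0) c2.
exists (Num.max `|k m| (Num.max K1 K2)); first by rewrite le_max normr_ge0.
move=> s hs; rewrite !le_max; case: (ltgtP s m) => [/H1 ->|/H2 ->|->]; last by rewrite lexx.
  by rewrite B1// orbT.
by rewrite B2// !orbT.
Qed.

(** Reduces instability to a statement on angles: equal integrals of cosine and sine mean equal
    endpoints, and sup-norm bounds on angle and curvature put the competitor into any prescribed
    neighbourhood. *)
Lemma moved_not_local_minimizer (P0 P1 : 'rV[R]_2) (gamma : R -> 'rV[R]_2) th0 k0 e0 :
  kinked m th0 k0 -> continuous e0 ->
  (forall s, 0 <= s <= l -> s != m -> `|k0 s| `^ p = e0 s) ->
  (forall t, 0 <= t <= L -> gamma t = moved th0 t) ->
  (forall d, 0 < d -> exists th k e, [/\ kinked m th k, continuous e,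
      forall s, 0 <= s <= l -> s != m -> `|k s| `^ p = e s &
    [/\ prim (fun s => cos (th s)) l = prim (fun s => cos (th0 s)) l,
        prim (fun s => sin (th s)) l = prim (fun s => sin (th0 s)) l,
        forall s, 0 <= s <= l -> `|th s - th0 s| <= d,
        forall s, 0 <= s <= l -> `|k s - k0 s| <= d & prim e l < prim e0 l]]) ->
  ~ local_minimizer p L P0 P1 gamma.
Proof.
move=> kt0 ce0 hk0 gE pert [[_ _ g0 gL] [e e_gt0 gmin]].
have L0 : 0 < L by rewrite LE mulr_gt0.
have gE' t : 0 < t < L -> gamma t = moved th0 t.
  by move=> /andP[? ?]; apply: gE; rewrite !ltW.
have [K K0 HK] := kinked_bounded kt0.
have half_lt (x : R) : 0 < x -> e / (2 * x) * x < e.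
  by move=> x0; rewrite invfM mulrA divfK ?gt_eqF// ltr_pdivrMr// ltr_pMr// ltr1n.
(* The estimate of [moved_dist] is linear in d with slope [C]; d = e / (2 C) therefore gives e / 2 <
   e. *)
pose C := (2 * (r * l) + 2 + 2 * (r^-1 * (1 + K))) * L `^ p^-1.
have C0 : 0 < C.
  rewrite mulr_gt0 ?powR_gt0// addr_gt0//.
    by rewrite addr_gt0// !mulr_gt0.
  by rewrite !mulr_gt0 ?invr_gt0// (lt_le_trans ltr01)// lerDl.
pose d := e / (2 * C); have d0 : 0 < d by rewrite divr_gt0// mulr_gt0.
have [th [k [en [kt ce hk [hX hY hth hkk hen]]]]] := pert d d0.
have [ct _ _] := kt.
(* Agreement at both ends of [0, l] serves both orientations, which differ in the end that
   corresponds to t = 0. *)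
have endE s : s = 0 \/ s = l -> plane_curve th s = plane_curve th0 s.
  by case=> ->; rewrite /plane_curve ?prim0// hX hY.
have endL : al * L + a0 = 0 \/ al * L + a0 = l.
  rewrite LE; case: orient => -[-> ->]; [right|left]; first by rewrite addr0 mulrA mulVf// mul1r.
  by rewrite mulNr mulrA mulVf// mul1r addNr.
have end0 : al * 0 + a0 = 0 \/ al * 0 + a0 = l.
  by rewrite mulr0 add0r; case: orient => -[_ ->]; [left|right].
have A : A_pin p L P0 P1 (moved th).
  split; first exact: moved_W2p kt.
  - by move=> t _; rewrite moved_derive1// enorm_moved1.
  - by rewrite -g0 (gE 0 _) ?lexx ?(ltW L0)// /moved (endE _ end0).
  - by rewrite -gL (gE L _) ?lexx ?(ltW L0)// /moved (endE _ endL).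
have N : (W2p_norm p L (fun t => moved th t - gamma t)%R < e%:E)%E.
  rewrite (@W2p_norm_eq _ (fun t => moved th t - moved th0 t)); last first.
    by move=> t ht; rewrite gE'.
  apply: (le_lt_trans (moved_dist kt kt0 (ltW d0) K0 hth hkk HK)); rewrite lte_fin.
  have -> : (2 * (r * (d * l)) + 2 * d + 2 * (r^-1 * (d + K * d))) * L `^ p^-1 = d * C.
    by rewrite /C; ring.
  exact: half_lt.
have := gmin _ A N; apply/negP; rewrite -ltNge.
rewrite (bending_eq gE') (moved_bending kt ce hk) (moved_bending kt0 ce0 hk0).
by rewrite ltr_pM2l ?powR_gt0 ?invr_gt0// ltr_pM2l.
Qed.

End Curves.

(** * Flat-core curves *)
Section FlatCoreAngle.
Context {R : realType}.
Local Notation mu := (@lebesgue_measure R).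
Implicit Types (th : R -> R) (c : @pcurve R) (l : nat -> R) (sigma : nat -> bool).

(** Stated through cosine and sine because the curve depends on its angle only through these. *)
Definition congruent_2pi (x y : R) := cos x = cos y /\ sin x = sin y.

(* c is the unit speed curve with tangent angle th, started at the origin. *)
Definition turning c (h : R) th := [/\ lo c = 0, hi c = h, 0 <= h, continuous th &
  forall s, 0 <= s <= h -> pt c s = plane_curve th s].

Definition chord_x th (s : R) := prim (fun t => cos (th t)) s.
Definition chord_y th (s : R) := prim (fun t => sin (th t)) s.

Lemma plane_curve_congr th1 th2 (s : R) : 0 <= s ->
  (forall t, 0 <= t <= s -> congruent_2pi (th1 t) (th2 t)) -> plane_curve th1 s = plane_curve th2 s.
Proof.
move=> s0 E; rewrite /plane_curve; congr vec2; apply: prim_ext => // t /E[] //.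
Qed.

Lemma prim_shift (f g : R -> R) (a h : R) : continuous f -> continuous g -> 0 <= h ->
  (forall t, 0 <= t <= h -> f (a + t) = g t) -> prim f (a + h) = prim f a + prim g h.
Proof.
move=> cf cg h0 fg; apply/eqP; rewrite [eqbRHS]addrC -subr_eq; apply/eqP.
have dG (t : R) : is_derive t (1 : R) (fun t => prim g (1 * t + (- a))) (g (t - a)).
  have := @derive_comp_fun _ (prim g) (fun t => 1 * t + (- a)) t _ _
    (prim_derive _ cg) (derive_affine_fun 1 (- a) t).
  by move=> d; apply: (is_derive_eq d); rewrite mulr1 mul1r.
have ah : a <= a + h by rewrite lerDl.
have d (t : R) : a < t < a + h -> is_derive t (1 : R) (fun t => prim g (1 * t + (- a))) (f t).
  move=> /andP[t1 t2]; apply: (is_derive_eq (dG t)).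
  rewrite -(fg (t - a)); first by rewrite addrC subrK.
  by rewrite subr_ge0 lerBlDl !ltW.
rewrite (prim_diff cf (is_derive_continuousT dG) ah d).
by rewrite !mul1r subrr prim0 subr0 addrAC subrr add0r.
Qed.

(** Congruence modulo 2 pi is the right comparison: each piece restarts its own angle, while a
    continuous angle of the whole curve keeps the full turns of the loops already passed. *)
Lemma turning_concat c1 c2 (h1 h2 : R) th1 th2 th : turning c1 h1 th1 -> turning c2 h2 th2 ->
  continuous th ->
  (forall s, 0 <= s <= h1 -> congruent_2pi (th s) (th1 s)) ->
  (forall s, 0 <= s <= h2 -> congruent_2pi (th (h1 + s)) (th2 s)) ->
  [/\ turning (concat c1 c2) (h1 + h2) th,
      chord_x th (h1 + h2) = chord_x th1 h1 + chord_x th2 h2 &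
      chord_y th (h1 + h2) = chord_y th1 h1 + chord_y th2 h2].
Proof.
move=> [lo1 hi1 h10 cth1 pt1] [lo2 hi2 h20 cth2 pt2] cth E1 E2.
have cc := continuous_cos_comp cth; have cs := continuous_sin_comp cth.
have cc2 := continuous_cos_comp cth2; have cs2 := continuous_sin_comp cth2.
have X1 : prim (fun t => cos (th t)) h1 = prim (fun t => cos (th1 t)) h1.
  by apply: prim_ext => // t /E1[].
have Y1 : prim (fun t => sin (th t)) h1 = prim (fun t => sin (th1 t)) h1.
  by apply: prim_ext => // t /E1[].
have shift s : 0 <= s <= h2 ->
    prim (fun t => cos (th t)) (h1 + s) = prim (fun t => cos (th1 t)) h1 + prim (fun t => cos (th2 t)) s /\
    prim (fun t => sin (th t)) (h1 + s) = prim (fun t => sin (th1 t)) h1 + prim (fun t => sin (th2 t)) s.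
  move=> /andP[s0 sh]; have E2' t : 0 <= t <= s -> congruent_2pi (th (h1 + t)) (th2 t).
    by move=> /andP[t0 ts]; apply: E2; rewrite t0 (le_trans ts).
  by rewrite -X1 -Y1; split; apply: prim_shift => // t /E2'[].
have hh : 0 <= h2 <= h2 by rewrite h20 lexx.
split; [|by have [] := shift _ hh|by have [] := shift _ hh].
split=> //=; rewrite ?lo1 ?lo2 ?hi1 ?hi2 ?subr0 ?addr_ge0//.
move=> s /andP[s0 sh]; rewrite addr0; case: ifPn => [sh1|].
  rewrite pt1 ?s0//; apply: plane_curve_congr => // t /andP[t0 ts].
  by have /E1[Ec Es] : 0 <= t <= h1; [rewrite t0 (le_trans ts)|split].
rewrite -ltNge => h1s.
have hs : 0 <= s - h1 <= h2 by rewrite subr_ge0 (ltW h1s) lerBlDl.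
have h11 : 0 <= h1 <= h1 by rewrite h10 lexx.
have h00 : 0 <= 0 :> R by [].
rewrite (pt2 (s - h1) hs) (pt1 h1 h11) (pt2 0); last by rewrite lexx.
have [Ex Ey] := shift _ hs; rewrite subrKC in Ex Ey.
by apply: rV2P; rewrite /plane_curve !mxE/= !prim0 subr0 ?Ex ?Ey addrC.
Qed.

Lemma turning_seg (h : R) : 0 <= h -> turning (seg h) h (fun=> 0).
Proof.
move=> h0; split=> //=; first exact: cst_continuous.
move=> s _; rewrite /plane_curve cos0 sin0 !prim_cst.
by rewrite mul1r mul0r.
Qed.

Lemma chord_seg (h : R) : chord_x (fun=> 0) h = h /\ chord_y (fun=> 0) h = 0.
Proof. by rewrite /chord_x /chord_y cos0 sin0 !prim_cst mul1r mul0r. Qed.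

Definition signb (a : bool) : R := if a then 1 else -1.

Lemma congruent_2pi_addl (x y z : R) : congruent_2pi x 0 -> congruent_2pi y z -> congruent_2pi (x + y) z.
Proof.
move=> [c1 s1] [c2 s2]; rewrite /congruent_2pi cosD sinD c1 s1 cos0 sin0 c2 s2.
by rewrite !mul1r !mul0r subr0 add0r.
Qed.

Lemma congruent_2pi_sum (I : Type) (r : seq I) (P : pred I) (F : I -> R) :
  (forall i, P i -> congruent_2pi (F i) 0) -> congruent_2pi (\sum_(i <- r | P i) F i) 0.
Proof.
move=> H; apply: (big_ind (fun x => congruent_2pi x 0)); [by split| |exact: H].
by move=> x y; exact: congruent_2pi_addl.
Qed.

Lemma congruent_2pi_signb (a : bool) : congruent_2pi (signb a * (2 * pi)) 0.
Proof.
rewrite /signb /congruent_2pi mulr_natl.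
by case: a; rewrite ?mul1r ?mulN1r ?cosN ?sinN cos2pi sin2pi cos0 sin0 ?oppr0.
Qed.

Lemma is_derive_bigsum (I : Type) (r : seq I) (P : pred I) (F F' : I -> R -> R) (t : R) :
  (forall i, is_derive t (1 : R) (F i) (F' i t)) ->
  is_derive t (1 : R) (fun t => \sum_(i <- r | P i) F i t) (\sum_(i <- r | P i) F' i t).
Proof.
move=> dF; elim: r => [|i r IH].
  rewrite big_nil; under eq_fun do rewrite big_nil.
  exact: derive_cst_fun.
rewrite big_cons; under eq_fun do rewrite big_cons.
by case: (P i) => //; exact: deriveD_fun.
Qed.

Lemma continuous_bigsum (I : Type) (r : seq I) (P : pred I) (F : I -> R -> R) :
  (forall i, continuous (F i)) -> continuous (fun t => \sum_(i <- r | P i) F i t).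
Proof.
move=> cF; elim: r => [|i r IH].
  under eq_fun do rewrite big_nil.
  exact: cst_continuous.
under eq_fun do rewrite big_cons.
by case: (P i) => // t; apply: cvgD; [exact: cF|exact: IH].
Qed.

Section Loops.
Variables (p : R) (Th ka : R -> R).
Hypothesis prof : loop_profile Th ka.
Hypothesis angleE : {in `[0, 1], loop_angle p =1 Th}.

(** Reflection in the first axis amounts to negating the angle. *)
Lemma turning_loop (a : bool) : turning (loop p a) 1 (fun s => signb a * Th s).
Proof.
have cT := profile_continuous prof.
split=> //=; first by move=> s; apply: cvgM; [exact: cvg_cst|exact: cT].
move=> s /andP[s0 s1]; rewrite /plane_curve.
have intE (f : R -> R) : \int[mu]_(t in `[0, s]) f (loop_angle p t) = prim (fun t => f (Th t)) s.
  rewrite prim_ge0E//; apply: eq_Rintegral => t; rewrite inE/= in_itv/= => /andP[t0 ts].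
  by rewrite angleE// in_itv/= t0 (le_trans ts).
have cs := profile_sin_continuous prof.
rewrite (intE cos) (intE sin); congr vec2.
  by apply: prim_ext => // t _; case: a; rewrite /signb ?mul1r// mulN1r cosN.
case: a; rewrite /signb; first by apply: prim_ext => // t _; rewrite mul1r.
transitivity (prim (fun t => -1 * sin (Th t)) s); first by rewrite (primZ (-1) s cs) mulN1r.
apply: prim_ext => // t _.
by rewrite !mulN1r sinN.
Qed.

Lemma chord_loop (a : bool) : 0 < chord_x (fun s => signb a * Th s) 1 /\
  chord_y (fun s => signb a * Th s) 1 = 0.
Proof.
split.
  rewrite /chord_x (@prim_ext _ _ (fun t => cos (Th t)))//; first exact: (profile_dx_gt0 prof).
  by move=> t _; case: a; rewrite /signb ?mul1r// mulN1r cosN.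
rewrite /chord_y (@prim_ext _ _ (fun t => signb a * sin (Th t)))//; last first.
  by move=> t _; case: a; rewrite /signb ?mul1r// !mulN1r sinN.
by rewrite (primZ _ _ (profile_sin_continuous prof)) -/(loop_dy Th 1) (loop_dy1 prof) mulr0.
Qed.

(* Arclength at which the (n+1)-st loop starts. *)
Definition core_length l (n : nat) : R := \sum_(i < n.+1) l i + n%:R.

(** A continuous angle for the whole curve: a loop not yet reached contributes 0, a loop already
    passed contributes a full turn 2 pi or - 2 pi. *)
Definition core_angle sigma l (n : nat) (s : R) : R :=
  \sum_(i < n) signb (sigma i.+1) * Th (s - core_length l i).

Lemma core_length0 l : core_length l 0 = l 0%N.
Proof. by rewrite /core_length big_ord_recl big_ord0 !addr0. Qed.

Lemma core_lengthS l n : core_length l n.+1 = core_length l n + 1 + l n.+1.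
Proof. by rewrite /core_length big_ord_recr/= -natr1; ring. Qed.

Lemma core_length_lt l N (i j : nat) : (forall k, (k <= N)%N -> 0 <= l k) -> (i < j <= N)%N ->
  core_length l i + 1 <= core_length l j.
Proof.
move=> l0 /andP[]; elim: j => // j IH; rewrite ltnS leq_eqVlt => /predU1P[->|ij] jN.
  by rewrite core_lengthS lerDl l0.
rewrite core_lengthS (le_trans (IH ij (ltnW jN)))// -addrA lerDl.
by rewrite addr_ge0 ?l0.
Qed.

Lemma core_length_ge0 l N (i : nat) : (forall k, (k <= N)%N -> 0 <= l k) -> (i <= N)%N ->
  0 <= core_length l i.
Proof.
move=> l0 iN; apply: addr_ge0 => //; apply: sumr_ge0 => k _; apply: l0.
by rewrite (leq_trans _ iN)// -ltnS.
Qed.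

Lemma shifted_loop_is_derive (a : bool) (x t : R) :
  is_derive t (1 : R) (fun s => signb a * Th (s - x)) (signb a * ka (t - x)).
Proof.
have dx : is_derive t (1 : R) (fun s => s - x) 1.
  by apply: (is_derive_eq (deriveB_fun (is_derive_id t (1 : R)) (derive_cst_fun x t))); rewrite subr0.
have d := @derive_comp_fun _ Th (fun s => s - x) t _ _ (profile_is_derive prof _) dx.
apply: (is_derive_eq (deriveM_fun (derive_cst_fun (signb a) t) d)).
by rewrite mul0r add0r mulr1.
Qed.

Lemma core_angle_continuous sigma l n : continuous (core_angle sigma l n).
Proof.
by apply: continuous_bigsum => i; exact: is_derive_continuousT (shifted_loop_is_derive _ _).
Qed.

(** Strict positivity of the horizontal chord provides the [X0 > 0] required for rescaling and
    rotating. The weak inequality carries the induction, since without loops the chord may be 0. *)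
Lemma flat_core_turning sigma l N : (forall j, (j <= N)%N -> 0 <= l j) ->
  [/\ turning (flat_core p sigma l N) (core_length l N) (core_angle sigma l N),
      0 <= chord_x (core_angle sigma l N) (core_length l N),
      ((0 < N)%N -> 0 < chord_x (core_angle sigma l N) (core_length l N)) &
      chord_y (core_angle sigma l N) (core_length l N) = 0].
Proof.
elim: N => [|n IH] l0.
  have E : core_angle sigma l 0 = (fun=> 0) by apply/funext => s; rewrite /core_angle big_ord0.
  rewrite E core_length0; have [-> ->] := chord_seg (l 0%N); split=> //=; last exact: l0.
  by apply: turning_seg; exact: l0.
have [T1 X1 _ Y1] := IH (fun j jn => l0 j (leqW jn)).
have ln0 := l0 n.+1 (leqnn _).
have cT : continuous (fun s => signb (sigma n.+1) * Th s).
  by move=> s; apply: cvgM; [exact: cvg_cst|exact: (profile_continuous prof)].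
have [|T2 X2 Y2] := turning_concat (turning_loop (sigma n.+1)) (turning_seg ln0) cT
  (fun s _ => conj erefl erefl).
  move=> s /andP[s0 _]; rewrite (profile_ge1 prof) ?lerDl//.
  exact: congruent_2pi_signb.
have E s : core_angle sigma l n.+1 s =
    core_angle sigma l n s + signb (sigma n.+1) * Th (s - core_length l n).
  by rewrite /core_angle big_ord_recr.
have [||T3 X3 Y3] := turning_concat T1 T2 (@core_angle_continuous sigma l n.+1).
- move=> s /andP[_ sn]; rewrite E (profile_le0 prof) ?subr_le0// mulr0 addr0.
  by split.
- move=> s /andP[s0 _]; rewrite E (_ : core_length l n + s - core_length l n = s); last by ring.
  apply: congruent_2pi_addl; last by split.
  apply: congruent_2pi_sum => i _; rewrite (profile_ge1 prof); first exact: congruent_2pi_signb.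
  have := @core_length_lt l n.+1 i n l0; rewrite ltn_ord leqnSn => /(_ isT).
  by lra.
have [dx dy] := chord_loop (sigma n.+1); have [sx sy] := chord_seg (l n.+1).
rewrite core_lengthS -addrA; split=> //.
- by rewrite X3 X2 sx !addr_ge0// ltW.
- by move=> _; rewrite X3 X2 sx ltr_wpDl// ltr_pwDl.
- by rewrite Y3 Y2 Y1 dy sy !addr0.
Qed.

End Loops.
End FlatCoreAngle.

(** * Unit speed forces an affine change of parameter *)

Section Reparametrization.
Context {R : realType}.

(** The mean value theorem gives |psi y - psi x| = k (y - x) without any continuity of the
    derivative; injectivity makes [psi] monotone, which fixes one sign for all pairs. *)
Lemma slope_cst (psi : R -> R) (L k : R) : 0 < k ->
  {within `[0, L], continuous psi} ->
  (forall t, t \in `]0, L[ -> derivable psi t 1 /\ `|psi^`() t| = k) ->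
  {in `[0, L] &, injective psi} ->
  (forall x y, 0 <= x -> x <= y -> y <= L -> psi y - psi x = k * (y - x)) \/
  (forall x y, 0 <= x -> x <= y -> y <= L -> psi y - psi x = - (k * (y - x))).
Proof.
move=> k0 cpsi dpsi inj_psi.
have dist x y : 0 <= x -> x <= y -> y <= L -> `|psi y - psi x| = k * (y - x).
  move=> x0 xy' yL; have [->|xNy] := eqVneq x y; first by rewrite !subrr normr0 mulr0.
  have {xNy}xy : x < y by rewrite lt_neqAle xNy.
  have [||c' hc' E'] := @MVT R psi psi^`() x y xy.
  - move=> z; rewrite in_itv/= => /andP[xz zy].
    have /dpsi[d _] : z \in `]0, L[ by rewrite in_itv/= (le_lt_trans x0 xz) (lt_le_trans zy yL).
    by split; [exact: d|rewrite derive1E].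
  - by apply: continuous_subspaceW cpsi; apply: subset_itvScc; rewrite bnd_simp// ltW.
  move: hc'; rewrite in_itv/= => /andP[xc cy].
  have /dpsi[_ dk] : c' \in `]0, L[ by rewrite in_itv/= (le_lt_trans x0 xc) (lt_le_trans cy yL).
  by rewrite E' normrM dk (@ger0_norm _ (y - x))// subr_ge0 ltW.
have [mono|mono] := itv_continuous_inj_mono cpsi inj_psi; [left|right] => x y x0 xy yL;
  have xi : x \in `[0, L] by [rewrite in_itv/= x0 (le_trans xy)];
  have yi : y \in `[0, L] by [rewrite in_itv/= yL (le_trans x0)].
- rewrite -(dist x y)// ger0_norm// subr_ge0; move: xy; rewrite le_eqVlt => /predU1P[->//|xy].
  by rewrite ltW// mono.
- rewrite -(dist x y)// ler0_norm ?opprK// subr_le0; move: xy; rewrite le_eqVlt => /predU1P[->//|xy].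
  by rewrite ltW// mono.
Qed.

(** Unit speed on both sides forces the change of parameter to have slope 1 / r in absolute value,
    hence to be affine. *)
Lemma same_shape_moved (L h : R) (g : R -> 'rV[R]_2) c (th : R -> R) :
  0 < L -> 0 < h -> turning c h th -> (forall t, t \in `]0, L[ -> enorm (g^`() t) = 1) ->
  same_shape L g c ->
  exists r Q b al a0, [/\ 0 < r, Q *m Q^T = 1%:M,
    (al = r^-1 /\ a0 = 0) \/ (al = - r^-1 /\ a0 = h), L = r * h &
    forall t, 0 <= t <= L -> g t = moved r al a0 Q b th t].
Proof.
move=> L0 h0 [loc hic _ cth ptc] ng [S [psi [[r [Q [b [r0 QQ SE]]]] [psi_bij cpsi dpsi] gE]]].
rewrite loc hic in psi_bij; have [psi_fun psi_inj psi_surj] := psi_bij.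
have psi_itv t : 0 <= t <= L -> 0 <= psi t <= h.
  by move=> ht; have := psi_fun t; rewrite /= !in_itv/=; apply.
have gE' t : 0 <= t <= L -> g t = r *: (plane_curve th (psi t) *m Q) + b.
  by move=> ht; rewrite gE ?in_itv// SE ptc// psi_itv.
have rN0 : r != 0 by rewrite gt_eqF.
have slope t : t \in `]0, L[ -> derivable psi t 1 /\ `|psi^`() t| = r^-1.
  move=> ht; have [dp _] := dpsi t ht; split=> //.
  have dp1 : is_derive t (1 : R) psi (psi^`() t) by split; [exact: dp|rewrite derive1E].
  have dg : is_derive t (1 : R) g
      ((r * psi^`() t) *: (vec2 (cos (th (psi t))) (sin (th (psi t))) *m Q)).
    apply: (@near_eq_is_derive _ _ _ (fun t => r *: (plane_curve th (psi t) *m Q) + b)).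
      have := ht; rewrite in_itv/= => /near_itvoo; apply: filterS => s /andP[s0 sL].
      by rewrite gE'// !ltW.
    by apply: is_derive_rV2; exact: similar_curve_coord.
  have := ng t ht; rewrite (derive1_is_derive dg) enormZ enorm_mul// /enorm vec2_0 vec2_1.
  rewrite cos2Dsin2 sqrtr1 mulr1 normrM (ger0_norm (ltW r0)) => E.
  by apply: (mulfI rN0); rewrite E divff.
have inj_psi : {in `[0, L] &, injective psi}.
  by move=> x y xi yi; apply: psi_inj; rewrite inE.
have ri0 : 0 < r^-1 by rewrite invr_gt0.
(* Surjectivity is used at the two ends of [0, h]: with monotonicity it forces [psi] to map ends to
   ends. *)
have [z hz psiz] : exists2 z, 0 <= z <= L & psi z = 0.
  have := psi_surj 0; rewrite /= in_itv/= lexx (ltW h0) => /(_ isT)[z hz zE].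
  by exists z => //; move: hz; rewrite /= in_itv.
have [w hw psiw] : exists2 w, 0 <= w <= L & psi w = h.
  have := psi_surj h; rewrite /= in_itv/= lexx (ltW h0) => /(_ isT)[w hw wE].
  by exists w => //; move: hw; rewrite /= in_itv.
have /andP[z0 zL] := hz; have /andP[w0 wL] := hw.
have h0i : 0 <= (0 : R) <= L by rewrite lexx ltW.
have hLi : 0 <= L <= L by rewrite lexx ltW.
have /andP[p00 p0h] := psi_itv _ h0i; have /andP[pL0 pLh] := psi_itv _ hLi.
have [inc|dec] := slope_cst ri0 cpsi slope inj_psi.
- have hz' : 0 <= r^-1 * z by rewrite mulr_ge0// ltW.
  have hw' : 0 <= r^-1 * (L - w) by rewrite mulr_ge0 ?subr_ge0// ltW.
  have ez := inc 0 z (lexx 0) z0 zL; have ew := inc w L w0 wL (lexx L).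
  have psi0 : psi 0 = 0 by lra.
  have psiL : psi L = h by lra.
  exists r, Q, b, r^-1, 0; split; [exact: r0|exact: QQ|by left| |].
    have := inc 0 L (lexx 0) (ltW L0) (lexx L); rewrite psi0 psiL !subr0 => ->.
    by rewrite mulrA divff// mul1r.
  move=> t ht; have /andP[t0 tL] := ht; have := inc 0 t (lexx 0) t0 tL; rewrite psi0 !subr0 => E.
  have psit : psi t = r^-1 * t + 0 by rewrite E addr0.
  by rewrite (gE' t ht) /moved psit.
- have hw' : 0 <= r^-1 * w by rewrite mulr_ge0// ltW.
  have hz' : 0 <= r^-1 * (L - z) by rewrite mulr_ge0 ?subr_ge0// ltW.
  have ew := dec 0 w (lexx 0) w0 wL; have ez := dec z L z0 zL (lexx L).
  have psi0 : psi 0 = h by lra.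
  have psiL : psi L = 0 by lra.
  exists r, Q, b, (- r^-1), h; split; [exact: r0|exact: QQ|by right| |].
    have := dec 0 L (lexx 0) (ltW L0) (lexx L); rewrite psi0 psiL subr0 sub0r => /oppr_inj ->.
    by rewrite mulrA divff// mul1r.
  move=> t ht; have /andP[t0 tL] := ht; have := dec 0 t (lexx 0) t0 tL; rewrite psi0 subr0 => E.
  have psit : psi t = - r^-1 * t + h by rewrite mulNr -E subrK.
  by rewrite (gE' t ht) /moved psit.
Qed.

End Reparametrization.

(** * Instability *)
Section Instability.
Context {R : realType}.
Variables (p : R) (Th ka : R -> R).
Hypothesis p1 : 1 < p.
Hypothesis prof : loop_profile Th ka.
Hypothesis angleE : {in `[0, 1], loop_angle p =1 Th}.

Lemma is_derive_dist (m s : R) : s != m ->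
  is_derive s (1 : R) (fun s => `|s - m|) (Num.sg (s - m)).
Proof.
rewrite neq_lt => /orP[sm|ms].
- rewrite ltr0_sg ?subr_lt0//.
  apply: (near_eq_is_derive _ (derive_affine_fun (-1) m s)).
  have : \forall t \near s, t < m by exact: lt_nbhsl.
  by apply: filterS => t tm; rewrite ltr0_norm ?subr_lt0// mulN1r opprB addrC.
- rewrite gtr0_sg ?subr_gt0//.
  apply: (near_eq_is_derive _ (derive_affine_fun 1 (- m) s)).
  have : \forall t \near s, m < t by exact: lt_nbhsr.
  by apply: filterS => t tm; rewrite gtr0_norm ?subr_gt0// mul1r.
Qed.

Lemma bent_kinked (sg m : R) (rest rest' : R -> R) (u la b : R) :
  (forall s : R, is_derive s (1 : R) rest (rest' s)) -> continuous rest' ->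
  kinked m (bent_angle Th sg m rest u la b) (bent_curv ka sg m rest' u la).
Proof.
move=> drest crest'; split.
- by move=> s; apply: (bent_angle_continuous prof drest).
(* Freezing the sign of s - m at -1 or 1 extends each one-sided curvature continuously across
   [m]. *)
- pose side (e s : R) := sg * (- la * e) * ka (1 - u - la * `|s - m|) + rest' s.
  have cside e : continuous (side e).
    move=> s; apply: cvgD; last exact: crest'.
    apply: cvgM; first exact: cvg_cst.
    apply: (@continuous_comp _ _ _ (fun s => 1 - u - la * `|s - m|) ka).
      exact: continuous_affine_norm.
    exact: (profile_curv_continuous prof).
  exists (side (-1)), (side 1); split=> // s sm; rewrite /bent_curv /side.
    by rewrite ltr0_sg// subr_lt0.
  by rewrite gtr0_sg// subr_gt0.
- move=> s sm.
  have darg : is_derive s (1 : R) (fun s => 1 - u - la * `|s - m|) (- (la * Num.sg (s - m))).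
    have d1 := deriveM_fun (derive_cst_fun la s) (is_derive_dist sm).
    apply: (is_derive_eq (deriveB_fun (derive_cst_fun (1 - u) s) d1)).
    by ring.
  have dT := @derive_comp_fun _ Th (fun s => 1 - u - la * `|s - m|) s _ _
    (profile_is_derive prof _) darg.
  have d1 := deriveM_fun (derive_cst_fun sg s) dT.
  apply: (is_derive_eq (deriveD_fun (deriveD_fun (derive_cst_fun b s) d1) (drest s))).
  by rewrite /bent_curv; ring.
Qed.

(* The loops at the positions where P holds are left unchanged; the remaining
   ones form the tent sg * Th (1 - |s - m|) centered at m. *)
Lemma tent_not_local_minimizer (L : R) (P0 P1 : 'rV[R]_2) (gamma : R -> 'rV[R]_2)
    (N : nat) sigma l (sg m x : R) (P : pred 'I_N) :
  0 < L -> A_pin p L P0 P1 gamma -> flat_core_form p L gamma N sigma l ->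
  sg = 1 \/ sg = -1 -> congruent_2pi x 0 ->
  0 <= m <= core_length l N -> m = 0 \/ 1 <= m ->
  m = core_length l N \/ m <= core_length l N - 1 ->
  (forall i s, P i -> 0 <= s <= core_length l N -> `|s - m| < 1 ->
    s <= core_length l i \/ core_length l i + 1 <= s) ->
  (forall s, 0 <= s <= core_length l N ->
    core_angle Th sigma l N s = sg * Th (1 - `|s - m|) +
      (\sum_(i < N | P i) signb (sigma i.+1) * Th (s - core_length l i) + x)) ->
  ~ local_minimizer p L P0 P1 gamma.
Proof.
move=> L0 [_ speed _ _] [N1 l0 shape] sgE x0 m0l mleft mright away angE.
set h := core_length l N in m0l mright away angE.
pose rest s := \sum_(i < N | P i) signb (sigma i.+1) * Th (s - core_length l i) + x.
pose rest' s := \sum_(i < N | P i) signb (sigma i.+1) * ka (s - core_length l i).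
have [T _ /(_ N1) X0 Y0] := flat_core_turning prof angleE sigma l0.
have h0 : 0 < h.
  have := @core_length_lt _ l N 0 N l0; rewrite N1 leqnn => /(_ isT).
  by have := core_length_ge0 l0 (leq0n N); rewrite -/h; lra.
have drest s : is_derive s (1 : R) rest (rest' s).
  have d1 : is_derive s (1 : R)
      (fun s => \sum_(i < N | P i) signb (sigma i.+1) * Th (s - core_length l i)) (rest' s).
    apply: (@is_derive_bigsum _ _ _ P
      (fun i t => signb (sigma i.+1) * Th (t - core_length l i))
      (fun i t => signb (sigma i.+1) * ka (t - core_length l i)) s) => i.
    exact: (shifted_loop_is_derive prof).
  by apply: (is_derive_eq (deriveD_fun d1 (derive_cst_fun x s))); rewrite addr0.
have crest' : continuous rest'.
  apply: continuous_bigsum => i s; apply: cvgM; first exact: cvg_cst.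
  apply: (@continuous_comp _ _ _ (fun s => s - core_length l i) ka).
    by apply: cvgB; [exact: cvg_id|exact: cvg_cst].
  exact: (profile_curv_continuous prof).
(* Within distance 1 of [m] every unchanged loop is either complete or not yet begun: its angle is a
   multiple of 2 pi and its curvature is 0. *)
have rest_flat s : 0 <= s <= h -> `|s - m| < 1 -> [/\ cos (rest s) = 1, sin (rest s) = 0 & rest' s = 0].
  move=> hs sm; have [c1 s1] : congruent_2pi (rest s) 0.
    apply: congruent_2pi_addl => //; apply: congruent_2pi_sum => i Pi.
    case: (away i s Pi hs sm) => si.
      by rewrite (profile_le0 prof) ?subr_le0// mulr0.
    rewrite (profile_ge1 prof); first exact: congruent_2pi_signb.
    by rewrite lerBrDl.
  rewrite c1 s1 cos0 sin0; split=> //; rewrite /rest' big1// => i Pi.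
  case: (away i s Pi hs sm) => si.
    by rewrite (profile_curv_le0 prof) ?subr_le0// mulr0.
  by rewrite (profile_curv_ge1 prof) ?mulr0// lerBrDl.
have angE' s : 0 <= s <= h -> congruent_2pi (core_angle Th sigma l N s) (bent_angle Th sg m rest 0 1 0 s).
  by move=> /angE ->; rewrite /bent_angle subr0 mul1r add0r -/(rest s).
have hX : prim (fun s => cos (bent_angle Th sg m rest 0 1 0 s)) h = chord_x (core_angle Th sigma l N) h.
  by apply: prim_ext => [|t /angE'[]//]; exact: ltW.
have hY : prim (fun s => sin (bent_angle Th sg m rest 0 1 0 s)) h = 0.
  by rewrite -[RHS]Y0; apply: prim_ext => [|t /angE'[]//]; exact: ltW.
have [r [Q [b [al [a0 [r0 QQ orient LE gE]]]]]] := same_shape_moved L0 h0 T speed shape.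
have la1 : 1 - 0 <= 1 :> R by rewrite subr0.
have energyE u la s := @bent_curv_energy _ _ _ prof p sg m h rest rest' p1 sgE rest_flat u la s.
have energyC u la : continuous (bent_energy ka p m rest' u la).
  by move=> s; exact: (bent_energy_continuous prof p1 crest').
apply: (moved_not_local_minimizer p1 r0 h0 QQ orient LE m0l
  (bent_kinked sg m 0 1 0 drest crest') (energyC 0 1)).
- by move=> s hs sm; exact: energyE.
- move=> t ht; rewrite (gE t ht) /moved.
  have /andP[ps0 psh] := reparam_itv r0 orient LE ht.
  set a := al * t + a0 in ps0 psh *.
  have -> // : plane_curve (core_angle Th sigma l N) a = plane_curve (bent_angle Th sg m rest 0 1 0) a.
  by apply: plane_curve_congr => // s /andP[s0 sp]; apply: angE'; rewrite s0 (le_trans sp).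
- move=> d d0.
  have [u [la [b' [la0 ula [hX' hY' hth hk hen]]]]] := bent_perturbation prof p1 sgE h0 m0l mleft mright
    drest crest' rest_flat X0 d0 hX hY.
  exists (bent_angle Th sg m rest u la b'), (bent_curv ka sg m rest' u la), (bent_energy ka p m rest' u la).
  split; [exact: bent_kinked|exact: energyC|by move=> s hs sm; exact: energyE|].
  by rewrite hX' hY' hX hY.
Qed.

End Instability.

(** * The three positions of the tent *)

Section UnstableCases.
Context {R : realType}.
Variables (p : R) (Th ka : R -> R).
Hypothesis p1 : 1 < p.
Hypothesis prof : loop_profile Th ka.
Hypothesis angleE : {in `[0, 1], loop_angle p =1 Th}.

Lemma profile_rev (t : R) : Th t = 2 * pi - Th (1 - t).
Proof. by rewrite (profile_sym prof) opprB addrC subrK. Qed.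

(** By the mirror symmetry of a loop, an opposite loop attached at t = 0 unwinds the angle exactly
    as the first one wound it up. *)
Lemma opposite_loops_tent (t : R) : Th (t + 1) - Th t = Th (1 - `|t|).
Proof.
have [t0|/ltW t0] := leP t 0.
  by rewrite (profile_le0 prof t0) subr0 ler0_norm// opprK addrC.
by rewrite (profile_ge1 prof) ?lerDr// ger0_norm// (profile_sym prof).
Qed.

Variables (L : R) (P0 P1 : 'rV[R]_2) (gamma : R -> 'rV[R]_2).
Variables (N : nat) (sigma : nat -> bool) (l : nat -> R).
Hypothesis L0 : 0 < L.
Hypothesis Apin : A_pin p L P0 P1 gamma.
Hypothesis form : flat_core_form p L gamma N sigma l.

Let N1 : (1 <= N)%N. Proof. by case: form. Qed.
Let l0 j : (j <= N)%N -> 0 <= l j. Proof. by case: form => _ + _; exact. Qed.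
Let h := core_length l N.

Lemma signb_pm1 (a : bool) : signb a = 1 :> R \/ signb a = -1 :> R.
Proof. by case: a; [left|right]. Qed.

Lemma initial_loop_unstable : l 0%N = 0 -> ~ local_minimizer p L P0 P1 gamma.
Proof.
move=> l00; pose i0 : 'I_N := Ordinal N1.
have E0 : core_length l i0 = 0 by rewrite core_length0.
have h1 : 1 <= h by have := @core_length_lt _ l N 0 N l0; rewrite N1 leqnn core_length0 l00 add0r; exact.
(* The first loop has its cut end at its start, so it is read backwards: Th s = 2 pi - Th (1 - s).
   This flips the sign of the tent and leaves a full turn, absorbed by the constant [x]. *)
apply: (@tent_not_local_minimizer _ _ _ _ p1 prof angleE L P0 P1 gamma N sigma l
  (- signb (sigma 1%N)) 0 (signb (sigma 1%N) * (2 * pi)) (fun i => i != i0)) => //.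
- by case: (signb_pm1 (sigma 1%N)) => ->; rewrite ?opprK; [right|left].
- exact: congruent_2pi_signb.
- by rewrite lexx (core_length_ge0 l0).
- by left.
- by right; rewrite subr_ge0.
- move=> i s ii0 /andP[s0 _]; rewrite subr0 ger0_norm// => s1; left.
  have i_gt0 : (0 < i)%N by rewrite lt0n.
  have := @core_length_lt _ l N 0 i l0; rewrite i_gt0 (ltnW (ltn_ord i)) core_length0 l00 add0r.
  by move=> /(_ isT); exact/le_trans/ltW.
- move=> s /andP[s0 _]; rewrite /core_angle (bigD1 i0)//= core_length0 l00 !subr0 ger0_norm//.
  by rewrite (profile_rev s); ring.
Qed.

Lemma final_loop_unstable : l N = 0 -> ~ local_minimizer p L P0 P1 gamma.
Proof.
move=> lN0; have NE : N.-1.+1 = N by rewrite prednK.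
have nN : (N.-1 < N)%N by rewrite NE.
pose i0 : 'I_N := Ordinal nN.
have E0 : h = core_length l i0 + 1.
  by rewrite /h -[in LHS]NE core_lengthS NE lN0 addr0.
have h1 : 1 <= h by have := core_length_ge0 l0 (ltnW nN); rewrite E0; lra.
(* The last loop ends at [h] and is already the left half of a tent: no sign change and no extra
   turn. *)
apply: (@tent_not_local_minimizer _ _ _ _ p1 prof angleE L P0 P1 gamma N sigma l
  (signb (sigma N)) h 0 (fun i => i != i0)) => //.
- exact: signb_pm1.
- by rewrite lexx andbT (le_trans ler01 h1).
- by right.
- by left.
- move=> i s ii0 /andP[_ sh]; rewrite ler0_norm ?subr_le0// => s1; right.
  have ilt : (i < N.-1)%N.
    by rewrite ltn_neqAle -ltnS NE ltn_ord andbT; move: ii0; rewrite -val_eqE.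
  have := @core_length_lt _ l N i N.-1 l0; rewrite ilt (ltnW nN) => /(_ isT).
  by move: s1; rewrite E0 /=; lra.
- move=> s /andP[_ sh]; rewrite /core_angle (bigD1 i0)//= NE addr0 ler0_norm ?subr_le0//.
  by rewrite -/h E0 /=; congr (_ * Th _ + _); ring.
Qed.

Lemma adjacent_loops_unstable j : (1 <= j < N)%N -> l j = 0 -> sigma j != sigma j.+1 ->
  ~ local_minimizer p L P0 P1 gamma.
Proof.
move=> /andP[j1 jN] lj0 sj; have jE : j.-1.+1 = j by rewrite prednK.
have iN : (j.-1 < N)%N by rewrite (leq_ltn_trans (leq_pred j)).
(* Ordinals count loops from 0, so loops j and j + 1 have indices j - 1 and j; they meet at
   [core_length l j] because [l j = 0]. *)
pose i0 : 'I_N := Ordinal iN; pose j0 : 'I_N := Ordinal jN.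
have E0 : core_length l j = core_length l j.-1 + 1 by rewrite -[in LHS]jE core_lengthS jE lj0 addr0.
have m1 : 1 <= core_length l j by have := core_length_ge0 l0 (ltnW iN); rewrite E0; lra.
have mh : core_length l j + 1 <= h by apply: (core_length_lt l0); rewrite jN leqnn.
have sE : signb (sigma j.+1) = - signb (sigma j) :> R.
  by move: sj; case: (sigma j); case: (sigma j.+1); rewrite /signb ?opprK.
apply: (@tent_not_local_minimizer _ _ _ _ p1 prof angleE L P0 P1 gamma N sigma l
  (signb (sigma j)) (core_length l j) 0 (fun i => (i != i0) && (i != j0))) => //.
- exact: signb_pm1.
- by apply/andP; split; move: m1 mh; rewrite /h; lra.
- by right.
- by right; rewrite lerBrDr.
- move=> i s /andP[ii0 ij0] _ sm.
  have [ij|ij|ij] := ltngtP i j.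
  + right; have ilt : (i < j.-1)%N.
      by rewrite ltn_neqAle -ltnS jE ij andbT; move: ii0; rewrite -val_eqE.
    have := @core_length_lt _ l N i j.-1 l0; rewrite ilt (ltnW iN) => /(_ isT).
    by move: sm; rewrite E0 ltr_norml => /andP[]; lra.
  + left; have := @core_length_lt _ l N j i l0; rewrite ij (ltnW (ltn_ord i)) => /(_ isT).
    by move: sm; rewrite ltr_norml => /andP[]; lra.
  + by move: ij0; rewrite -val_eqE /= ij eqxx.
- move=> s _; rewrite /core_angle (bigD1 i0)//= (bigD1 j0)/=; last first.
    by rewrite -val_eqE /= -[in X in X != _]jE neq_ltn ltnSn orbT.
  rewrite jE sE addr0 addrA -opposite_loops_tent E0; congr (_ + _).
  by rewrite (_ : s - _ + 1 = s - core_length l j.-1); ring.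
Qed.

End UnstableCases.

Theorem theorem2p13 (R : realType) (p L : R) (P0 P1 : 'rV[R]_2)
    (gamma : R -> 'rV[R]_2) :
  2 < p -> 0 < L -> enorm (P0 - P1) < L ->
  A_pin p L P0 P1 gamma ->
  flat_core_pinned_elastica p L P0 P1 gamma ->
  has_adjacent_opposite_loops p L gamma \/ loop_touches_endpoint p L gamma ->
  ~ local_minimizer p L P0 P1 gamma.
Proof.
move=> p2 L0 _ Apin _ unstable.
have p1 : 1 < p by apply: lt_trans p2; rewrite ltr1n.
have [Th [ka [prof angleE]]] := loop_profile_exists p2.
case: unstable => [[N [sigma [l [form [j [jN lj sj]]]]]]|[N [sigma [l [form [l0|lN]]]]]].
- exact: (adjacent_loops_unstable p1 prof angleE L0 Apin form jN lj sj).
- exact: (initial_loop_unstable p1 prof angleE L0 Apin form l0).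
- exact: (final_loop_unstable p1 prof angleE L0 Apin form lN).
Qed.
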